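(* Let $(S,\Sigma,\mu)$ be a measure space, let $\mathcal{E}=(E_s)_{s\in S}$ be a family of $\mathbb{C}$-Banach spaces, and let $p$ be a real number. Suppose that $\mu$ is $\sigma$-finite, that $\mathcal{E}$ is a discrete measurable family, and that $1\leq p<\infty$. Then the $L^p$ direct integral $L^p(\mathcal{E})$ is strictly plurisubharmonic if and only if $E_s$ is strictly plurisubharmonic for almost all $s\in S$.
   Context: Let $\bar{\mathbb{D}}\subset\mathbb{C}$ be the closed unit disc. A map defined on $\bar{\mathbb{D}}$ is holomorphic if it extends to a holomorphic map on a neighbourhood of $\bar{\mathbb{D}}$. A $\mathbb{C}$-Banach space $E$ is strictly plurisubharmonic if every holomorphic map $\gamma:\bar{\mathbb{D}}\to E$ whose image is contained in the unit sphere is constant. Direct integrals. Let $(S,\Sigma,\mu)$ be a measure space and $\mathcal{E}=(E_s)_{s\in S}$ a family of $\mathbb{K}$-Banach spaces ($\mathbb{K}=\mathbb{R}$ or $\mathbb{C}$; here $\mathbb{K}=\mathbb{C}$). Let $\Phi_{\mathcal{E}}=\{E_s : s\in S\}$ be the set of Banach spaces occurring in the family (so $s,t$ determine the same element iff $E_s=E_t$), equipped with the discrete $\sigma$-algebra (all subsets), and let $\Omega_{\mathcal{E}}=\coprod_{E\in\Phi_{\mathcal{E}}}E$, equipped with the disjoint union topology and its Borel $\sigma$-algebra. The family $\mathcal{E}$ is measurable if the map $S\to\Phi_{\mathcal{E}}$, $s\mapsto E_s$, is measurable. A section is an element $\sigma$ of $\Pi_{\mathcal{E}}=\prod_{s\in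 S}E_s$; it is measurable if, seen as a map $S\to\Omega_{\mathcal{E}}$, it is measurable, and strongly measurable if moreover the set of its non-zero values $\sigma(S)^*\subset\Omega_{\mathcal{E}}$ is separable. For $p\in[1,\infty]$ and a measurable section $\sigma$, $\|\sigma\|_p\in[0,\infty]$ is the $p$-norm of the function $s\mapsto\|\sigma(s)\|_{E_s}$, i.e. $\left(\int_S\|\sigma(s)\|_{E_s}^p\,d\mu(s)\right)^{1/p}$ if $p<\infty$ and the essential supremum if $p=\infty$. $\mathcal{L}^p(\mathcal{E})$ is the space of strongly measurable sections with $\|\sigma\|_p<\infty$, $\mathcal{N}(\mathcal{E})$ the space of strongly measurable sections equal to zero almost everywhere, and the $L^p$ direct integral is $L^p(\mathcal{E})=\mathcal{L}^p(\mathcal{E})/\mathcal{N}(\mathcal{E})$ with the norm $\|\cdot\|_p$. Discreteness: for $E\in\Phi_{\mathcal{E}}$ let $S_E=\{s\in S : E_s=E\}$. A measurable family $\mathcal{E}$ is discrete if $\mu(\{s\in S : \mu(S_{E_s})=0\})=0$. *)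

(* Defs.v *)
From HB Require Import structures.
From mathcomp Require Import all_boot all_order all_algebra.
From mathcomp Require Import complex.
From mathcomp Require Import all_classical all_reals ereal topology normedtype.
From mathcomp Require Import derive measure measurable_realfun lebesgue_measure.
From mathcomp Require Import lebesgue_integral exp ess_sup_inf hoelder.

Set Implicit Arguments.
Unset Strict Implicit.
Unset Printing Implicit Defensive.

Import Order.TTheory GRing.Theory Num.Theory.
Import numFieldNormedType.Exports.

Local Open Scope classical_set_scope.
Local Open Scope ring_scope.
Local Open Scope quotient_scope.

Section plurisubharmonic.
Context (R : realType) (V : normedModType R[i]).

Definition closed_disc : set R[i]^o := [set z | `|z| <= 1].

Definition holomorphic_on (U : set R[i]^o) (f : R[i]^o -> V) : Prop :=
  forall z, U z -> derivable f z 1.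

(* Maps on the closed disc are represented by total functions, whose values
   outside the disc are irrelevant. *)
Definition holomorphic_disc (gamma : R[i]^o -> V) : Prop :=
  exists (U : set R[i]^o) (f : R[i]^o -> V),
    [/\ open U, closed_disc `<=` U, holomorphic_on U f
      & forall z, closed_disc z -> f z = gamma z].

Definition strictly_psh : Prop :=
  forall gamma : R[i]^o -> V,
    holomorphic_disc gamma ->
    (forall z, closed_disc z -> `|gamma z| = 1) ->
    exists v : V, forall z, closed_disc z -> gamma z = v.

End plurisubharmonic.
Arguments strictly_psh {R} V.

(* The norm of a complex normed module takes its values in R[i]; rnorm is the
   same norm with values in R. *)
Definition rnorm (R : realType) (V : normedModType R[i]) (x : V) : R :=
  complex.Re `|x|.

Section rnorm.
Context (R : realType) (V : normedModType R[i]).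
Implicit Types x y : V.

Lemma rnormE x : `|x| = (rnorm x)%:C%C.
Proof. by rewrite /rnorm RRe_real// normr_real. Qed.

Lemma rnorm_ge0 x : 0 <= rnorm x.
Proof. by rewrite -ler0c -rnormE. Qed.

Lemma rnorm0 : rnorm (0 : V) = 0.
Proof. by rewrite /rnorm normr0. Qed.

Lemma rnorm_eq0 x : rnorm x = 0 -> x = 0.
Proof. by move=> x0; apply/normr0_eq0; rewrite rnormE x0. Qed.

Lemma ler_rnormD x y : rnorm (x + y) <= rnorm x + rnorm y.
Proof. by rewrite -lecR rmorphD/= -!rnormE ler_normD. Qed.

Lemma rnormZ (c : R[i]) x : rnorm (c *: x) = complex.Re `|c| * rnorm x.
Proof.
apply/(@complexI R); rewrite -[LHS]rnormE normrZ rmorphM/= -rnormE.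
by congr (_ * _); rewrite RRe_real// normr_real.
Qed.

Lemma rnorm_lt (x : V) (a : R) : (rnorm x < a) = (`|x| < a%:C%C).
Proof. by rewrite rnormE ltcR. Qed.

Lemma rnorm_continuous : continuous (@rnorm R V).
Proof.
move=> x; apply/cvgrPdist_lt => e e0.
near=> y.
have : `|x - y| < e%:C%C.
  near: y; apply: cvgr_dist_lt; first exact: cvg_id.
  by rewrite ltcR.
rewrite -rnorm_lt; apply: le_lt_trans.
rewrite ler_norml; apply/andP; split.
  rewrite lerNl opprB lerBlDr (_ : rnorm (x - y) = rnorm (y - x)).
    by apply: le_trans (ler_rnormD _ _); rewrite subrK.
  by rewrite /rnorm distrC.
by rewrite lerBlDr; apply: le_trans (ler_rnormD _ _); rewrite subrK.
Unshelve. all: by end_near. Qed.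

End rnorm.

Definition separable_set (T : topologicalType) (A : set T) : Prop :=
  exists D : set T, [/\ countable D, D `<=` A & A `<=` closure D].

Section family.
Context (R : realType) d (S : measurableType d).
Variable E : S -> completeNormedModType R[i].

Definition same_space (s t : S) : bool := `[< E s = E t >].

Lemma same_space_equiv : equiv_class_of same_space.
Proof.
split=> [s|s t|s t u]; rewrite /same_space; first exact/asboolP.
- by apply/asboolP/asboolP => ->.
- by move=> /asboolP -> /asboolP ->; apply/asboolP.
Qed.

Canonical same_space_equivrel := EquivRelPack same_space_equiv.

(* Universe constraints prevent the range of E from being used as a set in the
   sense of classical_sets; the set of the spaces which occur in the family is
   therefore represented by the quotient of S by equality of the fibres, to
   which it is in bijection. *)
Definition spaces : Type := {eq_quot same_space}.
HB.instance Definition _ := Choice.on spaces.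
HB.instance Definition _ := EqQuotient.on spaces.

Definition space_of (F : spaces) : completeNormedModType R[i] := E (repr F).

Lemma space_ofE (s : S) : E s = space_of (\pi_spaces s).
Proof.
have : s == repr (\pi_spaces s) %[mod spaces] by rewrite reprK.
by rewrite piE => /asboolP.
Qed.

Definition transport (V W : completeNormedModType R[i]) (e : V = W) (x : V) :
    W :=
  eq_rect V (fun U : completeNormedModType R[i] => U : Type) x W e.

Definition space_coprod : Type := {F : spaces & space_of F}.
HB.instance Definition _ := Topological.copy space_coprod
  {F : spaces & space_of F}.
HB.instance Definition _ := isPointed.Build space_coprod
  (existT _ (\pi_spaces point) (0 : space_of (\pi_spaces point))).

Definition borel_coprod := g_sigma_algebraType (@open space_coprod).

Definition measurable_family : Prop :=
  forall A : set spaces, measurable [set s | A (\pi_spaces s)].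

Definition section : Type := forall s, E s.

(* The section sigma seen as a map from S to the coproduct: the value at s is
   moved to the chosen representative of the class of E s along the equality of
   Banach spaces. *)
Definition to_coprod (sigma : section) (s : S) : space_coprod :=
  existT _ (\pi_spaces s) (transport (space_ofE s) (sigma s)).

Definition measurable_section (sigma : section) : Prop :=
  measurable_fun setT (to_coprod sigma : S -> borel_coprod).

Definition nonzero_values (sigma : section) : set space_coprod :=
  to_coprod sigma @` [set s | sigma s != 0].

Definition strongly_measurable (sigma : section) : Prop :=
  measurable_section sigma /\ separable_set (nonzero_values sigma).

Definition section_norm (mu : {measure set S -> \bar R}) (p : \bar R)
    (sigma : section) : \bar R :=
  'N[mu]_p[EFin \o (fun s => rnorm (sigma s))]%E.

Definition same_space_set (s : S) : set S := [set t | E t = E s].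

Definition discrete_family (mu : {measure set S -> \bar R}) : Prop :=
  mu [set s | mu (same_space_set s) = 0%E] = 0%E.

Lemma measurable_sectionP (sigma : section) :
  measurable_section sigma <->
  forall U : set space_coprod, open U -> measurable (to_coprod sigma @^-1` U).
Proof.
split=> [ms U oU|ms].
  rewrite -[X in measurable X]setTI; apply: ms => //.
  exact: sub_gen_smallest.
apply: (@measurability _ _ S borel_coprod setT _ (@open space_coprod)) => // _ [U oU <-].
by rewrite setTI; exact: ms.
Qed.

Lemma transportD (V W : completeNormedModType R[i]) (e : V = W) x y :
  transport e (x + y) = transport e x + transport e y.
Proof. by case: W / e. Qed.

Lemma transportZ (V W : completeNormedModType R[i]) (e : V = W) c x :
  transport e (c *: x) = c *: transport e x.
Proof. by case: W / e. Qed.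

Lemma transport0 (V W : completeNormedModType R[i]) (e : V = W) :
  transport e 0 = 0.
Proof. by case: W / e. Qed.

Lemma transport_eq0 (V W : completeNormedModType R[i]) (e : V = W) x :
  (transport e x == 0) = (x == 0).
Proof. by case: W / e. Qed.

Lemma transport_rnorm (V W : completeNormedModType R[i]) (e : V = W) x :
  rnorm (transport e x) = rnorm x.
Proof. by case: W / e. Qed.

Definition section0 : section := fun=> 0.
Definition section_opp (f : section) : section := fun s => - f s.
Definition section_add (f g : section) : section := fun s => f s + g s.
Definition section_scale (c : R[i]) (f : section) : section := fun s => c *: f s.

HB.instance Definition _ := gen_eqMixin section.
HB.instance Definition _ := gen_choiceMixin section.

Lemma sectionP (f g : section) : (forall s, f s = g s) -> f = g.
Proof. exact: functional_extensionality_dep. Qed.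

Fact section_addA : associative section_add.
Proof. by move=> f g h; apply: sectionP => s; exact: addrA. Qed.
Fact section_addC : commutative section_add.
Proof. by move=> f g; apply: sectionP => s; exact: addrC. Qed.
Fact section_add0 : left_id section0 section_add.
Proof. by move=> f; apply: sectionP => s; exact: add0r. Qed.
Fact section_addN : left_inverse section0 section_opp section_add.
Proof. by move=> f; apply: sectionP => s; exact: addNr. Qed.
HB.instance Definition _ := GRing.isZmodule.Build section
  section_addA section_addC section_add0 section_addN.

Fact section_scaleA a b f :
  section_scale a (section_scale b f) = section_scale (a * b) f.
Proof. by apply: sectionP => s; exact: scalerA. Qed.
Fact section_scale1 : left_id 1 section_scale.
Proof. by move=> f; apply: sectionP => s; exact: scale1r. Qed.
Fact section_scaleDr : right_distributive section_scale +%R.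
Proof. by move=> a f g; apply: sectionP => s; exact: scalerDr. Qed.
Fact section_scaleDl f : {morph section_scale^~ f : a b / a + b}.
Proof. by move=> a b; apply: sectionP => s; exact: scalerDl. Qed.
HB.instance Definition _ := GRing.Zmodule_isLmodule.Build R[i] section
  section_scaleA section_scale1 section_scaleDr section_scaleDl.

Lemma section_addE (f g : section) s : (f + g) s = f s + g s. Proof. by []. Qed.
Lemma section_oppE (f : section) s : (- f) s = - f s. Proof. by []. Qed.
Lemma section_scaleE c (f : section) s : (c *: f) s = c *: f s. Proof. by []. Qed.

Let cball (w : space_coprod) (n : nat) : set space_coprod :=
  existT (fun F => space_of F : Type) (projT1 w) @`
    [set y | `|projT2 w - y| < n.+1%:R^-1].

Let existT_inj (F : spaces) (x y : space_of F) :
  existT (fun F => space_of F : Type) F x = existT _ F y -> x = y.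
Proof.
by move=> e; have := projT2_eq e; rewrite (eq_irrelevance (projT1_eq e) erefl).
Qed.

Let cballE (F : spaces) (x y : space_of F) n :
  cball (existT _ F x) n (existT _ F y) <-> `|x - y| < n.+1%:R^-1.
Proof. by split=> [[z /= xz /existT_inj <-//]|xy]; exists y. Qed.

Let cball_ind n (P : forall (F G : spaces), space_of F -> space_of G -> Prop) :
  (forall F (x y : space_of F), `|x - y| < n.+1%:R^-1 -> P F F x y) ->
  forall F G (x : space_of F) (y : space_of G),
  cball (existT _ F x) n (existT _ G y) -> P F G x y.
Proof.
move=> HP F G x y [z /= xz e].
have FG : F = G by exact: (congr1 (@projT1 _ _) e).
by subst G; rewrite -(existT_inj e); exact: HP.
Qed.

Let open_cball w n : open (cball w n).
Proof.
case: w => F x; apply: existT_open_map => /=.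
by have := @ball_open _ (space_of F) x n.+1%:R^-1; rewrite -ball_normE.
Qed.

Let cball_refl w n : cball w n w.
Proof. by case: w => F x; apply/cballE; rewrite subrr normr0 invr_gt0. Qed.

Let cball_sym w n v : cball w n v -> cball v n w.
Proof.
case: w v => [F x] [G y].
move: F G x y; apply: cball_ind => F x y xy.
by apply/cballE; rewrite distrC.
Qed.

Let nbhs_cball (w : space_coprod) (n : nat) : nbhs w (cball w n).
Proof. by apply: open_nbhs_nbhs; split; [exact: open_cball|exact: cball_refl]. Qed.

Let half_lt (a b : R[i]) (n : nat) :
  a < (n.*2.+2)%:R^-1 -> b < (n.*2.+2)%:R^-1 -> a + b < n.+1%:R^-1.
Proof.
move=> an bn; apply: lt_le_trans (ltrD an bn) _.
rewrite -doubleS -muln2 natrM invfM -mulrDr.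
by rewrite -[X in X + X]mul1r -mulrDl mulfV ?mulr1.
Qed.

Let cball_triangle w n v u : cball w n.*2.+1 v -> cball v n.*2.+1 u -> cball w n u.
Proof.
case: w v u => [F x] [G y] [H z].
move: F G x y; apply: cball_ind => F x y xy.
move=> yz; move: F H y z yz x xy; apply: cball_ind => F y z yz x xy.
apply/cballE; rewrite -(subrK y x) -addrA; apply: le_lt_trans (ler_normD _ _) _.
exact: half_lt.
Qed.

Let cball_nbhs w N : nbhs w N -> exists n, cball w n `<=` N.
Proof.
case: w => F x; rewrite /nbhs/= => /nbhs_ballP[e /= e0 eN].
have [n ne] : exists n, (n.+1%:R^-1 : R[i]) < e.
  have e_real : e = (complex.Re e)%:C%C by rewrite RRe_real// gtr0_real.
  have Re0 : 0 < complex.Re e by rewrite -ltcR -e_real.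
  have [n] := ltr_add_invr Re0; rewrite add0r => ne; exists n.
  by rewrite e_real -(rmorph_nat (real_complex R)) -fmorphV ltcR.
exists n => v [y /= xy <-]; apply: eN; rewrite -ball_normE /=.
exact: lt_trans ne.
Qed.

Let to_coprodD (f g : section) s : to_coprod (f + g) s =
  existT _ (\pi_spaces s)
    (transport (space_ofE s) (f s) + transport (space_ofE s) (g s)).
Proof. by rewrite -transportD. Qed.

Let cballD (F G : spaces) (x x' : space_of F) (y y' : space_of G) n :
  cball (existT _ F x) n.*2.+1 (existT _ G y) ->
  cball (existT _ F x') n.*2.+1 (existT _ G y') ->
  cball (existT _ F (x + x')) n (existT _ G (y + y')).
Proof.
move=> xy; move: F G x y xy x' y'; apply: cball_ind => F x y xy x' y'.
move=> /cballE xy'; apply/cballE.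
rewrite opprD addrACA; apply: le_lt_trans (ler_normD _ _) _.
exact: half_lt.
Qed.

Let to_coprod_near (f g : section) s t n :
  cball (to_coprod f s) n.*2.+1 (to_coprod f t) ->
  cball (to_coprod g s) n.*2.+1 (to_coprod g t) ->
  cball (to_coprod (f + g) s) n (to_coprod (f + g) t).
Proof. by rewrite !to_coprodD; exact: cballD. Qed.

Let separable_weak (A D : set space_coprod) :
  countable D -> A `<=` closure D -> separable_set A.
Proof.
move=> cD AD.
pose c w n := get (A `&` cball w n).
exists (A `&` \bigcup_(w in D) range (c w)); split.
- apply: sub_countable (bigcup_countable cD _).
    by apply: subset_card_le; exact: subIsetr.
  by move=> w _; apply: card_image_le.
- exact: subIsetl.
move=> a Aa N /cball_nbhs[n nN].
have [w [Dw aw]] := AD _ Aa _ (nbhs_cball a n.*2.+1).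
have [Ac wc] : (A `&` cball w n.*2.+1) (c w n.*2.+1).
  by apply: (@getI _ _ a); split => //; exact: cball_sym.
exists (c w n.*2.+1); split; last by apply: nN; exact: cball_triangle wc.
by split=> //; exists w => //; exists n.*2.+1.
Qed.

Lemma measurable_section0 : measurable_family -> measurable_section 0.
Proof.
move=> mE; apply/measurable_sectionP => U oU.
have := mE [set F | U (existT _ F (0 : space_of F))]; congr measurable.
apply/seteqP; split=> s /=; by rewrite /to_coprod transport0.
Qed.

Lemma strongly_measurable0 : measurable_family -> strongly_measurable 0.
Proof.
move=> mE; split; first exact: measurable_section0.
rewrite (_ : nonzero_values 0 = set0); first by exists set0; split.
by rewrite -subset0 => w [s /= /eqP].
Qed.

Lemma countable_bigcup_measurable (I : Type) (D : set I) (F : I -> set S) :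
  countable D -> (forall i, D i -> measurable (F i)) ->
  measurable (\bigcup_(i in D) F i).
Proof.
move=> /countable_injP[f]; move=> finj mF.
have -> : \bigcup_(i in D) F i =
    \bigcup_n \bigcup_(i in [set i | D i /\ f i = n]) F i.
  apply/seteqP; split=> s; first by move=> [i Di Fi]; exists (f i) => //; exists i.
  by move=> [_ _ [i [Di _] Fi]]; exists i.
apply: bigcupT_measurable => n.
have [[i [Di fin]]|H] := pselect (exists i, D i /\ f i = n).
  rewrite (_ : [set _ | _] = [set i]); first by rewrite bigcup_set1; exact: mF.
  apply/seteqP; split=> [j [Dj fj]|_ ->//]; apply: finj; rewrite ?inE//.
  by rewrite fin.
rewrite (_ : [set _ | _] = set0) ?bigcup_set0//.
by rewrite -subset0 => i ?; apply: H; exists i.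
Qed.

Let rnorm_gt_measurable (f : section) (a : R) :
  measurable_section f -> measurable [set s | a < rnorm (f s)].
Proof.
pose U := [set w : space_coprod | a < rnorm (projT2 w : space_of (projT1 w))].
have oU : open U.
  apply/sigT_openP => F.
  have /continuousP rc := @rnorm_continuous R (space_of F).
  exact: (rc _ (@open_gt _ a)).
move=> /measurable_sectionP/(_ _ oU); congr measurable.
by apply/seteqP; split=> s /=; rewrite /U/= transport_rnorm.
Qed.

Lemma measurable_section_rnorm (f : section) :
  measurable_section f -> measurable_fun setT (fun s => rnorm (f s)).
Proof.
move=> mf; apply: (measurability _ (measurable_realfun.RGenOInfty.measurableE R)) => //.
move=> _ [_ [a ->] <-]; rewrite setTI.
rewrite (_ : _ @^-1` _ = [set s | a < rnorm (f s)]).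
  exact: rnorm_gt_measurable.
by apply/seteqP; split=> s /=; rewrite in_itv/= andbT.
Qed.

Let measurable_eq0 (f : section) :
  measurable_section f -> measurable [set s | f s = 0].
Proof.
move=> /(rnorm_gt_measurable 0) /measurableC; congr measurable.
apply/seteqP; split=> s /=; last by move=> ->; rewrite rnorm0 ltxx.
by move/negP; rewrite -leNgt => f0; apply/rnorm_eq0/le_anti; rewrite f0 rnorm_ge0.
Qed.

Lemma strongly_measurableD (f g : section) :
  strongly_measurable f -> strongly_measurable g -> strongly_measurable (f + g).
Proof.
move=> [/measurable_sectionP mf [Df [cDf _ fD]]].
move=> [/measurable_sectionP mg [Dg [cDg _ gD]]].
split.
  apply/measurable_sectionP => U oU.
  pose good w1 w2 : set nat := fun n => forall s, cball w1 n (to_coprod f s) ->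
    cball w2 n (to_coprod g s) -> U (to_coprod (f + g) s).
  have -> : to_coprod (f + g) @^-1` U =
      ([set s | f s = 0] `&` to_coprod g @^-1` U) `|`
      ([set s | g s = 0] `&` to_coprod f @^-1` U) `|`
      \bigcup_(w1 in Df) \bigcup_(w2 in Dg) \bigcup_(n in good w1 w2)
        (to_coprod f @^-1` cball w1 n `&` to_coprod g @^-1` cball w2 n).
    apply/seteqP; split => s /=; last first.
      move=> [[[fs0]|[gs0]]|[w1 _ [w2 _ [n]]]].
      - by rewrite to_coprodD fs0 transport0 add0r.
      - by rewrite to_coprodD gs0 transport0 addr0.
      - by move=> H [] /H; exact.
    have [fs0|fs0 Us] := eqVneq (f s) 0.
      by rewrite to_coprodD fs0 transport0 add0r; left; left.
    have [gs0|gs0] := eqVneq (g s) 0.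
      by move: Us; rewrite to_coprodD gs0 transport0 addr0; left; right.
    right.
    have [n nU] := cball_nbhs (open_nbhs_nbhs (conj oU Us)).
    set m := n.*2.+1.*2.+1.
    have [w1 [Dw1 fw1]] := fD _ (ex_intro2 _ _ s fs0 erefl) _
      (nbhs_cball _ m).
    have [w2 [Dw2 gw2]] := gD _ (ex_intro2 _ _ s gs0 erefl) _
      (nbhs_cball _ m).
    exists w1 => //; exists w2 => //; exists m; last by split; exact: cball_sym.
    move=> t ft gt; apply: nU; apply: to_coprod_near.
      exact: cball_triangle ft.
    exact: cball_triangle gt.
  apply: measurableU; first apply: measurableU.
  - by apply: measurableI; [exact/measurable_eq0/measurable_sectionP|exact: mg].
  - by apply: measurableI; [exact/measurable_eq0/measurable_sectionP|exact: mf].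
  - apply: countable_bigcup_measurable => // w1 _.
    apply: countable_bigcup_measurable => // w2 _.
    apply: bigcup_measurable => n _; apply: measurableI.
      by apply: mf; exact: open_cball.
    by apply: mg; exact: open_cball.
pose sum w1 w2 : set space_coprod :=
  [set w | exists F (x y : space_of F),
    [/\ w1 = existT _ F x, w2 = existT _ F y & w = existT _ F (x + y)]].
have sum1 w1 w2 : countable (sum w1 w2).
  have [[w sw]|H] := pselect (exists w, sum w1 w2 w).
    suff -> : sum w1 w2 = [set w] by exact: countable1.
    apply/seteqP; split=> [v|_ -> //].
    move: sw => [F [x [y [-> -> ->]]]] [G [x' [y' [e]]]].
    have FG : F = G by exact: (congr1 (@projT1 _ _) e).
    by subst G => /existT_inj <- ->; rewrite (existT_inj e).
  rewrite (_ : sum w1 w2 = set0)//.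
  by rewrite -subset0 => w ?; apply: H; exists w.
apply: (@separable_weak _ (Df `|` Dg `|`
  \bigcup_(w1 in Df) \bigcup_(w2 in Dg) sum w1 w2)).
  have cU (A B : set space_coprod) :
      countable A -> countable B -> countable (A `|` B).
    move=> cA cB; rewrite -bigcup2E; apply: bigcup_countable => //.
    by move=> [|[|i]] _.
  apply: (cU); first exact: cU.
  by apply: bigcup_countable => // w1 _; exact: bigcup_countable.
move=> _ [s /= fgs <-] N.
have [fs0|fs0] := eqVneq (f s) 0.
  move=> sN.
  have gs0 : g s != 0.
    by move: fgs; rewrite section_addE fs0 add0r.
  have := gD _ (ex_intro2 _ _ s gs0 erefl) N.
  rewrite to_coprodD fs0 transport0 add0r in sN.
  by move=> /(_ sN)[w [? ?]]; exists w; split=> //; left; right.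
have [gs0|gs0] := eqVneq (g s) 0.
  move=> sN.
  have := fD _ (ex_intro2 _ _ s fs0 erefl) N.
  rewrite to_coprodD gs0 transport0 addr0 in sN.
  by move=> /(_ sN)[w [? ?]]; exists w; split=> //; left; left.
move=> /cball_nbhs[n nN].
set m := n.*2.+1.
have [w1 [Dw1 fw1]] := fD _ (ex_intro2 _ _ s fs0 erefl) _ (nbhs_cball _ m).
have [w2 [Dw2 gw2]] := gD _ (ex_intro2 _ _ s gs0 erefl) _ (nbhs_cball _ m).
move: fw1 gw2 => [x /= fx xw1] [y /= gy yw2].
exists (existT _ (\pi_spaces s) (x + y)); split.
  right; exists w1 => //; exists w2 => //.
  by exists (\pi_spaces s), x, y.
apply: nN; rewrite to_coprodD; apply: cballD; exact/cballE.
Qed.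

Lemma strongly_measurableZ (c : R[i]) (f : section) :
  measurable_family -> strongly_measurable f -> strongly_measurable (c *: f).
Proof.
move=> mE [mf [D [cD _ fD]]].
have [->|c0] := eqVneq c 0; first by rewrite scale0r; exact: strongly_measurable0.
pose h (w : space_coprod) : space_coprod := existT _ (projT1 w) (c *: projT2 w).
have ch : continuous h.
  apply/continuousP => U /sigT_openP oU; apply/sigT_openP => F.
  have /continuousP sc := @scaler_continuous _ (space_of F) c.
  exact: (sc _ (oU F)).
have hE s : to_coprod (c *: f) s = h (to_coprod f s).
  by rewrite /h /= -transportZ.
split.
  apply/measurable_sectionP => U oU.
  have := (measurable_sectionP f).1 mf (h @^-1` U) (open_comp (in1W ch) oU).
  by congr measurable; apply/seteqP; split=> s /=; rewrite hE.
apply: (@separable_weak _ (h @` D)); first exact: (sub_countable (card_image_le _ _)).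
move=> _ [s /= cfs <-] N; rewrite hE => /ch hN.
have fs0 : f s != 0.
  by apply: contraNneq cfs => fs0; rewrite section_scaleE fs0 scaler0.
have [w [Dw Nw]] := fD _ (ex_intro2 _ _ s fs0 erefl) _ hN.
by exists (h w); split => //; exists w.
Qed.

End family.

Section Lnorm_mono.
Context d (T : measurableType d) (R : realType) (mu : {measure set T -> \bar R}).
Local Open Scope ereal_scope.

Lemma ae_le_Lnorm (p : \bar R) (f g : T -> R) : 1 <= p ->
  measurable_fun setT f -> measurable_fun setT g ->
  {ae mu, forall x, `|f x|%R <= `|g x|%R}%R ->
  'N[mu]_p[EFin \o f] <= 'N[mu]_p[EFin \o g].
Proof.
move=> + mf mg fg; rewrite unlock; case: p => [r|_|//].
  rewrite lee_fin => r1.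
  have mpow (h : T -> R) : measurable_fun setT h ->
      measurable_fun setT (EFin \o (fun x => `|h x| `^ r)%R : T -> \bar R).
    move=> mh; apply/measurable_EFinP.
    apply: (@measurableT_comp _ _ _ _ _ _ (@powR R ^~ r)) => //.
    exact: measurableT_comp.
  have int0 (h : T -> R) : 0 <= \int[mu]_x `|(EFin \o h) x| `^ r.
    by apply: integral_ge0 => x _; exact: poweR_ge0.
  apply: gt0_ler_poweR; rewrite ?in_itv/= ?int0 ?leey//.
    by rewrite invr_ge0 (le_trans _ r1).
  apply: ae_ge0_le_integral => //; [exact: mpow|exact: mpow|].
  apply: filterS fg => x fgx _ /=; rewrite lee_fin ge0_ler_powR ?nnegrE//.
  by rewrite (le_trans _ r1).
by case: ifPn => // mu0; apply: le_ess_sup; apply: filterS fg => x /=; rewrite lee_fin.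
Qed.

Lemma Lnorm_scale (p : \bar R) (p1 : 1 <= p) (f : T -> R) (a : R) :
  measurable_fun setT f -> finite_norm mu p f ->
  'N[mu]_p[EFin \o (fun x => a * f x)%R] = `|a|%:E * 'N[mu]_p[EFin \o f].
Proof.
move=> mf ff.
have fL : f \in Lfun mu p by apply/andP; split; rewrite inE.
exact: (LnormZ (Lfun_Sub p1 fL) a).
Qed.

End Lnorm_mono.

Section direct_integral.
Context (R : realType) d (S : measurableType d).
Variables (E : S -> completeNormedModType R[i]).
Variables (mu : {measure set S -> \bar R}) (p : \bar R).
Hypotheses (mE : measurable_family E) (p1 : (1 <= p)%E).
Implicit Types f g : section E.

Let p0 : (0 < p)%E. Proof. exact: lt_le_trans p1. Qed.

(* The proof arguments only serve to make closure under the vector space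
   operations inferable: the zero section is measurable only if the family is,
   and stability under addition relies on Minkowski's inequality. *)
Definition Lp_pred of measurable_family E & (1 <= p)%E : {pred section E} :=
  [pred f | `[< strongly_measurable f /\ (section_norm mu p f < +oo)%E >]].

Local Notation LpP := (Lp_pred mE p1).

Let mrnorm f : strongly_measurable f -> measurable_fun setT (fun s => rnorm (f s)).
Proof. by move=> [/measurable_section_rnorm]. Qed.

Lemma section_normD f g : strongly_measurable f -> strongly_measurable g ->
  (section_norm mu p (f + g)%R <= section_norm mu p f + section_norm mu p g)%E.
Proof.
move=> mf mg; apply: le_trans (eminkowski mu (mrnorm mf) (mrnorm mg) p1).
apply: ae_le_Lnorm => //.
- exact/mrnorm/strongly_measurableD.
- by apply: measurable_funD; exact: mrnorm.
- apply: aeW => s /=; rewrite !ger0_norm ?rnorm_ge0 ?addr_ge0 ?rnorm_ge0//.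
  exact: ler_rnormD.
Qed.

Lemma section_normZ c f : f \in LpP ->
  section_norm mu p (c *: f) = ((complex.Re `|c|%R)%:E * section_norm mu p f)%E.
Proof.
move=> /asboolP[mf ff].
rewrite -[complex.Re _]ger0_norm; last exact: (@rnorm_ge0 R R[i]^o c).
rewrite -Lnorm_scale//; last exact: mrnorm.
by apply: eq_Lnorm => s /=; rewrite -rnormZ.
Qed.

Lemma section_norm0 : section_norm mu p (0 : section E) = 0%E.
Proof.
rewrite /section_norm -[RHS](@Lnorm0 _ _ _ mu p); last by rewrite gt_eqF.
by apply: eq_Lnorm => s /=; rewrite rnorm0.
Qed.

Lemma Lp_submod_closed : submod_closed LpP.
Proof.
split.
  apply/asboolP; split; first exact: strongly_measurable0.
  by rewrite section_norm0 ltry.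
move=> c f g fL gL; have /asboolP[mf ff] := fL; have /asboolP[mg fg] := gL.
apply/asboolP; split.
  by apply: strongly_measurableD => //; exact: strongly_measurableZ.
apply: le_lt_trans (section_normD _ _) _ => //; first exact: strongly_measurableZ.
rewrite lte_add_pinfty// section_normZ// lte_mul_pinfty// lee_fin.
exact: (@rnorm_ge0 R R[i]^o c).
Qed.

HB.instance Definition _ :=
  GRing.isSubmodClosed.Build R[i] (section E) LpP Lp_submod_closed.

Definition Lp_sections : Type := {f : section E | f \in LpP}.
HB.instance Definition _ := SubChoice.on Lp_sections.
HB.instance Definition _ := [SubChoice_isSubLmodule of Lp_sections by <:].

Implicit Types u v : Lp_sections.

Definition null_sections : {pred Lp_sections} :=
  [pred u | `[< {ae mu, forall s, val u s = 0} >]].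

Lemma null_zmod_closed : zmod_closed null_sections.
Proof.
split; first by apply/asboolP; exact: aeW.
move=> u v /asboolP u0 /asboolP v0; apply/asboolP.
apply: filterS2 u0 v0 => s us vs.
have -> : val (u - v) = val u - val v by [].
by rewrite section_addE section_oppE us vs subr0.
Qed.
HB.instance Definition _ :=
  GRing.isZmodClosed.Build Lp_sections null_sections null_zmod_closed.

Definition Lp : Type := Quotient.quot null_sections.
HB.instance Definition _ := GRing.Zmodule.on Lp.
HB.instance Definition _ := EqQuotient.on Lp.

Lemma Lp_piP u v : reflect ({ae mu, forall s, val u s = val v s})
  (\pi_Lp u == \pi_Lp v).
Proof.
rewrite -(@Quotient.idealrBE _ null_sections u v).
have valB s : val (u - v) s = val u s - val v s by [].
apply: (iffP (asboolP _)); apply: filterS => s.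
  by rewrite valB => /eqP; rewrite subr_eq0 => /eqP.
by rewrite valB => ->; rewrite subrr.
Qed.

Definition Lp_scale (c : R[i]) (x : Lp) : Lp := \pi_Lp (c *: repr x).

Lemma pi_Lp_scale c u : Lp_scale c (\pi_Lp u) = \pi_Lp (c *: u).
Proof.
apply/eqP/Lp_piP; have /eqP/Lp_piP := reprK (\pi_Lp u).
apply: filterS => s us.
have valZ (w : Lp_sections) : val (c *: w) s = c *: val w s.
  by [].
by rewrite !valZ us.
Qed.

Lemma pi_LpD u v : \pi_Lp (u + v) = \pi_Lp u + \pi_Lp v.
Proof. exact: (@Quotient.pi_add _ null_sections). Qed.

Fact Lp_scaleA a b x : Lp_scale a (Lp_scale b x) = Lp_scale (a * b) x.
Proof.
elim/quotW: x => u.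
by rewrite (pi_Lp_scale b u) (pi_Lp_scale a) (pi_Lp_scale (a * b)) scalerA.
Qed.
Fact Lp_scale1 : left_id 1 Lp_scale.
Proof. by move=> x; elim/quotW: x => u; rewrite (pi_Lp_scale 1 u) scale1r. Qed.
Fact Lp_scaleDr : right_distributive Lp_scale +%R.
Proof.
move=> a x y; elim/quotW: x => u; elim/quotW: y => v.
by rewrite -pi_LpD (pi_Lp_scale a u) (pi_Lp_scale a v) (pi_Lp_scale a (u + v))
  scalerDr pi_LpD.
Qed.
Fact Lp_scaleDl x : {morph Lp_scale^~ x : a b / a + b}.
Proof.
move=> a b; elim/quotW: x => u.
by rewrite /= (pi_Lp_scale a u) (pi_Lp_scale b u) (pi_Lp_scale (a + b) u)
  scalerDl pi_LpD.
Qed.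
HB.instance Definition _ := GRing.Zmodule_isLmodule.Build R[i] Lp
  Lp_scaleA Lp_scale1 Lp_scaleDr Lp_scaleDl.

Definition Lp_norm (x : Lp) : R[i] :=
  (fine (section_norm mu p (val (repr x))))%:C%C.

Lemma section_norm_fin_num u : section_norm mu p (val u) \is a fin_num.
Proof.
have /asboolP[_ nu] := valP u.
by rewrite ge0_fin_numE//; exact: Lnorm_ge0.
Qed.

Lemma section_norm_ae u v : {ae mu, forall s, val u s = val v s} ->
  section_norm mu p (val u) = section_norm mu p (val v).
Proof.
have /asboolP[mu_ _] := valP u; have /asboolP[mv_ _] := valP v.
move=> uv; apply/eqP; rewrite eq_le; apply/andP; split; apply: ae_le_Lnorm => //;
  do ?[exact: mrnorm]; by apply: filterS uv => s ->.
Qed.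

Lemma Lp_norm_pi u :
  Lp_norm (\pi_Lp u) = (fine (section_norm mu p (val u)))%:C%C.
Proof.
by congr (fine _)%:C%C; apply/section_norm_ae/Lp_piP/eqP; exact: reprK.
Qed.

Fact ler_Lp_normD x y : Lp_norm (x + y) <= Lp_norm x + Lp_norm y.
Proof.
rewrite -[x]reprK -[y]reprK -pi_LpD !Lp_norm_pi -rmorphD lecR.
rewrite -fineD ?section_norm_fin_num// fine_le ?fin_numD ?section_norm_fin_num//.
have /asboolP[mx _] := valP (repr x); have /asboolP[my _] := valP (repr y).
exact: section_normD.
Qed.

Fact Lp_normZ c x : Lp_norm (c *: x) = `|c| * Lp_norm x.
Proof.
rewrite -[x]reprK [c *: _]pi_Lp_scale !Lp_norm_pi.
have -> : val (c *: repr x) = c *: val (repr x) by [].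
rewrite section_normZ; last exact: valP.
rewrite fineM ?section_norm_fin_num// rmorphM /=.
by congr (_ * _); rewrite RRe_real// normr_real.
Qed.

Fact Lp_norm_eq0 x : Lp_norm x = 0 -> x = 0.
Proof.
rewrite -[x]reprK Lp_norm_pi => /complexI fx0.
have /asboolP[mx _] := valP (repr x).
have nx0 : section_norm mu p (val (repr x)) = 0%E.
  by rewrite -[LHS]fineK ?section_norm_fin_num// fx0.
have x0 : {ae mu, forall s, val (repr x) s = 0}.
  have mrx := (measurable_EFinP setT _).2 (mrnorm mx).
  apply: filterS (Lnorm_eq0_eq0 mrx p0 nx0) => s /(_ I)[].
  exact: rnorm_eq0.
have pi0 : \pi_Lp (0 : Lp_sections) = 0.
  by apply: (addrI (\pi_Lp 0)); rewrite -pi_LpD !addr0.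
by rewrite -pi0; apply/eqP/Lp_piP; exact: x0.
Qed.

HB.instance Definition _ := Lmodule_isNormed.Build R[i] Lp
  ler_Lp_normD Lp_normZ Lp_norm_eq0.

Lemma Lp_normE u : `|\pi_Lp u| = (fine (section_norm mu p (val u)))%:C%C.
Proof. exact: Lp_norm_pi. Qed.

End direct_integral.

(* Main.v *)
Require Import Defs.
From HB Require Import structures.
From mathcomp Require Import all_boot all_order all_algebra.
From mathcomp Require Import complex.
From mathcomp Require Import all_classical all_reals ereal topology normedtype.
From mathcomp Require Import derive measure measurable_realfun lebesgue_measure.
From mathcomp Require Import lebesgue_integral exp ess_sup_inf hoelder numfun.
From mathcomp Require Import sequences trigo zify ring lra.

(** Let f be a holomorphic disc in the unit sphere of Lp. Comparison with the
    Poisson kernel gives |2 f 0 - f z| <= 1 for |z| <= 1/3, hence a sum of n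
    values of f at such points has norm n. Equality in Minkowski's inequality
    then forces, for almost every s, equality in the triangle inequality for
    the corresponding vectors of E s. These are values of a holomorphic map
    f_s, because f is the limit, with a geometric rate, of polynomials which
    interpolate it at roots of unity. Multiplying f_s by 1 + t G with G
    holomorphic and t small shows that |f_s| is constant near 0, and so is f_s
    when E s is strictly plurisubharmonic. A constant germ propagates through
    the disc.

    Integrals and the completeness of Lp are avoided: Cauchy's formula is
    proved in any normed space as a limit of means over 2 ^ j-th roots of
    unity, by running Goursat's bisection on trapezoid sums over dyadic grids.

    Conversely, discreteness and sigma-finiteness provide, for almost every s,
    a set A of finite positive measure on which the fibres are equal to E s,
    and normalized sections supported in A embed E s isometrically in Lp. *)

Set Implicit Arguments.
Unset Strict Implicit.
Unset Printing Implicit Defensive.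

Import Order.TTheory GRing.Theory Num.Theory.
Import numFieldNormedType.Exports.

Local Open Scope classical_set_scope.
Local Open Scope ring_scope.
Local Open Scope quotient_scope.

(** An element of [Lp] has no value at [s]: representatives are determined up to a null set which
    depends on the vector, so only countably many almost everywhere statements can be combined,
    while the disc is uncountable. This is why [f_s] is rebuilt from the values of [f] at the points
    w / 3, with w a 2 ^ j-th root of unity, and tested at the points w / 6. Any other point [z]
    brings its own null set, which is harmless because [f z = f 0] is proved for one [z] at a time.
    For p = 1 the norm is not strictly convex, so equality in Minkowski's inequality says nothing
    more than additivity of the fibre norms; the perturbation by 1 + t G is designed to exploit just
    this. The radius 1/3 is the one up to which the Poisson kernel, whose maximum is (1 + r) / (1 -
    r), stays below 2, so that it and its complement to 2 are both nonnegative weights. Placing the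
    nodes at radius 1/3 as well gives, with N = 2 ^ j nodes, an interpolation error of order N * 3 ^
    -N, small enough to be summed over the nodes. *)

Section complex_modulus.
Context (R : realType).
Implicit Types (c z w : R[i]) (x : R).

(** The norm on [R[i]] takes values in [R[i]], which is only partially ordered; a real-valued
    modulus lets [lra] and [nra] handle the estimates. *)
Definition cabs c : R := complex.Re `|c|.

Lemma cabsE c : `|c| = (cabs c)%:C%C.
Proof. exact: (@rnormE R R[i]^o c). Qed.

Lemma cabs_ge0 c : 0 <= cabs c.
Proof. exact: (@rnorm_ge0 R R[i]^o c). Qed.

Lemma cabsM c z : cabs (c * z) = cabs c * cabs z.
Proof. exact: (@rnormZ R R[i]^o c z). Qed.

Lemma ler_cabsD c z : cabs (c + z) <= cabs c + cabs z.
Proof. exact: (@ler_rnormD R R[i]^o c z). Qed.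

Lemma cabsN c : cabs (- c) = cabs c.
Proof. by rewrite /cabs normrN. Qed.

Lemma cabsC c z : cabs (c - z) = cabs (z - c).
Proof. by rewrite -opprB cabsN. Qed.

Lemma cabs0 : cabs 0 = 0. Proof. by rewrite /cabs normr0. Qed.

Lemma cabs1 : cabs 1 = 1. Proof. by rewrite /cabs normr1. Qed.

Lemma cabs_eq0 c : (cabs c == 0) = (c == 0).
Proof.
apply/eqP/eqP => [|->]; last exact: cabs0.
exact: (@rnorm_eq0 R R[i]^o c).
Qed.

Lemma cabs_gt0 c : (0 < cabs c) = (c != 0).
Proof. by rewrite lt0r cabs_eq0 cabs_ge0 andbT. Qed.

Lemma cabsV c : cabs c^-1 = (cabs c)^-1.
Proof. by apply: (@complexI R); rewrite -[LHS]cabsE normfV cabsE fmorphV. Qed.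

Lemma cabsX c n : cabs (c ^+ n) = cabs c ^+ n.
Proof. by elim: n => [|n IH]; rewrite ?expr0 ?cabs1// !exprS cabsM IH. Qed.

Lemma cabs_real x : cabs x%:C%C = `|x|.
Proof. by rewrite /cabs normc_def /= expr0n /= addr0 sqrtr_sqr. Qed.

Lemma cabs_sqr c : cabs c ^+ 2 = complex.Re c ^+ 2 + complex.Im c ^+ 2.
Proof. by apply: (@complexI R); rewrite -[RHS]/(_%:C%C) add_Re2_Im2 cabsE rmorphXn. Qed.

Lemma ler_Re_cabs c : `|complex.Re c| <= cabs c.
Proof.
rewrite -[leRHS]ger0_norm ?cabs_ge0// -ler_sqr ?nnegrE//.
by rewrite !real_normK ?num_real// cabs_sqr lerDl sqr_ge0.
Qed.

Lemma ler_cabsB c z : cabs c - cabs z <= cabs (c - z).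
Proof. by rewrite lerBlDr; apply: le_trans (ler_cabsD _ _); rewrite subrK. Qed.

Lemma ler_cabs_sum (I : Type) (r : seq I) (P : pred I) (F : I -> R[i]) :
  cabs (\sum_(i <- r | P i) F i) <= \sum_(i <- r | P i) cabs (F i).
Proof.
elim/big_rec2: _ => [|i y x _ h]; first by rewrite cabs0.
by apply: le_trans (ler_cabsD _ _) _; rewrite lerD2l.
Qed.

Lemma cabs_natr n : cabs n%:R = n%:R.
Proof. by rewrite -(rmorph_nat (real_complex R)) cabs_real normr_nat. Qed.

Lemma cabs_le_ReIm c : cabs c <= `|complex.Re c| + `|complex.Im c|.
Proof.
rewrite -ler_sqr ?nnegrE ?cabs_ge0 ?addr_ge0// cabs_sqr sqrrD.
rewrite !real_normK ?num_real// [leRHS]addrAC lerDl mulrn_wge0// mulr_ge0//.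
Qed.

Lemma cabs_conj c : cabs c^*%C = cabs c.
Proof.
apply/eqP; rewrite -(@eqrXn2 _ 2%N)// ?cabs_ge0// !cabs_sqr.
by case: c => a b /=; rewrite sqrrN.
Qed.

Lemma closed_discE z : closed_disc z <-> cabs z <= 1.
Proof. by rewrite /closed_disc /= cabsE -[1 in X in X <-> _](rmorph1 (real_complex R)) lecR. Qed.

End complex_modulus.

Section rnorm_extra.
Context (R : realType) (V : normedModType R[i]).
Implicit Types (u v : V) (c : R[i]).

Lemma rnormZc c v : rnorm (c *: v) = cabs c * rnorm v.
Proof. exact: rnormZ. Qed.

Lemma rnormN v : rnorm (- v) = rnorm v.
Proof. by rewrite /rnorm normrN. Qed.

Lemma rnormC u v : rnorm (u - v) = rnorm (v - u).
Proof. by rewrite -opprB rnormN. Qed.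

Lemma ler_rnormB u v : rnorm u - rnorm v <= rnorm (u - v).
Proof. by rewrite lerBlDr; apply: le_trans (ler_rnormD _ _); rewrite subrK. Qed.

Lemma ler_rnorm_sum (I : Type) (r : seq I) (P : pred I) (F : I -> V) :
  rnorm (\sum_(i <- r | P i) F i) <= \sum_(i <- r | P i) rnorm (F i).
Proof.
elim/big_rec2: _ => [|i y x _ h]; first by rewrite rnorm0.
by apply: le_trans (ler_rnormD _ _) _; rewrite lerD2l.
Qed.

Lemma rnormB_le u v a b : rnorm u <= a -> rnorm v <= b -> rnorm (u - v) <= a + b.
Proof.
by move=> ua vb; apply: le_trans (ler_rnormD _ _) _; rewrite rnormN lerD.
Qed.

Lemma cvg_rnormP (T : Type) (F : set_system T) {FF : Filter F} (u : T -> V) (l : V) :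
  u @ F --> l <-> forall e : R, 0 < e -> \forall t \near F, rnorm (u t - l) <= e.
Proof.
split=> [ul e e0|H].
  have e0' : (0 : R[i]) < e%:C%C by rewrite ltcR.
  move/cvgrPdist_le : ul => /(_ _ e0').
  apply: filterS => t; by rewrite rnormE lecR rnormC.
apply/cvgrPdist_le => e e0.
have eE : e = (complex.Re e)%:C%C by rewrite RRe_real// gtr0_real.
have : 0 < complex.Re e by rewrite -ltcR -eE.
by move=> /H; apply: filterS => t; rewrite eE rnormE lecR rnormC.
Qed.

Lemma cvg_rnorm (T : Type) (F : set_system T) {FF : Filter F} (u : T -> V) (l : V) :
  u @ F --> l -> rnorm (u t) @[t --> F] --> rnorm l.
Proof. by move=> ul; apply: (cvg_comp _ _ ul); exact: rnorm_continuous. Qed.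

End rnorm_extra.

Section complex_differentiability.
Context (R : realType) (V : normedModType R[i]).
Implicit Types (f : R[i]^o -> V) (z w : R[i]^o).

(** First order expansion with real [e] and [d], free of division by [w - z]; it is equivalent to
    [derivable f z 1] by [derivable_cdiffP]. *)
Definition cdiff f z := exists D : V, forall e : R, 0 < e -> exists2 d : R, 0 < d &
  forall w, cabs (w - z) < d -> rnorm (f w - f z - (w - z) *: D) <= e * cabs (w - z).

Lemma nbhs_cabs z (A : set R[i]^o) :
  nbhs z A <-> exists2 d : R, 0 < d & forall w, cabs (w - z) < d -> A w.
Proof.
split.
  move=> /nbhs_ballP[e /= e0 eA].
  have eE : e = (complex.Re e)%:C%C by rewrite RRe_real// gtr0_real.
  exists (complex.Re e); first by rewrite -ltcR -eE.
  move=> w wz; apply: eA; rewrite -ball_normE /=.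
  by rewrite eE cabsE ltcR cabsC.
move=> [d d0 dA]; apply/nbhs_ballP; exists d%:C%C; first by rewrite /= ltcR.
move=> w; rewrite -ball_normE /= cabsE ltcR cabsC; exact: dA.
Qed.

Lemma derivable_cdiffP f z : derivable f z 1 <-> cdiff f z.
Proof.
split.
  move=> /cvg_ex[/= D] /cvg_rnormP H; exists D => e /H.
  rewrite near_withinE => /nbhs_cabs[d d0 dH]; exists d => // w wd.
  have [->|wz] := eqVneq w z; first by rewrite !subrr scale0r subr0 rnorm0 cabs0 mulr0.
  have wz0 : w - z != 0 by rewrite subr_eq0.
  have /= := dH (w - z); rewrite subr0 => /(_ wd wz0).
  have -> : (w - z) *: 1 + z = w by rewrite /GRing.scale/= mulr1 subrK.
  have -> : (f w - f z - (w - z) *: D) =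
    (w - z) *: ((w - z)^-1 *: (f w - f z) - D).
    by rewrite scalerBr scalerA mulfV// scale1r.
  by rewrite rnormZc mulrC => h; rewrite ler_pM2r// cabs_gt0.
move=> [D HD]; apply/cvg_ex; exists D; apply/cvg_rnormP => e e0.
rewrite near_withinE; apply/nbhs_cabs.
have [d d0 dH] := HD _ e0; exists d => // h; rewrite subr0 => hd h0 /=.
have -> : h *: 1 + z = h + z by rewrite /GRing.scale/= mulr1.
have := dH (h + z); rewrite addrK => /(_ hd).
have -> : f (h + z) - f z - h *: D = h *: (h^-1 *: (f (h + z) - f z) - D).
  by rewrite scalerBr scalerA mulfV// scale1r.
by rewrite rnormZc mulrC ler_pM2r// cabs_gt0.
Qed.

Lemma cdiff_continuous f z : cdiff f z ->
  forall e : R, 0 < e -> exists2 d : R, 0 < d &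
  forall w, cabs (w - z) < d -> rnorm (f w - f z) <= e.
Proof.
move=> [D /(_ _ ltr01)[d d0 H]] e e0.
exists (Num.min d (e / (1 + rnorm D))).
  by rewrite lt_min d0 divr_gt0// ltr_pwDl// rnorm_ge0.
move=> w; rewrite lt_min => /andP[/H wd we].
rewrite -[f w - f z](subrK ((w - z) *: D)).
apply: le_trans (ler_rnormD _ _) _; rewrite rnormZc.
apply: le_trans (lerD wd (lexx _)) _.
rewrite mul1r -[X in X + _]mulr1 -mulrDr.
by move: we; rewrite ltr_pdivlMr ?ltr_pwDl ?rnorm_ge0// => /ltW.
Qed.

End complex_differentiability.

(** * Means over roots of unity *)

Section roots_of_unity.
Context (R : realType).
Implicit Types (x y : R) (j m n : nat).

Definition cis x : R[i] := (cos x +i* sin x)%C.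

Lemma cisD x y : cis (x + y) = cis x * cis y.
Proof. by rewrite /cis cosD sinD; apply/eqP; rewrite eq_complex /= !eqxx andTb addrC. Qed.

Lemma cis0 : cis 0 = 1.
Proof. by rewrite /cis cos0 sin0. Qed.

Lemma cabs_cis x : cabs (cis x) = 1.
Proof.
apply/eqP; rewrite -(@eqrXn2 _ 2%N)// ?cabs_ge0// cabs_sqr /=.
by rewrite cos2Dsin2 expr1n.
Qed.

Lemma ler_dist_cos x y : `|cos x - cos y| <= `|x - y|.
Proof.
wlog xy : x y / x <= y => [H|].
  by case: (leP x y) => [/H//|/ltW/H]; rewrite distrC [in leRHS]distrC.
have [z _ E] := @MVT_segment R cos (- sin) x y xy (fun z _ => is_derive_cos z)
  (continuous_subspaceT (@continuous_cos R)).
rewrite distrC E normrM [`|x - y|]distrC ler_piMl// normrN; exact: sin_max.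
Qed.

Lemma ler_dist_sin x y : `|sin x - sin y| <= `|x - y|.
Proof.
have := ler_dist_cos (pi / 2 - x) (pi / 2 - y).
rewrite !cosB cos_pihalf sin_pihalf !mul0r !mul1r !add0r => /le_trans; apply.
by rewrite (_ : _ - _ = y - x) 1?distrC//; ring.
Qed.

Lemma ler_dist_cis x y : cabs (cis x - cis y) <= 2 * `|x - y|.
Proof.
apply: le_trans (cabs_le_ReIm _) _ => /=.
by rewrite mulr_natl mulr2n lerD// ?ler_dist_cos// ler_dist_sin.
Qed.

Definition root2 j : R[i] := cis (pi *+ 2 / (2 ^ j)%:R).

Lemma root2X j m : root2 j ^+ m = cis (pi *+ 2 * (m%:R / (2 ^ j)%:R)).
Proof.
elim: m => [|m IH]; first by rewrite expr0 mul0r mulr0 cis0.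
by rewrite exprS IH -cisD; congr cis; rewrite -[m.+1%:R]natr1; ring.
Qed.

Lemma root2_order j : root2 j ^+ (2 ^ j) = 1.
Proof.
rewrite root2X divff ?mulr1; first by rewrite /cis cos2pi sin2pi.
by rewrite pnatr_eq0 expn_eq0.
Qed.

Lemma root2_half j : root2 j.+1 ^+ (2 ^ j) = -1.
Proof.
have -> : root2 j.+1 ^+ (2 ^ j) = cis (pi *+ 2 / 2).
  rewrite root2X; congr cis; rewrite expnS natrM; field.
  by rewrite pnatr_eq0 expn_eq0.
rewrite -(mulr_natr pi) mulfK// /cis cospi sinpi.
by apply/eqP; rewrite eq_complex /= oppr0 !eqxx.
Qed.

(** The order divides 2 ^ j, hence is some 2 ^ i. If i < j, the power of exponent 2 ^ (j - 1) would
    be 1, but it is -1 by [root2_half]. *)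
Lemma root2_prim j : (2 ^ j).-primitive_root (root2 j).
Proof.
have [m pm] := prim_order_exists (expn_gt0 2 j) (root2_order j).
case/(@dvdn_pfactor 2 m j isT) => i; rewrite leq_eqVlt => /orP[/eqP ->|ij] mE.
  by rewrite -[X in X.-primitive_root _]mE.
case: j ij pm => // j ij pm.
have : root2 j.+1 ^+ (2 ^ j) == 1.
  by rewrite -(prim_order_dvd pm) mE dvdn_exp2l.
by rewrite root2_half eqNr oner_eq0.
Qed.

Lemma cabs_root2 j : cabs (root2 j) = 1. Proof. exact: cabs_cis. Qed.

Lemma root2_neq0 j : root2 j != 0.
Proof. by rewrite -cabs_gt0 cabs_root2 ltr01. Qed.

Lemma root2S j : root2 j.+1 ^+ 2 = root2 j.
Proof.
rewrite root2X; congr cis; rewrite expnS natrM; field.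
by rewrite pnatr_eq0 expn_eq0.
Qed.

Lemma sum_root2 j k : (0 < k < 2 ^ j)%N ->
  \sum_(m < 2 ^ j) (root2 j ^+ m) ^+ k = 0.
Proof.
move=> /andP[k0 kj].
have k1 : root2 j ^+ k != 1.
  by rewrite -(prim_order_dvd (root2_prim j)) gtnNdvd.
under eq_bigr do rewrite -exprM mulnC exprM.
have := subrX1 (root2 j ^+ k) (2 ^ j).
rewrite -exprM mulnC exprM root2_order expr1n subrr => /esym/eqP.
by rewrite mulf_eq0 subr_eq0 (negbTE k1) => /eqP.
Qed.

(* The powers of root2 j.+1 cross from 1 to -1 in 2 ^ j steps of equal length. *)
Lemma root2_chord j : 8 / (2 ^ j.+2)%:R <= cabs (root2 j.+2 - (root2 j.+2)^-1).
Proof.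
have H : cabs ((root2 j.+1) ^+ (2 ^ j) - 1) <= (2 ^ j)%:R * cabs (root2 j.+1 - 1).
  rewrite subrX1 cabsM mulrC ler_wpM2r ?cabs_ge0//.
  apply: le_trans (ler_cabs_sum _ _ _) _.
  rewrite (eq_bigr (fun=> 1)) ?sumr_const ?card_ord// => i _.
  by rewrite cabsX cabs_root2 expr1n.
move: H; rewrite root2_half -opprD cabsN -[1 + 1]/(2%:R) cabs_natr -root2S => H.
have -> : root2 j.+2 - (root2 j.+2)^-1 = (root2 j.+2)^-1 * (root2 j.+2 ^+ 2 - 1).
  by rewrite mulrBr mulr1 expr2 mulKf ?root2_neq0.
rewrite cabsM cabsV cabs_root2 invr1 mul1r.
rewrite ler_pdivrMr ?ltr0n ?expn_gt0// !expnS !natrM.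
by move: H; nra.
Qed.

End roots_of_unity.

Section circle_average.
Context (R : realType) (V : lmodType R[i]).
Implicit Types (g : R[i] -> V).

(** Riemann sum of the mean of [g] over the unit circle, with respect to normalized arc length; it
    replaces that integral throughout. *)
Definition avg j g : V := (2 ^ j)%:R^-1 *: \sum_(m < 2 ^ j) g (root2 R j ^+ m).

Lemma avgD j g1 g2 : avg j (fun w => g1 w + g2 w) = avg j g1 + avg j g2.
Proof. by rewrite /avg big_split scalerDr. Qed.

Lemma avgZ j c g : avg j (fun w => c *: g w) = c *: avg j g.
Proof. by rewrite /avg -scaler_sumr !scalerA mulrC. Qed.

Lemma avgB j g1 g2 : avg j (fun w => g1 w - g2 w) = avg j g1 - avg j g2.
Proof.
rewrite -[- avg j g2]scaleN1r -avgZ -avgD.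
by congr (_ *: _); apply: eq_bigr => i _; rewrite scaleN1r.
Qed.

Lemma eq_avg j g1 g2 : (forall w, cabs w = 1 -> w ^+ (2 ^ j) = 1 -> g1 w = g2 w) ->
  avg j g1 = avg j g2.
Proof.
move=> H; congr (_ *: _); apply: eq_bigr => i _; apply: H.
  by rewrite cabsX cabs_root2 expr1n.
by rewrite -exprM mulnC exprM root2_order expr1n.
Qed.

Lemma avg_cst j v : avg j (fun=> v) = v.
Proof.
rewrite /avg sumr_const card_ord -[v *+ _]scaler_nat scalerA mulVf ?scale1r//.
Qed.

Lemma avg_sum j (I : Type) (r : seq I) (P : pred I) (G : I -> R[i] -> V) :
  avg j (fun w => \sum_(i <- r | P i) G i w) = \sum_(i <- r | P i) avg j (G i).
Proof. by rewrite /avg exchange_big scaler_sumr. Qed.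

End circle_average.

Lemma avg_scale (R : realType) (V : lmodType R[i]) j (g : R[i] -> R[i]) (v : V) :
  avg j (fun w => g w *: v) = avg (V := R[i]^o) j g *: v.
Proof. by rewrite /avg -scaler_suml scalerA. Qed.

Lemma rnorm_avg (R : realType) (V : normedModType R[i]) j (g : R[i] -> V) (M : R) :
  (forall w, cabs w = 1 -> rnorm (g w) <= M) -> rnorm (avg j g) <= M.
Proof.
move=> H; rewrite rnormZc cabsV cabs_natr ler_pdivrMl ?ltr0n ?expn_gt0//.
apply: le_trans (ler_rnorm_sum _ _ _) _.
rewrite mulr_natl -[X in _ *+ X]card_ord -sumr_const; apply: ler_sum => i _.
by apply: H; rewrite cabsX cabs_root2 expr1n.
Qed.

Lemma avg_orth (R : realType) j a b : (a < 2 ^ j)%N -> (b < 2 ^ j)%N ->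
  avg (V := R[i]^o) j (fun w => w ^+ a * w ^- b) = (a == b)%:R.
Proof.
move=> aj bj; have [->|ab] := eqVneq a b.
  rewrite (eq_avg (g2 := fun=> 1)) ?avg_cst// => w w1 _.
  by rewrite divff// expf_neq0// -cabs_gt0 w1 ltr01.
(* A positive exponent congruent to a - b modulo 2 ^ j, which is what matters for roots of unity:
   the first form serves when a < b, the second when b < a. *)
have Nab : (0 < 2 ^ j + a - b < 2 ^ j)%N || (0 < a - b < 2 ^ j)%N.
  by move: ab aj bj; lia.
have H k : (0 < k < 2 ^ j)%N -> avg (V := R[i]^o) j (fun w => w ^+ k) = 0.
  by move=> k0j; rewrite /avg sum_root2 ?scaler0.
case/orP: Nab => hk; rewrite mulr0n -(H _ hk); apply: eq_avg => w w1 wN.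
  by rewrite expfB ?exprD ?wN ?mul1r//; lia.
by rewrite expfB//; lia.
Qed.

(** * Discrete Goursat lemma *)

(** Each dyadic interval is one half of the preceding one; [a k] encodes the first k binary digits
    of [x], the supremum of the left endpoints. *)
Lemma dyadic_nested (R : realType) (a : nat -> nat) :
  (forall k, (a k).*2 <= a k.+1 <= (a k).*2.+1)%N ->
  exists x : R, forall k, (a k)%:R / (2 ^ k)%:R <= x <= (a k).+1%:R / (2 ^ k)%:R.
Proof.
move=> ha.
pose lo k : R := (a k)%:R / (2 ^ k)%:R; pose hi k : R := (a k).+1%:R / (2 ^ k)%:R.
have p2 k : (0 : R) < (2 ^ k)%:R by rewrite ltr0n expn_gt0.
have lo_mono : nondecreasing_seq lo.
  apply/nondecreasing_seqP => k; rewrite /lo expnS natrM invfM mulrA.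
  rewrite ler_pM2r ?invr_gt0// ler_pdivlMr// -natrM ler_nat muln2.
  by case/andP: (ha k).
have hi_mono : nonincreasing_seq hi.
  apply/nonincreasing_seqP => k; rewrite /hi expnS natrM invfM mulrA.
  rewrite ler_pM2r ?invr_gt0// ler_pdivrMr// -natrM ler_nat.
  by case/andP: (ha k) => _; lia.
have lohi k l : lo k <= hi l.
  have [kl|lk] := leqP k l.
    by apply: le_trans (lo_mono _ _ kl) _; rewrite ler_pM2r ?invr_gt0// ler_nat.
  apply: le_trans _ (hi_mono _ _ (ltnW lk)); rewrite ler_pM2r ?invr_gt0// ler_nat//.
exists (sup (range lo)) => k; apply/andP; split.
  apply: ub_le_sup; last by exists k.
  by exists (hi 0%N) => _ [l _ <-]; exact: lohi.
by apply: ge_sup; [exists (lo 0%N), 0%N | move=> _ [l _ <-]; exact: lohi].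
Qed.

(** Discrete Green formula: an interior edge is shared by two cells with opposite signs, so the sums
    telescope to the boundary. *)
Lemma sum_cells (V : zmodType) (H W : nat -> nat -> V) i0 i1 j0 j1 :
  (i0 <= i1)%N -> (j0 <= j1)%N ->
  \sum_(i0 <= i < i1) \sum_(j0 <= j < j1) (H i j + W i.+1 j - H i j.+1 - W i j) =
  \sum_(i0 <= i < i1) (H i j0 - H i j1) + \sum_(j0 <= j < j1) (W i1 j - W i0 j).
Proof.
move=> hi hj.
under eq_bigr => i _.
  under eq_bigr => j _.
    rewrite (_ : _ - W i j = - (H i j.+1 - H i j) + (W i.+1 j - W i j)); last first.
      by rewrite opprB addrACA addrA addrAC.
    over.
  rewrite big_split /= sumrN telescope_sumr// opprB.
  over.
rewrite big_split /= exchange_big /=; congr (_ + _).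
by apply: eq_bigr => j _; rewrite telescope_sumr.
Qed.

Section discrete_goursat.
Context (R : realType) (V : normedModType R[i]).
Variables (F : R[i]^o -> V) (Psi : R -> R -> R[i]) (L : R).
Hypothesis L0 : 0 < L.
Hypothesis PsiL : forall x y x' y', 0 <= x <= 1 -> 0 <= y <= 1 ->
  0 <= x' <= 1 -> 0 <= y' <= 1 ->
  cabs (Psi x y - Psi x' y') <= L * (`|x - x'| + `|y - y'|).
Hypothesis Fd : forall x y, 0 <= x <= 1 -> 0 <= y <= 1 -> cdiff F (Psi x y).

Definition grid n (i j : nat) : R[i] := Psi (i%:R / (2 ^ n)%:R) (j%:R / (2 ^ n)%:R).

(* Trapezoid rule for the integral of G dz on the segment [a, b]: being exact
   on affine functions, it makes the contribution of each grid cell vanish for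
   these. *)
Definition trap (G : R[i] -> V) (a b : R[i]) : V := ((b - a) / 2) *: (G a + G b).

Definition hedge G n i j := trap G (grid n i j) (grid n i.+1 j).
Definition vedge G n i j := trap G (grid n i j) (grid n i j.+1).
Definition cell G n i j :=
  hedge G n i j + vedge G n i.+1 j - hedge G n i j.+1 - vedge G n i j.

(** Dyadic square (a, b) of level [k], cut into cells of the grid of level k + m. Indexing by the
    number [m] of further subdivisions makes [blockS] an exact splitting on a single grid. *)
Definition block k a b m := \sum_(a * 2 ^ m <= i < a.+1 * 2 ^ m)
  \sum_(b * 2 ^ m <= j < b.+1 * 2 ^ m) cell F (k + m) i j.

Let split2 (f : nat -> V) a m :
  \sum_(a * 2 ^ m.+1 <= i < a.+1 * 2 ^ m.+1) f i =
  \sum_(a.*2 * 2 ^ m <= i < a.*2.+1 * 2 ^ m) f i +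
  \sum_(a.*2.+1 * 2 ^ m <= i < a.*2.+2 * 2 ^ m) f i.
Proof.
have -> : (a * 2 ^ m.+1 = a.*2 * 2 ^ m)%N by rewrite expnS mulnA muln2.
have -> : (a.+1 * 2 ^ m.+1 = a.*2.+2 * 2 ^ m)%N by rewrite expnS mulnA muln2 doubleS.
by rewrite -big_cat_nat//= leq_mul2r leqnSn orbT.
Qed.

Lemma blockS k a b m : block k a b m.+1 =
  block k.+1 a.*2 b.*2 m + block k.+1 a.*2 b.*2.+1 m +
  (block k.+1 a.*2.+1 b.*2 m + block k.+1 a.*2.+1 b.*2.+1 m).
Proof.
rewrite /block split2 -!big_split /= addSnnS.
by congr (_ + _); apply: eq_bigr => i _; rewrite split2.
Qed.

(** After removal of the affine part of [F], the remainder [G] is at most e * 2 L / 2 ^ k on the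
    square. Interior edges cancel, and 4 * 2 ^ m boundary edges of length at most L / 2 ^ (k + m)
    remain: the factor 2 ^ m disappears, so the bound is uniform in the mesh. *)
Lemma block_bound (e : R) k a b m (x y : R) (D : V) :
  0 <= e -> (a < 2 ^ k)%N -> (b < 2 ^ k)%N ->
  a%:R / (2 ^ k)%:R <= x <= a.+1%:R / (2 ^ k)%:R ->
  b%:R / (2 ^ k)%:R <= y <= b.+1%:R / (2 ^ k)%:R ->
  (forall w, cabs (w - Psi x y) <= 2 * L / (2 ^ k)%:R ->
    rnorm (F w - F (Psi x y) - (w - Psi x y) *: D) <= e * cabs (w - Psi x y)) ->
  rnorm (block k a b m) <= 8 * L ^+ 2 * e / (2 ^ k)%:R ^+ 2.
Proof.
move=> e0 ak bk xa yb HD.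
set z := Psi x y in HD *.
pose G w := F w - F z - (w - z) *: D.
(* A primitive of the affine part [F z + (w - z) *: D]. The trapezoid rule integrates the latter
   exactly, and the increments of [Q] cancel around a cell. *)
pose Q w := w *: F z + (w ^+ 2 / 2 - z * w) *: D.
have FE w : F w = G w + (F z + (w - z) *: D) by rewrite /G [F z + _]addrC addrA !subrK.
have trapG u v : trap F u v = trap G u v + (Q v - Q u).
  rewrite /trap (FE u) (FE v) addrACA scalerDr; congr (_ + _).
  rewrite addrACA -scalerDl -mulr2n -[F z *+ 2]scaler_nat /Q opprD [RHS]addrACA -!scalerBl.
  by rewrite scalerDr !scalerA; congr (_ *: _ + _ *: _); field.
have cancelQ (s t u v q0 q1 q2 q3 : V) :
    s + (q1 - q0) + (t + (q2 - q1)) - (u + (q2 - q3)) - (v + (q3 - q0)) =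
    s + t - u - v.
  have subACA (a1 a2 a3 a4 : V) : a1 + a2 - (a3 + a4) = a1 - a3 + (a2 - a4).
    by rewrite opprD addrACA.
  rewrite addrACA [X in X - _ = _]subACA subACA [q1 - q0 + _]addrC subrKA.
  by rewrite opprB [q2 - q0 + _]addrC subrKA subrr addr0.
have cellG n i j : cell F n i j = cell G n i j by rewrite /cell /hedge /vedge !trapG cancelQ.
have p2 j : (0 : R) < (2 ^ j)%:R by rewrite ltr0n expn_gt0.
set n := (k + m)%N.
have np : (2 ^ n)%:R = (2 ^ k)%:R * (2 ^ m)%:R :> R by rewrite /n expnD natrM.
have side (c i : nat) : (c < 2 ^ k)%N -> (c * 2 ^ m <= i <= c.+1 * 2 ^ m)%N ->
    (0 <= (i%:R : R) / (2 ^ n)%:R <= 1) /\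
    (c%:R / (2 ^ k)%:R <= (i%:R : R) / (2 ^ n)%:R <= c.+1%:R / (2 ^ k)%:R).
  move=> ck /andP[ci ic].
  have E (t : nat) : t%:R / (2 ^ k)%:R = (t * 2 ^ m)%:R / (2 ^ n)%:R :> R.
    by rewrite np natrM; field; rewrite !gt_eqF.
  rewrite divr_ge0 ?ler0n//= !E !ler_pM2r ?invr_gt0// !ler_nat ci ic; split=> //.
  rewrite ler_pdivrMr// mul1r ler_nat; apply: leq_trans ic _.
  by rewrite /n expnD leq_mul2r ck orbT.
have in01 (c : nat) (t : R) : (c < 2 ^ k)%N ->
    c%:R / (2 ^ k)%:R <= t <= c.+1%:R / (2 ^ k)%:R -> 0 <= t <= 1.
  move=> ck /andP[ct tc]; rewrite (le_trans _ ct) ?divr_ge0 ?ler0n//=.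
  by apply: le_trans tc _; rewrite ler_pdivrMr// mul1r ler_nat.
have dist (c : nat) (s t : R) : c%:R / (2 ^ k)%:R <= s <= c.+1%:R / (2 ^ k)%:R ->
    c%:R / (2 ^ k)%:R <= t <= c.+1%:R / (2 ^ k)%:R -> `|s - t| <= (2 ^ k)%:R^-1.
  have -> : c.+1%:R / (2 ^ k)%:R = c%:R / (2 ^ k)%:R + (2 ^ k)%:R^-1 :> R.
    by rewrite -natr1 mulrDl mul1r.
  by rewrite ler_norml => /andP[? ?] /andP[? ?]; apply/andP; split; lra.
have Gb i j : (a * 2 ^ m <= i <= a.+1 * 2 ^ m)%N -> (b * 2 ^ m <= j <= b.+1 * 2 ^ m)%N ->
    rnorm (G (grid n i j)) <= e * (2 * L / (2 ^ k)%:R).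
  move=> /(side _ _ ak)[i01 ia] /(side _ _ bk)[j01 jb].
  have h : cabs (grid n i j - z) <= 2 * L / (2 ^ k)%:R.
    apply: le_trans (PsiL i01 j01 (in01 _ _ ak xa) (in01 _ _ bk yb)) _.
    rewrite [2 * L]mulrC -mulrA ler_wpM2l ?(ltW L0)// [2 * _]mulr_natl mulr2n.
    by rewrite lerD ?(dist _ _ _ ia xa) ?(dist _ _ _ jb yb).
  by apply: le_trans (HD _ h) _; rewrite ler_wpM2l.
have step (i : nat) : i.+1%:R / (2 ^ n)%:R - i%:R / (2 ^ n)%:R = (2 ^ n)%:R^-1 :> R.
  by rewrite -natr1 mulrDl mul1r addrC addKr.
have stepL (s t : R) : s - t = (2 ^ n)%:R^-1 -> `|s - t| = (2 ^ n)%:R^-1.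
  by move=> ->; rewrite ger0_norm// invr_ge0 ler0n.
set K := L / (2 ^ n)%:R * (e * (2 * L / (2 ^ k)%:R)).
have trapb u v (c : R) : cabs (v - u) <= L / (2 ^ n)%:R ->
    rnorm (G u) <= c -> rnorm (G v) <= c -> rnorm (trap G u v) <= L / (2 ^ n)%:R * c.
  move=> uv uc vc; rewrite rnormZc cabsM cabsV cabs_natr -mulrA ler_pM ?cabs_ge0//.
    by rewrite mulr_ge0 ?rnorm_ge0// invr_ge0.
  rewrite ler_pdivrMl//; apply: le_trans (ler_rnormD _ _) _.
  by rewrite mulr_natl mulr2n lerD.
have cl (c i : nat) : (c * 2 ^ m <= i < c.+1 * 2 ^ m)%N ->
    (c * 2 ^ m <= i <= c.+1 * 2 ^ m)%N /\ (c * 2 ^ m <= i.+1 <= c.+1 * 2 ^ m)%N.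
  by move=> /andP[h1 h2]; split; lia.
have cl0 (c : nat) : (c * 2 ^ m <= c * 2 ^ m <= c.+1 * 2 ^ m)%N.
  by rewrite leqnn leq_mul2r leqnSn orbT.
have cl1 (c : nat) : (c * 2 ^ m <= c.+1 * 2 ^ m <= c.+1 * 2 ^ m)%N.
  by rewrite leqnn leq_mul2r leqnSn orbT.
have hb i j : (a * 2 ^ m <= i < a.+1 * 2 ^ m)%N ->
    (b * 2 ^ m <= j <= b.+1 * 2 ^ m)%N -> rnorm (hedge G n i j) <= K.
  move=> /cl[hi hi'] hj; apply: trapb; try exact: Gb.
  have [i01 _] := side _ _ ak hi; have [i01' _] := side _ _ ak hi'.
  have [j01 _] := side _ _ bk hj.
  apply: le_trans (PsiL i01' j01 i01 j01) _.
  by rewrite subrr normr0 addr0 stepL.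
have vb i j : (a * 2 ^ m <= i <= a.+1 * 2 ^ m)%N ->
    (b * 2 ^ m <= j < b.+1 * 2 ^ m)%N -> rnorm (vedge G n i j) <= K.
  move=> hi /cl[hj hj']; apply: trapb; try exact: Gb.
  have [i01 _] := side _ _ ak hi; have [j01 _] := side _ _ bk hj.
  have [j01' _] := side _ _ bk hj'.
  apply: le_trans (PsiL i01 j01' i01 j01) _.
  by rewrite subrr normr0 add0r stepL.
have sumb (c : nat) (f : nat -> V) :
    (forall i, (c * 2 ^ m <= i < c.+1 * 2 ^ m)%N -> rnorm (f i) <= K + K) ->
    rnorm (\sum_(c * 2 ^ m <= i < c.+1 * 2 ^ m) f i) <= (2 ^ m)%:R * (K + K).
  move=> fK; apply: le_trans (ler_rnorm_sum _ _ _) _.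
  apply: (@le_trans _ _ (\sum_(c * 2 ^ m <= i < c.+1 * 2 ^ m) (K + K))).
    by rewrite big_nat_cond [leRHS]big_nat_cond; apply: ler_sum => i /andP[/fK].
  by rewrite sumr_const_nat mulr_natl mulSn addnK.
have -> : block k a b m =
    \sum_(a * 2 ^ m <= i < a.+1 * 2 ^ m) \sum_(b * 2 ^ m <= j < b.+1 * 2 ^ m) cell G n i j.
  by apply: eq_bigr => i _; apply: eq_bigr => j _; exact: cellG.
rewrite /cell sum_cells; last 2 first.
- by rewrite leq_mul2r leqnSn orbT.
- by rewrite leq_mul2r leqnSn orbT.
apply: le_trans (ler_rnormD _ _) _.
have -> : 8 * L ^+ 2 * e / (2 ^ k)%:R ^+ 2 = (2 ^ m)%:R * (K + K) + (2 ^ m)%:R * (K + K).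
  by rewrite /K np; field; rewrite !gt_eqF.
apply: lerD; apply: sumb => i hi; apply: rnormB_le; by [exact: hb|exact: vb].
Qed.

(** On a fixed grid the sum need not vanish, so the bisection bears on [ok]: smallness relative to 4
    ^ -k for all fine enough meshes. A failure at level 0 would persist along squares shrinking to a
    point (x, y), against differentiability at [Psi x y]. *)
Lemma block_cvg : block 0 0 0 m @[m --> \oo] --> (0 : V).
Proof.
apply/cvg_rnormP => e e0.
pose ok k a b := exists m0, forall m, (m0 <= m)%N ->
  rnorm (block k a b m) <= e / (2 ^ k)%:R ^+ 2.
suff [m0 H] : ok 0%N 0%N 0%N.
  by exists m0 => // m /H; rewrite subr0 expr1n divr1.
apply: contrapT => nok.
have okS k a b : (forall u v : bool, ok k.+1 (u + a.*2)%N (v + b.*2)%N) -> ok k a b.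
  move=> H; have [m1 H1] := H false false; have [m2 H2] := H false true.
  have [m3 H3] := H true false; have [m4 H4] := H true true.
  exists (maxn (maxn m1 m2) (maxn m3 m4)).+1 => -[//|m]; rewrite ltnS !geq_max.
  move=> /andP[/andP[/H1 h1 /H2 h2] /andP[/H3 h3 /H4 h4]]; rewrite blockS.
  rewrite (_ : e / _ = e / (2 ^ k.+1)%:R ^+ 2 + e / (2 ^ k.+1)%:R ^+ 2 +
    (e / (2 ^ k.+1)%:R ^+ 2 + e / (2 ^ k.+1)%:R ^+ 2)); last first.
    by rewrite expnS natrM; field; rewrite pnatr_eq0 expn_eq0.
  by do 3 ?[apply: le_trans (ler_rnormD _ _) _; apply: lerD].
(* One bit per coordinate indexes the four subsquares; [get] picks one that is not [ok], which
   exists by [okS] when the parent is not [ok]. *)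
pose next k (ab : nat * nat) : nat * nat :=
  let uv := get [set uv : bool * bool | ~ ok k.+1 (uv.1 + ab.1.*2)%N (uv.2 + ab.2.*2)%N] in
  ((uv.1 + ab.1.*2)%N, (uv.2 + ab.2.*2)%N).
pose fix chain k : nat * nat := if k is k'.+1 then next k' (chain k') else (0%N, 0%N).
have chain_nok k : ~ ok k (chain k).1 (chain k).2.
  elim: k => [//|k IH] /=.
  apply: (@getPex _ [set uv : bool * bool |
    ~ ok k.+1 (uv.1 + (chain k).1.*2)%N (uv.2 + (chain k).2.*2)%N]).
  apply: contrapT => H; apply: IH; apply: okS => u v.
  by apply: contrapT => H'; apply: H; exists (u, v).
have b2 (u : bool) (x : nat) : (x.*2 <= u + x.*2 <= x.*2.+1)%N by case: u => /=; lia.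
have lt2 (f : nat -> nat) : f 0%N = 0%N -> (forall k, (f k).*2 <= f k.+1 <= (f k).*2.+1)%N ->
    forall k, (f k < 2 ^ k)%N.
  move=> f0 h; elim=> [|k IH]; first by rewrite f0.
  by have /andP[_ h2] := h k; rewrite expnS mul2n; apply: leq_ltn_trans h2 _; lia.
have s1 k : ((chain k).1.*2 <= (chain k.+1).1 <= (chain k).1.*2.+1)%N by exact: b2.
have s2 k : ((chain k).2.*2 <= (chain k.+1).2 <= (chain k).2.*2.+1)%N by exact: b2.
have l1 := lt2 (fun k => (chain k).1) erefl s1.
have l2 := lt2 (fun k => (chain k).2) erefl s2.
have [x xP] := @dyadic_nested R (fun k => (chain k).1) s1.
have [y yP] := @dyadic_nested R (fun k => (chain k).2) s2.
have x01 : 0 <= x <= 1 by have := xP 0%N; rewrite /= !divr1.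
have y01 : 0 <= y <= 1 by have := yP 0%N; rewrite /= !divr1.
have [D HD] := Fd x01 y01.
(* This tolerance turns the bound of [block_bound] into e / 4 ^ k, the threshold of [ok]. *)
have e'0 : 0 < e / (8 * L ^+ 2) by rewrite divr_gt0// mulr_gt0// exprn_gt0.
have [d d0 dH] := HD _ e'0.
have [k kd] : exists k, 2 * L / (2 ^ k)%:R < d.
  have dL0 : 0 < d / (2 * L) by rewrite divr_gt0// mulr_gt0.
  have [k hk] := ltr_add_invr dL0.
  exists k.+1; rewrite ltr_pdivrMr ?ltr0n ?expn_gt0//.
  move: hk; rewrite add0r ltr_pdivlMr ?mulr_gt0// ltr_pdivrMl// => hk.
  apply: lt_le_trans hk _; rewrite mulrC ler_pM2l// ler_nat.
  exact: (ltnW (ltn_expl _ _)).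
apply: (chain_nok k); exists 0%N => m _.
have -> : e / (2 ^ k)%:R ^+ 2 = 8 * L ^+ 2 * (e / (8 * L ^+ 2)) / (2 ^ k)%:R ^+ 2.
  by field; rewrite !gt_eqF ?ltr0n ?expn_gt0//.
apply: (@block_bound _ _ _ _ m x y D (ltW e'0) (l1 k) (l2 k) (xP k) (yP k)).
by move=> w wk; apply: dH; exact: le_lt_trans kd.
Qed.

End discrete_goursat.

(** * Cauchy's formula *)

Section products.
Context (R : realType) (V : normedModType R[i]).

Lemma derivable_scale (g : R[i]^o -> R[i]^o) (f : R[i]^o -> V) (x : R[i]^o) :
  derivable g x 1 -> derivable f x 1 -> derivable (fun t => g t *: f t) x 1.
Proof.
move=> dg df.
have gc : g (h *: (1 : R[i]^o) + x) @[h --> (0 : R[i]^o)^'] --> g x.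
  apply/cvg_rnormP => e e0.
  have [d d0 H] := cdiff_continuous ((derivable_cdiffP _ _).1 dg) e0.
  rewrite near_withinE; apply/nbhs_cabs; exists d => // h; rewrite subr0 => hd _.
  by rewrite [h *: _]mulr1; apply: H; rewrite addrK.
move: dg df => /cvg_ex[/= g' dg] /cvg_ex[/= f' df].
apply/cvg_ex; exists (g x *: f' + g' *: f x).
apply: cvg_trans (cvgD (cvgZ gc df) (cvgZ dg (cvg_cst (f x)))).
apply: near_eq_cvg; near=> h.
have E (k a b : R[i]) (u v : V) :
    a *: (k *: (u - v)) + (k * (a - b)) *: v = k *: (a *: u - b *: v).
  rewrite (scalerA a k) [a * k]mulrC -(scalerA k a) -(scalerA k (a - b) v) -scalerDr.
  by rewrite scalerBr scalerBl addrA subrK.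
exact: E.
Unshelve. all: by end_near. Qed.

Lemma cdiff_scale (g : R[i]^o -> R[i]^o) (f : R[i]^o -> V) (x : R[i]^o) :
  cdiff g x -> cdiff f x -> cdiff (fun t => g t *: f t) x.
Proof.
by move=> /derivable_cdiffP dg /derivable_cdiffP df; exact/derivable_cdiffP/derivable_scale.
Qed.

Lemma cdiff_inv_affine (a b x : R[i]^o) : a * x + b != 0 ->
  cdiff (fun t : R[i]^o => (a * t + b)^-1 : R[i]^o) x.
Proof.
move=> axb; apply/derivable_cdiffP.
apply: derivableV => //.
Qed.

End products.

Section cauchy_kernel.
Context (R : realType).
Implicit Types (z w : R[i]) (j : nat).

(** Cauchy kernel relative to normalized arc length: on the unit circle, dw / (2 i pi (w - z)) is w
    / (w - z) times d theta / (2 pi). *)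
Definition kern z w : R[i] := w / (w - z).

Lemma subr_kern_ge z w : cabs w = 1 -> 1 - cabs z <= cabs (w - z).
Proof. by move=> <-; exact: ler_cabsB. Qed.

Lemma subr_kern_neq0 z w : cabs z < 1 -> cabs w = 1 -> w - z != 0.
Proof.
move=> z1 w1; rewrite -cabs_gt0; apply: lt_le_trans (subr_kern_ge z w1).
by rewrite subr_gt0.
Qed.

Lemma cabs_kern z w : cabs z < 1 -> cabs w = 1 -> cabs (kern z w) <= (1 - cabs z)^-1.
Proof.
move=> z1 w1; rewrite /kern cabsM w1 mul1r cabsV lef_pV2 ?subr_kern_ge//.
  by rewrite posrE cabs_gt0 subr_kern_neq0.
by rewrite posrE subr_gt0.
Qed.

Lemma subr1X_neq0 z j : cabs z < 1 -> 1 - z ^+ (2 ^ j) != 0.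
Proof.
move=> z1; rewrite subr_eq0; apply/eqP => /(congr1 (@cabs R)).
rewrite cabs1 cabsX => /esym h.
by have := exprn_ilt1 (2 ^ j) (cabs_ge0 z) z1; rewrite h ltxx expn_eq0.
Qed.

(** At a 2 ^ j-th root of unity, (z / w) ^ (2 ^ j) no longer depends on [w], so a finite geometric
    sum gives the kernel exactly; [avg_orth] then computes its mean. *)
Lemma kern_geom z w j : cabs z < 1 -> cabs w = 1 -> w ^+ (2 ^ j) = 1 ->
  kern z w = (1 - z ^+ (2 ^ j))^-1 * \sum_(n < 2 ^ j) z ^+ n * w ^- n.
Proof.
move=> z1 w1 wN; have w0 : w != 0 by rewrite -cabs_gt0 w1 ltr01.
apply: (mulfI (subr1X_neq0 j z1)); rewrite mulVKf ?subr1X_neq0//.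
apply: (mulIf (subr_kern_neq0 z1 w1)); rewrite /kern -mulrA divfK ?subr_kern_neq0//.
under eq_bigr do rewrite -exprVn -exprMn.
have := subrX1 (z / w) (2 ^ j); rewrite exprMn exprVn wN invr1 mulr1 => E.
rewrite -[1 - _]opprB E.
have -> : w - z = - (w * (z / w - 1)) by rewrite mulrBr mulrC divfK// mulr1 opprB.
ring.
Qed.

Lemma avg_kern z j : cabs z < 1 ->
  avg (V := R[i]^o) j (kern z) = (1 - z ^+ (2 ^ j))^-1.
Proof.
move=> z1; rewrite (@eq_avg _ _ _ _ (fun w => \sum_(n < 2 ^ j)
    ((1 - z ^+ (2 ^ j))^-1 * z ^+ n) *: (w ^+ 0 * w ^- n : R[i]^o))); last first.
  move=> w w1 wN; rewrite (@kern_geom _ _ j)// mulr_sumr.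
  by apply: eq_bigr => n _; rewrite expr0 mul1r /GRing.scale/= mulrA.
rewrite avg_sum (bigD1 (Ordinal (expn_gt0 2 j : (0 < 2 ^ j)%N)))//=.
rewrite avgZ avg_orth ?expn_gt0// eqxx expr0 mulr1 /GRing.scale/= mulr1.
rewrite big1 ?addr0// => n n0; rewrite avgZ avg_orth ?expn_gt0//.
rewrite (_ : (0 == n)%N = false) ?scaler0//.
by apply: contraNF n0 => /eqP h; apply/eqP/val_inj.
Qed.

Lemma cvg_avg_kern z : cabs z < 1 ->
  avg (V := R[i]^o) j (kern z) @[j --> \oo] --> (1 : R[i]^o).
Proof.
move=> z1; apply/cvg_rnormP => e e0.
have : (cabs z ^+ j) @[j --> \oo] --> 0 by apply: cvg_expr; rewrite ger0_norm ?cabs_ge0.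
have e'0 : 0 < e * (1 - cabs z) by rewrite mulr_gt0// subr_gt0.
move=> /cvgrPdist_le/(_ _ e'0); apply: filterS => j.
rewrite sub0r normrN ger0_norm ?exprn_ge0 ?cabs_ge0// => h.
rewrite avg_kern//; set x := z ^+ _.
have x1 : 1 - x != 0 by exact: subr1X_neq0.
have -> : (1 - x)^-1 - 1 = x / (1 - x) by field.
have xz : cabs x <= cabs z ^+ j.
  rewrite cabsX ler_wiXn2l ?cabs_ge0 ?ltW//; exact: ltnW (ltn_expl _ _).
rewrite -[rnorm _]/(cabs _) cabsM cabsV ler_pdivrMr ?cabs_gt0//.
apply: le_trans xz _; apply: le_trans h _; rewrite ler_wpM2l ?(ltW e0)//.
apply: le_trans (ler_cabsB _ _); rewrite cabs1 lerB//.
apply: le_trans (_ : cabs z ^+ 1 <= _) => //.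
by rewrite /x cabsX ler_wiXn2l ?cabs_ge0 ?ltW// expn_gt0.
Qed.

End cauchy_kernel.

Section cauchy_formula.
Context (R : realType) (V : normedModType R[i]).
Implicit Types (f F : R[i]^o -> V) (z w : R[i]).

(** Cyclic summation by parts: the coefficient of [F] at a vertex is half the difference of the two
    neighbouring vertices, which is t * w ^ j times a factor independent of j. *)
Lemma trap_circle F z t w N : w != 0 -> w ^+ N = 1 ->
  \sum_(0 <= j < N) trap F (z + t * (w ^+ j - z)) (z + t * (w ^+ j.+1 - z)) =
  ((w - w^-1) / 2) *: \sum_(0 <= j < N) (t * w ^+ j) *: F (z + t * (w ^+ j - z)).
Proof.
move=> w0 wN; pose c j := z + t * (w ^+ j - z).
pose g j := (t * (w ^+ j - w ^+ j / w) / 2) *: F (c j).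
have shiftg : \sum_(0 <= j < N) g j.+1 = \sum_(0 <= j < N) g j.
  apply/eqP; rewrite -subr_eq0 -sumrB telescope_sumr//.
  by rewrite /g /c wN expr0 subrr.
transitivity (\sum_(0 <= j < N)
    ((t * (w ^+ j.+1 - w ^+ j) / 2) *: F (c j) + g j.+1)).
  apply: eq_bigr => j _; rewrite /trap -/(c j) -/(c j.+1) scalerDr.
  have -> : (c j.+1 - c j) / 2 = t * (w ^+ j.+1 - w ^+ j) / 2 by rewrite /c; ring.
  by congr (_ + _); rewrite /g exprS [w * _]mulrC mulfK.
rewrite big_split /= shiftg -big_split /= scaler_sumr.
apply: eq_bigr => j _; rewrite /g -scalerDl scalerA; congr (_ *: _).
by rewrite exprS; field.
Qed.

(** The unit circle is contracted towards [z] by w' = z + t (w - z). The form dw' / (w' - z) does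
    not depend on t, so [kern z w] is the weight on every contracted circle. Goursat's lemma on the
    region swept out compares t with 1; for small t, continuity at [z] and [cvg_avg_kern]
    conclude. *)
Lemma cauchy_avg f z : cabs z < 1 -> (forall w, cabs w <= 1 -> cdiff f w) ->
  avg j (fun w => kern z w *: f w) @[j --> \oo] --> f z.
Proof.
move=> z1 fd.
have kern0 : 0 < (1 - cabs z)^-1 by rewrite invr_gt0 subr_gt0.
have contract (t : R) : 0 < t <= 1 ->
    avg j (fun w => kern z w *: (f w - f (z + t%:C%C * (w - z)))) @[j --> \oo] --> (0 : V).
  move=> /andP[t0 t1].
  pose F w : V := (1 * w + - z)^-1 *: f w.
  (* [T] maps [0, 1] onto [t, 1], which keeps the swept region away from the pole [z] of [F]. *)
  pose T (x : R) : R := t + (1 - t) * x.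
  pose Psi (x y : R) : R[i] := z + (T x)%:C%C * (cis (pi *+ 2 * y) - z).
  have T01 x : 0 <= x <= 1 -> t <= T x <= 1.
    by move=> /andP[x0 x1]; rewrite /T; apply/andP; split; nra.
  have cis2 y : cabs (cis (pi *+ 2 * y) - z) <= 2.
    apply: le_trans (ler_cabsD _ _) _; rewrite cabsN cabs_cis.
    by rewrite -[2]/(1 + 1) lerD2l ltW.
  pose L : R := 2 + 2 * (pi *+ 2).
  have L0 : 0 < L by rewrite addr_gt0// mulr_gt0// mulrn_wgt0// pi_gt0.
  have PsiL x y x' y' : 0 <= x <= 1 -> 0 <= y <= 1 ->
      0 <= x' <= 1 -> 0 <= y' <= 1 ->
      cabs (Psi x y - Psi x' y') <= L * (`|x - x'| + `|y - y'|).
    move=> x01 _ /T01/andP[x'0 x'1] _.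
    have -> : Psi x y - Psi x' y' = ((1 - t) * (x - x'))%:C%C * (cis (pi *+ 2 * y) - z) +
        (T x')%:C%C * (cis (pi *+ 2 * y) - cis (pi *+ 2 * y')).
      have -> : (1 - t) * (x - x') = T x - T x' by rewrite /T; ring.
      by rewrite /Psi rmorphB /=; ring.
    apply: le_trans (ler_cabsD _ _) _; rewrite !cabsM !cabs_real.
    rewrite [leRHS]mulrDr; apply: lerD.
      rewrite mulrC ler_pM ?cabs_ge0//.
        by apply: le_trans (cis2 _) _; rewrite lerDl mulr_ge0// mulrn_wge0// pi_ge0.
      by rewrite normrM ler_piMl// ger0_norm ?subr_ge0// lerBlDr lerDl ltW.
    apply: le_trans (_ : 1 * (2 * (pi *+ 2 * `|y - y'|)) <= _).
      rewrite ler_pM ?cabs_ge0 ?normr_ge0//.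
        by rewrite ger0_norm// (le_trans _ x'0)// ltW.
      apply: le_trans (ler_dist_cis _ _) _.
      by rewrite -mulrBr normrM [`|_ *+ 2|]ger0_norm// mulrn_wge0// pi_ge0.
    by rewrite mul1r mulrA ler_wpM2r// lerDr.
  have Psi1 x y : 0 <= x <= 1 -> cabs (Psi x y) <= 1.
    move=> /T01/andP[tx x1]; have Tx0 := le_trans (ltW t0) tx.
    have -> : Psi x y = (1 - T x)%:C%C * z + (T x)%:C%C * cis (pi *+ 2 * y).
      by rewrite /Psi rmorphB rmorph1; ring.
    apply: le_trans (ler_cabsD _ _) _; rewrite !cabsM !cabs_real cabs_cis mulr1.
    rewrite !ger0_norm ?subr_ge0//.
    by have := ltW z1; have := cabs_ge0 z; nra.
  have Fd x y : 0 <= x <= 1 -> 0 <= y <= 1 -> cdiff F (Psi x y).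
    move=> x01 _; apply: (@cdiff_scale _ _ (fun w => (1 * w + - z)^-1)); last exact/fd/Psi1.
    apply: cdiff_inv_affine; rewrite mul1r /Psi addrAC subrr add0r mulf_neq0//.
      have /andP[tx _] := T01 _ x01.
      by rewrite -cabs_gt0 cabs_real normr_gt0 gt_eqF// (lt_le_trans t0).
    by rewrite subr_kern_neq0// cabs_cis.
  have blockE m : block F Psi 0 0 0 m = ((root2 R m - (root2 R m)^-1) / 2 * (2 ^ m)%:R) *:
      avg m (fun w => kern z w *: (f w - f (z + t%:C%C * (w - z)))).
    have N0 : (2 ^ m)%:R != 0 :> R by rewrite pnatr_eq0 expn_eq0.
    have N0c : (2 ^ m)%:R != 0 :> R[i] by rewrite pnatr_eq0 expn_eq0.
    rewrite /block !mul0n !mul1n add0n sum_cells//.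
    (* The sides y = 0 and y = 1 have the same image, [cis] being 2 pi periodic; only the two closed
       curves remain. *)
    rewrite big1 ?add0r; last first.
      move=> i _; rewrite /hedge /grid mul0r divff// /Psi mulr0 mulr1 cis0.
      by rewrite /cis cos2pi sin2pi subrr.
    have gridE (x : R) i j : i%:R / (2 ^ m)%:R = x ->
        grid Psi m i j = z + (T x)%:C%C * (root2 R m ^+ j - z).
      by move=> ix; rewrite /grid ix /Psi root2X.
    have vE (x : R) i : i%:R / (2 ^ m)%:R = x -> T x != 0 ->
        \sum_(0 <= j < 2 ^ m) vedge Psi F m i j =
        ((root2 R m - (root2 R m)^-1) / 2) *: \sum_(0 <= j < 2 ^ m)
          kern z (root2 R m ^+ j) *: f (z + (T x)%:C%C * (root2 R m ^+ j - z)).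
      move=> ix Tx0.
      rewrite (eq_bigr (fun j => trap F (z + (T x)%:C%C * (root2 R m ^+ j - z))
        (z + (T x)%:C%C * (root2 R m ^+ j.+1 - z)))); last first.
        by move=> j _; rewrite /vedge !(gridE x).
      rewrite trap_circle ?root2_neq0 ?root2_order//; congr (_ *: _).
      apply: eq_bigr => j _; rewrite /F scalerA; congr (_ *: _).
      rewrite mul1r addrAC subrr add0r /kern invfM mulrACA divff ?mul1r//.
      by rewrite -cabs_eq0 cabs_real normr_eq0.
    rewrite sumrB (vE 1) ?divff//; last by rewrite /T mulr1 addrC subrK oner_eq0.
    rewrite (vE 0) ?mul0r//; last by rewrite /T mulr0 addr0 gt_eqF.
    rewrite -scalerBr /avg scalerA -[_ * _ * _^-1]mulrA divff// mulr1; congr (_ *: _).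
    rewrite -sumrB big_mkord; apply: eq_bigr => j _.
    by rewrite /T mulr1 mulr0 addr0 [t + _]addrC subrK rmorph1 mul1r [z + _]addrC subrK scalerBr.
  have /cvg_rnormP H := block_cvg L0 PsiL Fd.
  apply/cvg_rnormP => e /H [m0 _ {}H].
  (* [root2_chord] applies from level 2 on. It shows that the scalar in [blockE] has modulus at
     least 1, so the mean is bounded by the block. *)
  exists (m0 + 2)%N => // m /= mm; have := H m (leq_trans (leq_addr _ _) mm).
  rewrite !subr0 blockE rnormZc; apply: le_trans.
  rewrite ler_peMl ?rnorm_ge0//.
  have [k ->] : exists k, m = k.+2.
    by exists (m - 2)%N; move: mm; lia.
  rewrite !cabsM cabsV !cabs_natr.
  have := root2_chord R k; rewrite ler_pdivrMr ?ltr0n ?expn_gt0//.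
  set x := cabs _; set y := (2 ^ k.+2)%:R; move=> h.
  have -> : x / 2 * y = x * y / 2 by rewrite mulrAC.
  by rewrite ler_pdivlMr// mul1r; apply: le_trans h; rewrite ler_nat.
apply/cvg_rnormP => e e0.
have e'0 : 0 < e / 3 * (1 - cabs z) by rewrite mulr_gt0 ?divr_gt0 ?subr_gt0.
have [d d0 dH] := cdiff_continuous (fd z (ltW z1)) e'0.
(* Since |w - z| <= 2 on the circle, the contracted points lie within d / 2 of [z]. *)
pose t := Num.min 1 (d / 4).
have t01 : 0 < t <= 1 by rewrite lt_min ltr01 divr_gt0//= ge_min lexx.
have e3 : 0 < e / 3 by rewrite divr_gt0.
have /cvg_rnormP/(_ _ e3) H1 := contract t t01.
have e3' : 0 < e / 3 / (1 + rnorm (f z)) by rewrite divr_gt0// ltr_pwDl// rnorm_ge0.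
have /cvg_rnormP/(_ _ e3') H2 := cvg_avg_kern z1.
apply: filterS2 H1 H2 => j; rewrite subr0 => H1 H2.
have -> : avg j (fun w => kern z w *: f w) - f z =
    avg j (fun w => kern z w *: (f w - f (z + t%:C%C * (w - z)))) +
    avg j (fun w => kern z w *: (f (z + t%:C%C * (w - z)) - f z)) +
    (avg (V := R[i]^o) j (kern z) - 1) *: f z.
  rewrite scalerBl scale1r -avg_scale addrA; congr (_ - _).
  rewrite -!avgD; apply: eq_avg => w _ _.
  by rewrite -!scalerDr addrA !subrK.
have -> : e = e / 3 + e / 3 + e / 3 by field.
apply: le_trans (ler_rnormD _ _) _; apply: lerD.
  apply: le_trans (ler_rnormD _ _) _; apply: lerD => //.
  apply: rnorm_avg => w w1; rewrite rnormZc.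
  apply: le_trans (_ : (1 - cabs z)^-1 * (e / 3 * (1 - cabs z)) <= _).
    rewrite ler_pM ?cabs_ge0 ?rnorm_ge0 ?cabs_kern//; apply: dH.
    rewrite addrC addKr cabsM cabs_real; case/andP: t01 => t0 _.
    rewrite gtr0_norm//.
    have h2 : cabs (w - z) <= 2.
      by apply: le_trans (ler_cabsD _ _) _; rewrite cabsN w1 -[2]/(1 + 1) lerD2l ltW.
    have h4 : t <= d / 4 by rewrite ge_min lexx orbT.
    by have := cabs_ge0 (w - z); nra.
  by rewrite mulrC mulfK// gt_eqF// subr_gt0.
rewrite rnormZc; move: H2; rewrite -[rnorm _]/(cabs _) => H2.
apply: le_trans (ler_wpM2r (rnorm_ge0 _) H2) _.
rewrite -[leRHS]mulr1 -(mulrA (e / 3)) ler_wpM2l ?(ltW e3)// mulrC ler_pdivrMr ?mul1r ?lerDr//.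
by rewrite ltr_pwDl// rnorm_ge0.
Qed.

End cauchy_formula.

(** * Poisson kernel *)

Lemma eq_cvg_to (T : Type) (U : topologicalType) (F : set_system T) (f g : T -> U) (l : U) :
  f =1 g -> f @ F --> l -> g @ F --> l.
Proof. by move=> /funext ->. Qed.

Section real_average.
Context (R : realType).
Implicit Types (g : R[i] -> R).

Definition ravg j g : R := (2 ^ j)%:R^-1 * \sum_(m < 2 ^ j) g (root2 R j ^+ m).

Lemma ler_ravg j g1 g2 : (forall w, cabs w = 1 -> g1 w <= g2 w) -> ravg j g1 <= ravg j g2.
Proof.
move=> H; rewrite ler_wpM2l ?invr_ge0 ?ler0n//; apply: ler_sum => i _.
by apply: H; rewrite cabsX cabs_root2 expr1n.
Qed.

Lemma ravgD j g1 g2 : ravg j (fun w => g1 w + g2 w) = ravg j g1 + ravg j g2.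
Proof. by rewrite /ravg big_split mulrDr. Qed.

Lemma ravgZ j (a : R) g : ravg j (fun w => a * g w) = a * ravg j g.
Proof. by rewrite /ravg -mulr_sumr mulrCA. Qed.

Lemma avg_ravg j g : avg (V := R[i]^o) j (fun w => (g w)%:C%C) = (ravg j g)%:C%C.
Proof. by rewrite /avg /ravg rmorphM fmorphV rmorph_nat rmorph_sum. Qed.

Lemma rnorm_avg_ravg (V : normedModType R[i]) j (f : R[i] -> V) :
  rnorm (avg j f) <= ravg j (fun w => rnorm (f w)).
Proof.
rewrite rnormZc cabsV cabs_natr ler_wpM2l ?invr_ge0 ?ler0n//.
exact: ler_rnorm_sum.
Qed.

End real_average.

Section poisson_kernel.
Context (R : realType).
Implicit Types (z w : R[i]).

(** Equal to the conjugate of [kern z w] on the unit circle, but holomorphic in [w] on the closed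
    disc when |z| < 1, so that its product with [f] has the mean value property. The shape a * w + b
    fits [cdiff_inv_affine]. *)
Definition ckern z w : R[i] := (- z^*%C * w + 1)^-1.

(** The Poisson kernel: for |w| = 1 it equals (1 - |z|^2) / |w - z|^2. *)
Definition pois z w : R := 2 * complex.Re (ckern z w) - 1.

Lemma conj_unit w : cabs w = 1 -> w^*%C = w^-1.
Proof.
move=> w1; have w0 : w != 0 by rewrite -cabs_gt0 w1 ltr01.
apply: (mulfI w0); rewrite divff//.
move: (cabs_sqr w); rewrite w1 expr1n; case: w {w0 w1} => a b /= ab.
by apply/eqP; rewrite eq_complex /= mulrN opprK -!expr2 -ab mulrN mulrC addrC subrr !eqxx.
Qed.

Lemma conj_kern z w : cabs w = 1 -> (kern z w)^*%C = ckern z w.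
Proof.
move=> w1; have w0 : w != 0 by rewrite -cabs_gt0 w1 ltr01.
rewrite /kern /ckern rmorphM fmorphV rmorphB /= (conj_unit w1).
rewrite -invfM mulrBr divff// addrC; congr (_^-1).
by rewrite mulNr mulrC.
Qed.

Lemma poisE z w : cabs w = 1 -> (pois z w)%:C%C = kern z w + ckern z w - 1.
Proof.
move=> w1; rewrite /pois -conj_kern//; case: (kern z w) => a b.
by apply/eqP; rewrite eq_complex /=; apply/andP; split; apply/eqP; ring.
Qed.

(** Here the radius 1/3 enters: |a / (1 - a)| is at most 1/3 divided by 2/3. This puts [pois z w] in
    the interval [0, 2]. *)
Lemma cabs_ckern z w : cabs z <= 3^-1 -> cabs w = 1 -> cabs (ckern z w - 1) <= 2^-1.
Proof.
move=> z3 w1; pose a := z^*%C * w.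
have a3 : cabs a <= 3^-1 by rewrite cabsM w1 mulr1 cabs_conj.
have h : 2 / 3 <= cabs (1 - a).
  apply: le_trans (ler_cabsB _ _); rewrite cabs1.
  by rewrite [leLHS](_ : _ = 1 - 3^-1) ?lerB//; field.
have a1 : 1 - a != 0 by rewrite -cabs_gt0; apply: lt_le_trans h; rewrite divr_gt0.
have -> : ckern z w - 1 = a / (1 - a).
  by rewrite /ckern mulNr -/a [- a + 1]addrC; field.
rewrite cabsM cabsV ler_pdivrMr ?cabs_gt0//; apply: le_trans a3 _.
by rewrite ler_pdivlMl//; move: h; rewrite mulrC.
Qed.

Lemma pois_dist z w : cabs z <= 3^-1 -> cabs w = 1 -> `|pois z w - 1| <= 1.
Proof.
move=> z3 w1; have h := le_trans (ler_Re_cabs _) (cabs_ckern z3 w1).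
have -> : pois z w - 1 = 2 * complex.Re (ckern z w - 1).
  by rewrite /pois; case: (ckern z w) => a b /=; ring.
by rewrite normrM ger0_norm// -ler_pdivlMl// mulr1.
Qed.

Lemma pois_itv z w : cabs z <= 3^-1 -> cabs w = 1 -> 0 <= pois z w <= 2.
Proof.
move=> z3 w1; have := pois_dist z3 w1.
by rewrite ler_norml => /andP[? ?]; apply/andP; split; lra.
Qed.

End poisson_kernel.

Section mean_values.
Context (R : realType) (V : normedModType R[i]).
Implicit Types f : R[i]^o -> V.

Lemma cvg_avg f : (forall w, cabs w <= 1 -> cdiff f w) ->
  avg j f @[j --> \oo] --> f 0.
Proof.
move=> fd; have := @cauchy_avg R V f 0; rewrite cabs0 => /(_ ltr01 fd).
apply: eq_cvg_to => j; apply: eq_avg => w w1 _.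
by rewrite /kern subr0 divff ?scale1r// -cabs_gt0 w1.
Qed.

Lemma cvg_avg_ckern f z : (forall w, cabs w <= 1 -> cdiff f w) -> cabs z < 1 ->
  avg j (fun w => ckern z w *: f w) @[j --> \oo] --> f 0.
Proof.
move=> fd z1; have -> : f 0 = ckern z 0 *: f 0.
  by rewrite /ckern mulr0 add0r invr1 scale1r.
apply: (@cvg_avg (fun w => ckern z w *: f w)) => w w1.
apply: cdiff_scale (fd _ w1); apply: cdiff_inv_affine.
rewrite mulNr addrC subr_eq0 eq_sym; apply/eqP => /(congr1 (@cabs R)).
rewrite cabsM cabs_conj cabs1 => h; have := cabs_ge0 z; have := cabs_ge0 w; nra.
Qed.

(** By [poisE], the three terms of the kernel contribute f z, f 0 and - f 0. *)
Lemma cvg_avg_pois f z : (forall w, cabs w <= 1 -> cdiff f w) -> cabs z < 1 ->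
  avg j (fun w => (pois z w)%:C%C *: f w) @[j --> \oo] --> f z.
Proof.
move=> fd z1; have -> : f z = f z + f 0 - f 0 by rewrite addrK.
apply: (eq_cvg_to _ (cvgB (cvgD (cauchy_avg z1 fd) (cvg_avg_ckern fd z1)) (cvg_avg fd))).
move=> j; rewrite !fctE -avgD -avgB.
by apply: eq_avg => w w1 _; rewrite poisE// scalerBl scalerDl scale1r.
Qed.

End mean_values.

Section norm_of_holomorphic.
Context (R : realType).

Lemma cvg_Re (u : nat -> R[i]^o) (l : R[i]^o) : u @ \oo --> l ->
  complex.Re (u n) @[n --> \oo] --> complex.Re l.
Proof.
move=> /cvg_rnormP H; apply/cvgrPdist_le => e /H; apply: filterS => n.
apply: le_trans; rewrite distrC; apply: le_trans (ler_Re_cabs _).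
by have -> : complex.Re (u n - l) = complex.Re (u n) - complex.Re l
  by case: (u n) l {H} => ? ? [].
Qed.

Lemma cvg_ravg_pois (z : R[i]) : cabs z < 1 -> ravg j (pois z) @[j --> \oo] --> (1 : R).
Proof.
move=> z1; pose one (w : R[i]^o) : R[i]^o := 1.
have one_diff w : cabs w <= 1 -> cdiff one w.
  by move=> _; apply/derivable_cdiffP; exact: derivable_cst.
apply: eq_cvg_to (cvg_Re (cvg_avg_pois one_diff z1)) => j.
by under [in avg _ _]eq_fun do rewrite /GRing.scale/= mulr1; rewrite avg_ravg.
Qed.

Context (V : normedModType R[i]).
Implicit Types f : R[i]^o -> V.

(** The vector [2 *: f 0 - f z] is the limit of means of [f] with weight [2 - pois z], which is
    nonnegative and has mean tending to 1. *)
Lemma harnack f z (M : R) : (forall w, cabs w <= 1 -> cdiff f w) ->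
  (forall w, cabs w = 1 -> rnorm (f w) <= M) -> cabs z <= 3^-1 ->
  rnorm (2 *: f 0 - f z) <= M.
Proof.
move=> fd fM z3; have z1 : cabs z < 1 by apply: le_lt_trans z3 _; rewrite invf_lt1// ltr1n.
have H1 : avg j (fun w => (2 - pois z w)%:C%C *: f w) @[j --> \oo] --> 2 *: f 0 - f z.
  apply: eq_cvg_to (cvgB (cvgZl_tmp (k := 2) (cvg_avg fd)) (cvg_avg_pois fd z1)) => j.
  rewrite !fctE /= -avgZ -avgB; apply: eq_avg => w _ _.
  by move: (pois z w) => p; rewrite rmorphB scalerBl (rmorph_nat (real_complex R) 2).
have H2 : ravg j (fun w => 2 - pois z w) * M @[j --> \oo] --> M.
  have {2}-> : M = (2 - 1) * M by ring.
  apply: cvgMr_tmp; apply: (eq_cvg_to _ (cvgB (cvg_cst (2 : R)) (cvg_ravg_pois z1))) => j.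
  rewrite !fctE; transitivity (ravg j (fun=> 2) - ravg j (pois z)).
    by congr (_ - _); rewrite /ravg sumr_const card_ord -[2 *+ _]mulr_natl
      mulKf// pnatr_eq0 expn_eq0.
  by rewrite -[- ravg _ _]mulN1r -ravgZ -ravgD; congr ravg; apply/funext => w; rewrite mulN1r.
apply: (ler_cvg_to (cvg_rnorm H1) H2); near=> j.
apply: le_trans (rnorm_avg_ravg _ _) _; rewrite mulrC -ravgZ; apply: ler_ravg => w w1.
have /andP[p0 p2] := pois_itv z3 w1.
by rewrite rnormZc cabs_real ger0_norm ?subr_ge0// mulrC ler_wpM2r ?subr_ge0 ?fM.
Unshelve. all: by end_near. Qed.

(* First order perturbation: the functions (1 + t G) f, with G holomorphic,
   G 0 = 0 and Re G = pois z - 1 on the circle, all have mean value f 0. *)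
Lemma norm_constant f z : (forall w, cabs w <= 1 -> cdiff f w) ->
  (forall j, ravg j (fun w => rnorm (f w)) <= rnorm (avg j f)) ->
  cabs z <= 3^-1 -> rnorm (f z) = rnorm (f 0).
Proof.
move=> fd fadd z3; have z1 : cabs z < 1 by apply: le_lt_trans z3 _; rewrite invf_lt1// ltr1n.
have C0 := cvg_avg fd.
pose h w := rnorm (f w).
have H0 : ravg j h @[j --> \oo] --> rnorm (f 0).
  apply: eq_cvg_to (cvg_rnorm C0) => j; apply/eqP; rewrite eq_le fadd andbT.
  exact: rnorm_avg_ravg.
(* Equality in the triangle inequality survives the weight [pois z]: both [pois z] and [2 - pois z]
   are nonnegative and they add up to 2, so a loss for one could not be recovered by the other. *)
have Hz : ravg j (fun w => pois z w * h w) @[j --> \oo] --> rnorm (f z).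
  apply: eq_cvg_to (cvg_rnorm (cvg_avg_pois fd z1)) => j.
  have rE w : cabs w = 1 -> rnorm ((pois z w)%:C%C *: f w) = pois z w * h w.
    move=> w1; have /andP[p0 p2] := pois_itv z3 w1.
    by rewrite rnormZc cabs_real ger0_norm.
  have rE' w : cabs w = 1 -> rnorm ((2 - pois z w)%:C%C *: f w) = (2 - pois z w) * h w.
    move=> w1; have /andP[p0 p2] := pois_itv z3 w1.
    by rewrite rnormZc cabs_real ger0_norm// subr_ge0.
  apply/eqP; rewrite eq_le; apply/andP; split.
    apply: le_trans (rnorm_avg_ravg _ _) _; apply: ler_ravg => w w1; by rewrite rE.
  have : 2 * ravg j h <= rnorm (avg j (fun w => (pois z w)%:C%C *: f w)) +
      ravg j (fun w => (2 - pois z w) * h w).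
    apply: (@le_trans _ _ (rnorm (2 *: avg j f))).
      by rewrite rnormZc cabs_natr ler_wpM2l.
    have -> : 2 *: avg j f = avg j (fun w => (pois z w)%:C%C *: f w) +
        avg j (fun w => (2 - pois z w)%:C%C *: f w).
      rewrite -avgZ -avgD; apply: eq_avg => w _ _.
      move: (pois z w) => p.
      by rewrite -scalerDl -rmorphD addrC subrK (rmorph_nat (real_complex R) 2).
    apply: le_trans (ler_rnormD _ _) _; rewrite lerD2l.
    by apply: le_trans (rnorm_avg_ravg _ _) _; apply: ler_ravg => w w1; rewrite rE'.
  rewrite -ravgZ (_ : (fun w => 2 * h w) = fun w => pois z w * h w + (2 - pois z w) * h w).
    by rewrite ravgD lerD2r.
  by apply/funext => w; rewrite -mulrDl addrC subrK.
(* On the circle |G| <= 1 and Re G = pois z w - 1, whence |1 + t G| <= 1 + t Re G + t^2 / 2: the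
   squares differ by at least the square of t (Re G + t / 2). *)
have key (t : R) : `|t| <= 1 -> rnorm (f 0) <= (1 - t + t ^+ 2 / 2) * rnorm (f 0) + t * rnorm (f z).
  move=> t1.
  pose G w := 2 * (ckern z w - 1).
  have C1 : avg j (fun w => (1 + t%:C%C * G w) *: f w) @[j --> \oo] --> f 0.
    rewrite (_ : f 0 = f 0 + (t%:C%C * 2) *: (f 0 - f 0)); last first.
      by rewrite subrr scaler0 addr0.
    apply: (eq_cvg_to _ (cvgD C0 (cvgZl_tmp (k := t%:C%C * 2)
      (cvgB (cvg_avg_ckern fd z1) C0)))) => j.
    rewrite !fctE /= -avgB -avgZ -avgD; apply: eq_avg => w _ _.
    by rewrite scalerDl scale1r -[X in _ - X]scale1r -scalerBl scalerA -mulrA.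
  have C2 : (1 - t + t ^+ 2 / 2) * ravg j h + t * ravg j (fun w => pois z w * h w) @[j --> \oo]
      --> (1 - t + t ^+ 2 / 2) * rnorm (f 0) + t * rnorm (f z).
    by apply: cvgD; apply: cvgMl_tmp.
  apply: (ler_cvg_to (cvg_rnorm C1) C2); near=> j.
  apply: le_trans (rnorm_avg_ravg _ _) _.
  rewrite -!ravgZ -ravgD; apply: ler_ravg => w w1.
  rewrite rnormZc mulrA -mulrDl ler_wpM2r ?rnorm_ge0//.
  have /andP[p0 p2] := pois_itv z3 w1.
  have ReG : complex.Re (G w) = pois z w - 1.
    by rewrite /G /pois; case: (ckern z w) => a b /=; ring.
  have G1 : cabs (G w) <= 1.
    by rewrite cabsM cabs_natr -ler_pdivlMl// mulr1 cabs_ckern.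
  rewrite -ler_sqr ?nnegrE ?cabs_ge0//; last first.
    by move: t1; rewrite ler_norml => /andP[? ?]; nra.
  rewrite cabs_sqr.
  have := cabs_sqr (G w); move: ReG G1; case: (G w) => a b /= -> G1 Gsq.
  have Gsq1 : (pois z w - 1) ^+ 2 + b ^+ 2 <= 1 by rewrite -Gsq expr_le1// cabs_ge0.
  set p := pois z w in p0 p2 Gsq1 *.
  rewrite (_ : 1 - t + t ^+ 2 / 2 + t * p = 1 + t * (p - 1) + t ^+ 2 / 2); last by ring.
  rewrite (_ : _ + _ = 1 + 2 * t * (p - 1) + t ^+ 2 * ((p - 1) ^+ 2 + b ^+ 2)); last by ring.
  apply: (@le_trans _ _ (1 + 2 * t * (p - 1) + t ^+ 2)).
    by rewrite lerD2l ler_piMr// sqr_ge0.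
  rewrite -subr_ge0 (_ : _ - _ = (t * (p - 1 + t / 2)) ^+ 2) ?sqr_ge0//.
  by field.
set h0 := rnorm (f 0) in key *; set hz := rnorm (f z) in key *.
have h00 : 0 <= h0 by exact: rnorm_ge0.
have hz0 : 0 <= hz by exact: rnorm_ge0.
(* [key] says t (h0 - hz) <= t^2 h0 / 2. For t = s, which has the sign of h0 - hz and modulus at
   most 1, this becomes s^2 (h0 / 2 + hz + 1) <= 0, so s = 0. *)
pose s := (h0 - hz) / (h0 + hz + 1).
have s0 : 0 < h0 + hz + 1 by rewrite ltr_wpDl ?addr_ge0.
have hs : h0 - hz = s * (h0 + hz + 1) by rewrite /s divfK// gt_eqF.
have s1 : `|s| <= 1.
  rewrite normrM normfV ler_pdivrMr ?normr_gt0 ?gt_eqF// mul1r [leRHS]gtr0_norm//.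
  by rewrite ler_norml; apply/andP; split; lra.
have := key _ s1 => k.
have : s ^+ 2 * (h0 / 2 + hz + 1) <= 0 by move: k hs; nra.
rewrite pmulr_lle0; last by rewrite ltr_wpDl// addr_ge0// divr_ge0.
have := sqr_ge0 s => ? ?; have /eqP : s ^+ 2 = 0 by apply/eqP; rewrite eq_le; apply/andP.
rewrite sqrf_eq0 => /eqP s00; apply/eqP; rewrite eq_sym -subr_eq0 hs s00 mul0r//.
Unshelve. all: by end_near. Qed.

End norm_of_holomorphic.

(** * Interpolation at roots of unity *)

Section interpolation.
Context (R : realType).
Implicit Types (z w x : R[i]).

(** Lagrange kernel of the nodes w / 3, a truncated geometric series in 3 z / w. For |z| <= 1/3 its
    terms have modulus at most 1, so interpolation enlarges norms by at most 2 ^ j. *)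
Definition lag j z w : R[i] := \sum_(n < 2 ^ j) (3 * z) ^+ n * w ^- n.

Lemma cabs_inv3 : cabs (3^-1 : R[i]) = 3^-1.
Proof. by rewrite cabsV cabs_natr. Qed.

Lemma cabs_lag j z w : cabs z <= 3^-1 -> cabs w = 1 -> cabs (lag j z w) <= (2 ^ j)%:R.
Proof.
move=> z3 w1; apply: le_trans (ler_cabs_sum _ _ _) _.
rewrite -[X in _ <= X%:R]card_ord -sumr_const; apply: ler_sum => n _.
rewrite cabsM cabsV !cabsX w1 expr1n invr1 mulr1 exprn_ile1 ?cabs_ge0//.
by rewrite cabsM cabs_natr -ler_pdivlMl// mulr1.
Qed.

Section interp.
Context (V : lmodType R[i]).
Implicit Types (v : R[i] -> V).

(* The polynomial of degree < 2 ^ j with value v w at w / 3 for w ^+ (2 ^ j) = 1. *)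
Definition interp j v z : V := avg j (fun w => lag j z w *: v w).

Lemma interp_poly j (c : nat -> V) z :
  interp j (fun w => \sum_(k < 2 ^ j) (w / 3) ^+ k *: c k) z = \sum_(k < 2 ^ j) z ^+ k *: c k.
Proof.
rewrite /interp.
rewrite (_ : (fun w => _) = fun w => \sum_(k < 2 ^ j) (\sum_(n < 2 ^ j)
    ((3 * z) ^+ n / 3 ^+ k) *: (w ^+ k * w ^- n : R[i]^o)) *: c k); last first.
  apply/funext => w; rewrite scaler_sumr; apply: eq_bigr => k _.
  rewrite scalerA; congr (_ *: _); rewrite /lag mulr_suml; apply: eq_bigr => n _.
  by rewrite /GRing.scale/= expr_div_n; ring.
rewrite avg_sum; apply: eq_bigr => k _; rewrite avg_scale; congr (_ *: _).
rewrite avg_sum (bigD1 k)//= big1 ?addr0; last first.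
  move=> n nk; rewrite avgZ avg_orth//.
  by rewrite (_ : (k == n :> nat) = false) ?scaler0//; apply/negbTE; rewrite eq_sym.
rewrite avgZ avg_orth// eqxx /GRing.scale/= mulr1 exprMn mulrAC divff ?mul1r//.
Qed.

Lemma interpB j v1 v2 z : interp j v1 z - interp j v2 z = interp j (fun w => v1 w - v2 w) z.
Proof. by rewrite -avgB; apply: eq_avg => w _ _; rewrite scalerBr. Qed.

End interp.

Lemma rnorm_interp (V : normedModType R[i]) j (v : R[i] -> V) z (M : R) :
  cabs z <= 3^-1 -> (forall w, cabs w = 1 -> rnorm (v w) <= M) ->
  rnorm (interp j v z) <= (2 ^ j)%:R * M.
Proof.
move=> z3 vM; apply: rnorm_avg => w w1; rewrite rnormZc.
by rewrite ler_pM ?cabs_ge0 ?rnorm_ge0 ?cabs_lag// vM.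
Qed.

Lemma rnorm_interp_sum (V : normedModType R[i]) j (v : R[i] -> V) z : cabs z <= 3^-1 ->
  rnorm (interp j v z) <= \sum_(m < 2 ^ j) rnorm (v (root2 R j ^+ m)).
Proof.
move=> z3; rewrite rnormZc cabsV cabs_natr ler_pdivrMl ?ltr0n ?expn_gt0// mulr_sumr.
apply: le_trans (ler_rnorm_sum _ _ _) _; apply: ler_sum => m _.
by rewrite rnormZc ler_wpM2r ?rnorm_ge0// cabs_lag// cabsX cabs_root2 expr1n.
Qed.

(** With N = 2 ^ j, the tail of the Cauchy kernel at radius 1/3 is at most 3/2 * 3 ^ -N, where 3/2 =
    1 / (1 - 1/3). It enters once as such and once interpolated, with a factor N. *)
Definition interp_err j : R := ((2 ^ j)%:R + 1) * (3 / 2) * 3^-1 ^+ (2 ^ j).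

Lemma lt13 : 3^-1 < 1 :> R.
Proof. by rewrite invf_lt1// ltr1n. Qed.

(** The terms of degree < 2 ^ j in [z] of the geometric expansion are reproduced by [interp_poly];
    only the tails contribute to the error. *)
Lemma kern_interp j z eta : cabs z <= 3^-1 -> cabs eta = 1 ->
  cabs (kern z eta - interp (V := R[i]^o) j (fun w => kern (w / 3) eta) z) <= interp_err j.
Proof.
move=> z3 e1; have e0 : eta != 0 by rewrite -cabs_gt0 e1 ltr01.
pose N := (2 ^ j)%N.
pose tail x : R[i]^o := (x / eta) ^+ N * kern x eta.
have tailE x : cabs x < 1 ->
    kern x eta = \sum_(k < N) x ^+ k *: (eta ^- k : R[i]^o) + tail x.
  move=> x1; have xe0 := subr_kern_neq0 x1 e1.
  have E : kern x eta * (1 - (x / eta) ^+ N) = \sum_(k < N) (x / eta) ^+ k.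
    rewrite -[1 - _]opprB subrX1 /kern -mulNr opprB mulrA.
    have -> : eta / (eta - x) * (1 - x / eta) = 1 by field; rewrite e0 xe0.
    by rewrite mul1r.
  rewrite (eq_bigr (fun k : 'I_N => (x / eta) ^+ k)); last first.
    by move=> k _; rewrite exprMn exprVn.
  by rewrite -E /tail; ring.
have tail_le x : cabs x <= 3^-1 -> cabs (tail x) <= 3 / 2 * 3^-1 ^+ N.
  move=> x3; rewrite mulrC cabsM ler_pM ?cabs_ge0//.
    rewrite cabsX cabsM cabsV e1 invr1 mulr1.
    by rewrite lerXn2r// nnegrE ?cabs_ge0// invr_ge0.
  apply: le_trans (cabs_kern (le_lt_trans x3 lt13) e1) _.
  rewrite [leRHS](_ : _ = (1 - 3^-1)^-1); last by field.
  by rewrite lef_pV2 ?lerB// posrE subr_gt0 ?lt13// (le_lt_trans x3 lt13).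
have c3 w : cabs w = 1 -> cabs (w / 3) <= 3^-1 by move=> w1; rewrite cabsM w1 mul1r cabs_inv3.
have -> : kern z eta - interp (V := R[i]^o) j (fun w => kern (w / 3) eta) z =
    tail z - interp (V := R[i]^o) j (fun w => tail (w / 3)) z.
  rewrite (tailE z (le_lt_trans z3 lt13)).
  rewrite -(@interp_poly R[i]^o j (fun k => eta ^- k)).
  rewrite [X in X - _ = _]addrC -addrA; congr (_ + _); rewrite interpB -[RHS]sub0r.
  rewrite -[X in _ = X - _](subrr (interp (V := R[i]^o) j (fun w => kern (w / 3) eta) z)).
  rewrite interpB [RHS]interpB; apply: eq_avg => w w1 _.
  by rewrite (tailE _ (le_lt_trans (c3 _ w1) lt13)); congr (_ *: _); ring.
apply: le_trans (ler_cabsD _ _) _; rewrite cabsN.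
rewrite /interp_err -mulrA mulrDl mul1r addrC; apply: lerD; last exact: tail_le.
by apply: (@rnorm_interp R[i]^o) => // w w1; apply: tail_le; exact: c3.
Qed.

Lemma avg_swap (V : lmodType R[i]) j k (g : R[i] -> R[i] -> V) :
  avg j (fun w => avg k (g w)) = avg k (fun eta => avg j (g^~ eta)).
Proof.
rewrite /avg -!scaler_sumr !scalerA mulrC exchange_big.
by congr (_ *: _); apply: eq_bigr.
Qed.

Lemma cvg_sumr (V : normedModType R[i]) (I : Type) (r : seq I) (u : I -> nat -> V) (l : I -> V) :
  (forall i, u i @ \oo --> l i) -> \sum_(i <- r) u i n @[n --> \oo] --> \sum_(i <- r) l i.
Proof.
move=> ul; elim: r => [|i r IH].
  by rewrite big_nil; apply: (eq_cvg_to _ (cvg_cst 0)) => n; rewrite big_nil.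
by rewrite big_cons; apply: (eq_cvg_to _ (cvgD (ul i) IH)) => n; rewrite big_cons.
Qed.

(** Cauchy's formula writes [f z] and the node values as limits of means of [f] against kernels.
    Interpolation commutes with these means, so the kernel error, uniform in [eta], bounds the error
    for [f]. *)
Lemma holomorphic_interp (V : normedModType R[i]) (f : R[i]^o -> V) j z :
  (forall w, cabs w <= 1 -> cdiff f w) -> (forall w, cabs w = 1 -> rnorm (f w) <= 1) ->
  cabs z <= 3^-1 -> rnorm (f z - interp j (fun w => f (w / 3)) z) <= interp_err j.
Proof.
move=> fd f1 z3.
have c3 w : cabs w = 1 -> cabs (w / 3) < 1.
  by move=> w1; rewrite cabsM w1 mul1r cabs_inv3 lt13.
have H : interp j (fun w => avg M (fun eta => kern (w / 3) eta *: f eta)) z @[M --> \oo] -->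
    interp j (fun w => f (w / 3)) z.
  apply: cvgZl_tmp; apply: cvg_sumr => m; apply: cvgZl_tmp; apply: cauchy_avg fd.
  by apply: c3; rewrite cabsX cabs_root2 expr1n.
apply: (ler_cvg_to (cvg_rnorm (cvgB (cauchy_avg (le_lt_trans z3 lt13) fd) H))
  (cvg_cst (interp_err j))); near=> M.
rewrite fctE /= (_ : _ - _ = avg M (fun eta =>
    (kern z eta - interp (V := R[i]^o) j (fun w => kern (w / 3) eta) z) *: f eta)).
  apply: rnorm_avg => w w1; rewrite rnormZc -[leRHS]mulr1.
  by rewrite ler_pM ?cabs_ge0 ?rnorm_ge0 ?kern_interp ?f1.
rewrite [RHS](_ : _ = avg M (fun eta => kern z eta *: f eta -
    avg j (fun w => (lag j z w * kern (w / 3) eta) *: f eta))); last first.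
  by apply: eq_avg => eta _ _; rewrite avg_scale -scalerBl.
rewrite avgB -avg_swap; congr (_ - _); apply: eq_avg => w _ _.
by rewrite -avgZ; apply: eq_avg => eta _ _; rewrite scalerA.
Unshelve. all: by end_near. Qed.

End interpolation.

(** * Uniform limits *)

Lemma subrACA (V : zmodType) (u1 u2 u3 u4 : V) :
  u1 - u2 - (u3 - u4) = u1 - u3 - (u2 - u4).
Proof. by rewrite !opprB addrACA [RHS]addrACA [- u2 - _]addrC. Qed.

Section complete_limits.
Context (R : realType) (V : completeNormedModType R[i]).

Lemma cauchy_rnorm_cvg (u : nat -> V) :
  (forall e : R, 0 < e -> exists n0, forall n, (n0 <= n)%N -> rnorm (u n - u n0) <= e) ->
  exists l : V, u @ \oo --> l.
Proof.
move=> H; suff : cauchy (u @ \oo) by move=> /cauchy_cvgP/cvg_ex.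
apply: cauchy_exP => e e0.
  have eE : e = (complex.Re e)%:C%C by rewrite RRe_real// gtr0_real.
  have Re0 : 0 < complex.Re e / 2 by rewrite divr_gt0// -ltcR -eE.
  have [n0 h] := H _ Re0; exists (u n0); exists n0 => // n /= nn0.
  rewrite -ball_normE /= eE rnormE ltcR rnormC.
  apply: le_lt_trans (h _ nn0) _; rewrite ltr_pdivrMr// ltr_pMr ?ltr1n//.
by rewrite -ltcR -eE.
Qed.

End complete_limits.

Section weierstrass.
Context (R : realType).

Lemma holomorphic_lipschitz (V : normedModType R[i]) (f : R[i]^o -> V) (z w : R[i]) (r M : R) :
  (forall w, cabs w <= 1 -> cdiff f w) -> (forall w, cabs w = 1 -> rnorm (f w) <= M) ->
  r < 1 -> cabs z <= r -> cabs w <= r ->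
  rnorm (f w - f z) <= M / (1 - r) ^+ 2 * cabs (w - z).
Proof.
move=> fd fM r1 zr wr.
have z1 := le_lt_trans zr r1; have w1 := le_lt_trans wr r1.
apply: (ler_cvg_to (cvg_rnorm (cvgB (cauchy_avg w1 fd) (cauchy_avg z1 fd)))
  (cvg_cst _)); near=> j.
rewrite fctE /= -avgB; apply: rnorm_avg => e e1.
rewrite -scalerBl rnormZc mulrC -mulrA ler_pM ?rnorm_ge0 ?cabs_ge0 ?fM//.
have ew := subr_kern_neq0 w1 e1; have ez := subr_kern_neq0 z1 e1.
have -> : kern w e - kern z e = e * (w - z) / ((e - w) * (e - z)).
  by rewrite /kern; field; rewrite ew ez.
rewrite !cabsM e1 mul1r mulrC ler_wpM2r ?cabs_ge0// cabsV cabsM.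
have r0 : 0 < 1 - r by rewrite subr_gt0.
have h x : cabs x <= r -> 1 - r <= cabs (e - x).
  by move=> xr; apply: le_trans (subr_kern_ge _ e1); rewrite lerB.
rewrite lef_pV2 ?posrE ?mulr_gt0 ?exprn_gt0 ?cabs_gt0//.
by rewrite expr2 ler_pM ?(ltW r0)// h.
Unshelve. all: by end_near. Qed.

Lemma cdiffB (V : normedModType R[i]) (f g : R[i]^o -> V) z :
  cdiff f z -> cdiff g z -> cdiff (fun w => f w - g w) z.
Proof.
by move=> /derivable_cdiffP df /derivable_cdiffP dg; apply/derivable_cdiffP/derivableB.
Qed.

(** [holomorphic_lipschitz], applied to p k - p i, turns bounds on the circle into Lipschitz
    constants C * e i on a smaller disc. Hence the derivatives at [z] form a Cauchy sequence, and
    the expansion of one p i passes to [g] with an error controlled by e i. *)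
Lemma weierstrass (V : completeNormedModType R[i]) (p : nat -> R[i]^o -> V) (e : nat -> R)
    (g : R[i]^o -> V) z :
  (forall n w, cabs w <= 1 -> cdiff (p n) w) ->
  (forall i k w, (i <= k)%N -> cabs w = 1 -> rnorm (p k w - p i w) <= e i) ->
  e @ \oo --> 0 ->
  (forall w, cabs w < 1 -> p n w @[n --> \oo] --> g w) ->
  cabs z < 1 -> cdiff g z.
Proof.
move=> pd pe e0 pg z1.
pose r := (1 + cabs z) / 2; pose C := (1 - r) ^- 2.
have r1 : r < 1 by rewrite /r; lra.
have zr : cabs z <= r by rewrite /r; lra.
have C0 : 0 < C by rewrite invr_gt0 exprn_gt0// subr_gt0.
have dr : 0 < r - cabs z by rewrite /r; lra.
have near_r w : cabs (w - z) < r - cabs z -> cabs w <= r.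
  by move=> wz; rewrite -[w](subrK z); apply: le_trans (ler_cabsD _ _) _; lra.
have Lp i k w : (i <= k)%N -> cabs w <= r ->
    rnorm ((p k w - p i w) - (p k z - p i z)) <= C * e i * cabs (w - z).
  move=> ik wr; rewrite [C * _]mulrC.
  apply: (@holomorphic_lipschitz _ (fun w => p k w - p i w) z w r) => //.
    by move=> x x1; apply: cdiffB; exact: pd.
  by move=> x x1; exact: pe.
have Lg i w : cabs w <= r ->
    rnorm ((g w - p i w) - (g z - p i z)) <= C * e i * cabs (w - z).
  move=> wr; have w1 := le_lt_trans wr r1.
  apply: (ler_cvg_to (cvg_rnorm (cvgB (cvgB (pg _ w1) (cvg_cst (p i w)))
    (cvgB (pg _ z1) (cvg_cst (p i z))))) (cvg_cst _)).
  by exists i => // k /= ik; exact: Lp.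
have [D HD] : exists D : nat -> V, forall n (a : R), 0 < a -> exists2 d : R, 0 < d &
    forall w, cabs (w - z) < d -> rnorm (p n w - p n z - (w - z) *: D n) <= a * cabs (w - z).
  have [D HD] := choice (fun n => pd n z (ltW z1)).
  by exists D.
have DD i k : (i <= k)%N -> rnorm (D k - D i) <= C * e i.
  move=> ik; apply/ler_addgt0Pr => a a0.
  have ha : 0 < a / 2 by rewrite divr_gt0.
  have [d1 d10 H1] := HD i _ ha; have [d2 d20 H2] := HD k _ ha.
  (* A test increment within both radii of differentiability that keeps z + t in the disc of radius
     r. *)
  pose t := Num.min (Num.min d1 d2) (r - cabs z) / 2.
  have m0 : 0 < Num.min (Num.min d1 d2) (r - cabs z) by rewrite !lt_min d10 d20.
  have t0 : 0 < t by rewrite divr_gt0.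
  have : t < Num.min (Num.min d1 d2) (r - cabs z).
    by rewrite /t ltr_pdivrMr// ltr_pMr// ltr1n.
  rewrite !lt_min => /andP[/andP[td1 td2] tr].
  pose w := z + t%:C%C.
  have wz : cabs (w - z) = t by rewrite /w addrC addKr cabs_real gtr0_norm.
  have wr : cabs w <= r by apply: near_r; rewrite wz.
  have := H1 w; rewrite wz => /(_ td1) h1; have := H2 w; rewrite wz => /(_ td2) h2.
  have := Lp i k w ik wr; rewrite wz => h3.
  have : rnorm ((w - z) *: (D k - D i)) <= (C * e i + a) * t.
    have -> : (w - z) *: (D k - D i) = (p k w - p i w - (p k z - p i z)) -
        ((p k w - p k z - (w - z) *: D k) - (p i w - p i z - (w - z) *: D i)).
      have E (a1 a2 b1 b2 c1 c2 : V) : c1 - c2 =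
          (a1 - a2 - (b1 - b2)) - ((a1 - b1 - c1) - (a2 - b2 - c2)).
        rewrite [X in _ = _ - X]subrACA [X in _ = X - _]subrACA.
        by rewrite subKr.
      by rewrite scalerBr; exact: E.
    apply: le_trans (rnormB_le h3 (rnormB_le h2 h1)) _.
    by rewrite mulrDl lerD2l -mulrDl -splitr.
  by rewrite rnormZc wz mulrC ler_pM2r.
have [Dl Dlim] : exists Dl : V, D @ \oo --> Dl.
  apply: cauchy_rnorm_cvg => a a0.
  have aC : 0 < a / C by rewrite divr_gt0.
  have /cvgrPdist_le/(_ _ aC)[n0 _ h] := e0; exists n0 => n n0n.
  apply: le_trans (DD _ _ n0n) _; rewrite -ler_pdivlMl// mulrC.
  by have := h n0 (leqnn _); rewrite sub0r normrN; apply: le_trans; exact: ler_norm.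
have DDl i : rnorm (Dl - D i) <= C * e i.
  apply: (ler_cvg_to (cvg_rnorm (cvgB Dlim (cvg_cst (D i)))) (cvg_cst _)).
  by exists i => // k /= ik; exact: DD.
exists Dl => a a0.
have aC : 0 < a / 3 / C by rewrite !divr_gt0.
have a3 : 0 < a / 3 by rewrite divr_gt0.
have [i ei] : exists i, C * e i <= a / 3.
  have /cvgrPdist_le/(_ _ aC)[i _ h] := e0; exists i.
  rewrite -ler_pdivlMl// mulrC.
  by have := h i (leqnn _); rewrite sub0r normrN; apply: le_trans; exact: ler_norm.
have [d d0 Hd] := HD i _ a3.
exists (Num.min d (r - cabs z)); first by rewrite lt_min d0.
move=> w; rewrite lt_min => /andP[wd /near_r wr].
have -> : g w - g z - (w - z) *: Dl = ((g w - p i w) - (g z - p i z)) +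
    (p i w - p i z - (w - z) *: D i) - (w - z) *: (Dl - D i).
  have E (a1 a2 b1 b2 c1 c2 : V) : a1 - b1 - c1 =
      (a1 - a2 - (b1 - b2)) + (a2 - b2 - c2) - (c1 - c2).
    by rewrite [X in _ = X + _ - _]subrACA subrKA subrACA subrr subr0.
  by rewrite scalerBr; exact: E.
have -> : a * cabs (w - z) =
    a / 3 * cabs (w - z) + a / 3 * cabs (w - z) + cabs (w - z) * (a / 3) by field.
apply: rnormB_le; last by rewrite rnormZc ler_wpM2l ?cabs_ge0// (le_trans (DDl i)).
apply: le_trans (ler_rnormD _ _) _; apply: lerD; last exact: Hd.
by apply: le_trans (Lg i w wr) _; rewrite ler_wpM2r ?cabs_ge0.
Qed.

End weierstrass.

(** * Successive interpolants *)

Section interpolation_refinement.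
Context (R : realType) (V : lmodType R[i]).
Implicit Types (v : R[i] -> V) (z : R[i]).

Lemma interp_coef j v z : interp j v z =
  \sum_(k < 2 ^ j) z ^+ k *: avg j (fun w => (3 ^+ k * w ^- k) *: v w).
Proof.
rewrite /interp (_ : (fun w => _) = fun w => \sum_(k < 2 ^ j) z ^+ k *: ((3 ^+ k * w ^- k) *: v w)).
  by rewrite avg_sum; apply: eq_bigr => k _; rewrite avgZ.
apply/funext => w; rewrite /lag scaler_suml; apply: eq_bigr => k _.
by rewrite scalerA exprMn; congr (_ *: _); ring.
Qed.

(** A polynomial of degree < 2 ^ j is reproduced at the next level. Thus the difference of two
    successive interpolants is an interpolant of finitely many residuals. *)
Lemma interpS j v z : interp j.+1 (fun w => interp j v (w / 3)) z = interp j v z.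
Proof.
pose c k := if (k < 2 ^ j)%N then avg j (fun w => (3 ^+ k * w ^- k) *: v w) else 0.
have E x : interp j v x = \sum_(k < 2 ^ j.+1) x ^+ k *: c k.
  rewrite interp_coef -(big_mkord xpredT (fun k => x ^+ k *: c k)).
  rewrite (@big_cat_nat _ _ _ (2 ^ j)%N) ?leq_pexp2l//= [X in _ + X]big_nat_cond.
  rewrite [X in _ + X]big1 ?addr0 ?big_mkord.
    by apply: eq_bigr => k _; rewrite /c ltn_ord.
  by move=> k /andP[/andP[jk _] _]; rewrite /c ltnNge jk scaler0.
rewrite E -interp_poly; apply: eq_avg => w _ _; congr (_ *: _); exact: E.
Qed.

End interpolation_refinement.

Lemma derivable_pow (R : realType) k (z : R[i]^o) :
  derivable (fun x : R[i]^o => x ^+ k : R[i]^o) z 1.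
Proof.
elim: k => [|k IH]; first exact: derivable_cst.
rewrite (_ : (fun x => _) = fun x : R[i]^o => x *: (x ^+ k : R[i]^o)); last first.
  by apply/funext => x; rewrite exprS.
by apply: derivable_scale IH; exact: derivable_id.
Qed.

Section polynomial_diff.
Context (R : realType) (V : normedModType R[i]).

Lemma cdiff_affine (f : R[i]^o -> V) (a b z : R[i]^o) :
  cdiff f (a * z + b) -> cdiff (fun w => f (a * w + b)) z.
Proof.
move=> [D HD]; have [a0|a0] := eqVneq a 0.
  exists 0 => e e0; exists 1 => // w _.
  by rewrite a0 !mul0r subrr scaler0 subr0 rnorm0 mulr_ge0 ?cabs_ge0// ltW.
have ca0 : 0 < cabs a by rewrite cabs_gt0.
exists (a *: D) => e e0; have ea0 : 0 < e / cabs a by rewrite divr_gt0.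
have [d d0 H] := HD _ ea0; exists (d / cabs a); first by rewrite divr_gt0.
move=> w wz; have E : a * w + b - (a * z + b) = a * (w - z) by ring.
have := H (a * w + b); rewrite E cabsM => h.
rewrite scalerA [(w - z) * a]mulrC.
have -> : e * cabs (w - z) = e / cabs a * (cabs a * cabs (w - z)) by field; rewrite gt_eqF.
by apply: h; rewrite mulrC -ltr_pdivlMr.
Qed.

Lemma cdiff_interp j (v : R[i] -> V) z : cdiff (fun x : R[i]^o => interp j v x) z.
Proof.
apply/derivable_cdiffP.
rewrite (_ : (fun x => _) = \sum_(k < 2 ^ j) (fun x : R[i]^o => (x ^+ k : R[i]^o) *:
  avg j (fun w => (3 ^+ k * w ^- k) *: v w))); last first.
  by apply/funext => x; rewrite interp_coef fct_sumE.
apply: derivable_sum => k; apply: derivable_scale; last exact: derivable_cst.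
exact: derivable_pow.
Qed.

End polynomial_diff.

(** * Constancy near 0 in a fibre *)

Section fiber.
Context (R : realType) (V : completeNormedModType R[i]).

(* 18 = 3 * 2 * 3: the interpolating polynomials converge on |z| <= 1/3, their
   limit is differentiable on the smaller disc |z| <= 1/6, and norm_constant
   divides the radius by 3. *)
Lemma fiber_constant (v u : R[i] -> V) (K : R) :
  strictly_psh V ->
  (forall j z, cabs z <= 3^-1 -> rnorm (interp j.+1 v z - interp j v z) <= K * 2^-1 ^+ j) ->
  (forall j m, (interp n v (root2 R j ^+ m / 6) @[n --> \oo] --> u (root2 R j ^+ m / 6))) ->
  (forall j, \sum_(m < 2 ^ j) rnorm (u (root2 R j ^+ m / 6)) <=
             rnorm (\sum_(m < 2 ^ j) u (root2 R j ^+ m / 6))) ->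
  forall z, cabs z <= 18^-1 -> interp n v 0 @[n --> \oo] --> u 0 ->
    interp n v z @[n --> \oo] --> u z -> u z = u 0.
Proof.
move=> psh vK ulim uadd z z18 u0 uz.
pose p n (x : R[i]^o) : V := interp n v (3^-1 * x + 0).
have x3 (x : R[i]) : cabs x <= 1 -> cabs (3^-1 * x + 0) <= 3^-1.
  by move=> x1; rewrite addr0 cabsM cabs_inv3 ler_piMr.
(* The subtracted term makes the bound telescope, so that the induction on k closes. *)
have pstep i k x : (i <= k)%N -> cabs x <= 1 ->
    rnorm (p k x - p i x) <= 2 * K * 2^-1 ^+ i - 2 * K * 2^-1 ^+ k.
  move=> + x1; elim: k => [|k IH].
    by rewrite leqn0 => /eqP ->; rewrite !subrr rnorm0.
  rewrite leq_eqVlt => /orP[/eqP ->|]; first by rewrite !subrr rnorm0.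
  rewrite ltnS => /IH {}IH; rewrite -[p k.+1 x](subrK (p k x)) -addrA.
  apply: le_trans (ler_rnormD _ _) _; apply: le_trans (lerD (vK k _ (x3 x x1)) IH) _.
  by rewrite exprS le_eqVlt; apply/orP; left; apply/eqP; field.
have K0 : 0 <= K.
  have := vK 0%N 0; rewrite cabs0 expr0 mulr1 invr_ge0 => /(_ (ler0n _ _)).
  by apply: le_trans; exact: rnorm_ge0.
have pcauchy i k x : (i <= k)%N -> cabs x <= 1 -> rnorm (p k x - p i x) <= 2 * K * 2^-1 ^+ i.
  move=> ik x1; apply: le_trans (pstep _ _ _ ik x1) _.
  by rewrite lerBlDr lerDl mulr_ge0 ?mulr_ge0 ?exprn_ge0// invr_ge0.
have e0 : (fun i => 2 * K * 2^-1 ^+ i) @ \oo --> (0 : R).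
  rewrite -[X in _ --> X](mulr0 (2 * K)); apply: cvgMl_tmp; apply: cvg_expr.
  by rewrite ger0_norm ?invr_ge0// invf_lt1// ltr1n.
have [g gP] : exists g : R[i]^o -> V, forall x, cabs x <= 1 -> p n x @[n --> \oo] --> g x.
  have H (x : R[i]^o) : exists l : V, cabs x <= 1 -> p n x @[n --> \oo] --> l.
    have [x1|x1] := leP (cabs x) 1; last by exists 0.
    have [l hl] : exists l : V, (p ^~ x) @ \oo --> l; last by exists l.
    apply: cauchy_rnorm_cvg => e ep.
    have /cvgrPdist_le/(_ _ ep)[n0 _ h] := e0; exists n0 => n n0n.
    apply: le_trans (pcauchy _ _ _ n0n x1) _.
    by have := h n0 (leqnn _); rewrite sub0r normrN; apply: le_trans; exact: ler_norm.
  by have [g gH] := choice H; exists g.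
have gd x : cabs x < 1 -> cdiff g x.
  apply: (@weierstrass _ _ p (fun i => 2 * K * 2^-1 ^+ i)) => //.
  - move=> n w w1; apply: (@cdiff_affine _ _ (fun x : R[i]^o => interp n v x)).
    exact: cdiff_interp.
  - by move=> i k w ik w1; apply: pcauchy => //; rewrite w1.
  - by move=> w w1; apply: gP; exact: ltW.
have gu x : cabs x <= 3^-1 -> interp n v x @[n --> \oo] --> u x -> g (3 * x) = u x.
  move=> x3' ux; have x1 : cabs (3 * x) <= 1.
    by rewrite cabsM cabs_natr -ler_pdivlMl// mulr1.
  have pux : p n (3 * x) @[n --> \oo] --> u x.
    apply: (eq_cvg_to _ ux) => n.
    by rewrite /p addr0 mulKf// pnatr_eq0.
  exact: (cvg_unique _ (gP _ x1) pux).
(* [gd] covers the open disc only; halving the radius makes [h] differentiable for |x| < 2, hence on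
   the closed disc that [norm_constant] requires. *)
pose h (x : R[i]^o) : V := g (2^-1 * x + 0).
have hd (x : R[i]) : cabs x < 2 -> cdiff h x.
  move=> x2; apply: (@cdiff_affine _ _ g); apply: gd.
  by rewrite addr0 cabsM cabsV cabs_natr ltr_pdivrMl// mulr1.
have hu x : cabs x <= 1 -> interp n v (x / 6) @[n --> \oo] --> u (x / 6) -> h x = u (x / 6).
  move=> x1 ux; rewrite -gu//.
    by rewrite /h; congr g; rewrite addr0; field.
  rewrite cabsM cabsV cabs_natr ler_pdivrMr//; apply: le_trans x1 _.
  by rewrite (_ : _ * _ = 2) ?ler1n//; field.
have root1 j m : cabs (root2 R j ^+ m) <= 1 by rewrite cabsX cabs_root2 expr1n.
have hconst x : cabs x <= 3^-1 -> rnorm (h x) = rnorm (h 0).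
  apply: norm_constant => [w w1|j].
    by apply: hd; apply: le_lt_trans w1 _; rewrite ltr1n.
  rewrite rnormZc cabsV cabs_natr ler_wpM2l ?invr_ge0 ?ler0n//.
  rewrite (eq_bigr (fun m : 'I_(2 ^ j) => rnorm (u (root2 R j ^+ m / 6)))); last first.
    by move=> m _; rewrite (hu _ (root1 _ _) (ulim _ _)).
  rewrite [X in _ <= rnorm X](eq_bigr (fun m : 'I_(2 ^ j) => u (root2 R j ^+ m / 6))); last first.
    by move=> m _; rewrite (hu _ (root1 _ _) (ulim _ _)).
  exact: uadd.
have c6 : cabs (6 * z) <= 3^-1.
  by rewrite cabsM cabs_natr -ler_pdivlMl// (_ : _ / _ = 18^-1)//; field.
have hz : h (6 * z) = u z.
  have -> : u z = u (6 * z / 6) by congr u; field.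
  apply: hu; first by apply: le_trans c6 (ltW (lt13 _)).
  by have -> : 6 * z / 6 = z by field.
have h0 : h 0 = u 0.
  have -> : u 0 = u (0 / 6) by rewrite mul0r.
  by apply: hu; rewrite ?cabs0 ?ler01// mul0r.
rewrite -hz -h0; have [h00|h00] := eqVneq (rnorm (h 0)) 0.
  by rewrite (rnorm_eq0 h00); apply: rnorm_eq0; rewrite hconst.
have h0p : 0 < rnorm (h 0) by rewrite lt0r h00 rnorm_ge0.
(* Normalized to norm 1 and rescaled from |x| <= 1/3, where [hconst] holds. Differentiability of [h]
   for |x| < 2 yields the neighbourhood |x| < 6. *)
pose gam (x : R[i]^o) : V := ((rnorm (h 0))^-1)%:C%C *: h (3^-1 * x + 0).
have [|x x1|l gl] := psh gam.
- exists [set x | cabs x < 6], gam; split=> //.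
  + rewrite openE => x /= x6; apply/nbhs_cabs; exists (6 - cabs x); first by rewrite subr_gt0.
    move=> w wx; rewrite -[w](subrK x); apply: le_lt_trans (ler_cabsD _ _) _.
    by rewrite -ltrBrDr.
  + move=> x /closed_discE x1 /=; apply: le_lt_trans x1 _; by rewrite ltr1n.
  + move=> x /= x6; apply: derivable_scale; first exact: derivable_cst.
    apply/derivable_cdiffP/(@cdiff_affine _ _ h)/hd.
    by rewrite addr0 cabsM cabs_inv3 ltr_pdivrMl// -natrM.
- have /closed_discE {}x1 := x1.
  rewrite rnormE rnormZc cabs_real ger0_norm ?invr_ge0 ?rnorm_ge0//.
  by rewrite hconst ?x3// mulVf// rmorph1.
have g1 : gam (18 * z) = l.
  apply/gl/closed_discE; rewrite cabsM cabs_natr -ler_pdivlMl// mulr1//.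
have g2 : gam 0 = l by apply/gl/closed_discE; rewrite cabs0.
have : gam (18 * z) = gam 0 by rewrite g1 g2.
rewrite /gam mulr0 !addr0 => /scalerI E; rewrite -E; last first.
  by rewrite -cabs_gt0 cabs_real normr_gt0 invr_eq0.
by congr h; field.
Qed.

End fiber.

(** * From a small disc to the whole disc *)

Section local_to_global.
Context (R : realType) (V : normedModType R[i]).

(** Once f = f 0 on |z| <= 1 - q ^ k, the hypothesis is applied to the discs of radius q ^ k centred
    on the boundary of this disc: they touch the unit circle from inside and push the radius out by
    q ^ k / 18, whence q = 17 / 18. Points of the unit circle follow by continuity. *)
Lemma strictly_psh_local :
  (forall f : R[i]^o -> V, (forall w, cabs w <= 1 -> cdiff f w) ->
    (forall w, cabs w <= 1 -> rnorm (f w) = 1) ->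
    forall z, cabs z <= 18^-1 -> f z = f 0) ->
  strictly_psh V.
Proof.
move=> loc gam [U [f [oU dU fU fgam]]] gam1.
have fd w : cabs w <= 1 -> cdiff f w.
  by move=> w1; apply/derivable_cdiffP/fU/dU/closed_discE.
have f1 w : cabs w <= 1 -> rnorm (f w) = 1.
  by move=> w1; rewrite fgam ?closed_discE// /rnorm gam1 ?closed_discE//.
pose q : R := 17 / 18.
have q0 : 0 <= q by rewrite divr_ge0.
have q1 : q < 1 by rewrite ltr_pdivrMr// mul1r ltr_nat.
have const_in k z : cabs z <= 1 - q ^+ k -> f z = f 0.
  elim: k z => [|k IH] z.
    rewrite expr0 subrr => z0; congr f; apply/eqP; rewrite -cabs_eq0.
    by rewrite eq_le z0 cabs_ge0.
  move=> zk; have qk0 : 0 < q ^+ k by rewrite exprn_gt0// divr_gt0.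
  have qk1 : q ^+ k <= 1 by rewrite exprn_ile1// ltW.
  have [/IH//|kz] := leP (cabs z) (1 - q ^+ k).
  have cz0 : 0 < cabs z by apply: le_lt_trans kz; rewrite subr_ge0.
  pose z0 := ((1 - q ^+ k) / cabs z)%:C%C * z.
  have cz : cabs z0 = 1 - q ^+ k.
    rewrite /z0 cabsM cabs_real ger0_norm ?divfK ?gt_eqF//.
    by rewrite divr_ge0 ?subr_ge0// ltW.
  rewrite -(IH z0) ?cz//.
  pose r : R[i] := (q ^+ k)%:C%C.
  have cr : cabs r = q ^+ k by rewrite cabs_real gtr0_norm.
  have disc w : cabs w <= 1 -> cabs (r * w + z0) <= 1.
    move=> w1; apply: le_trans (ler_cabsD _ _) _; rewrite cabsM cr cz.
    by rewrite -lerBrDr opprB addrC subrK ler_piMr// ltW.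
  have r0 : r != 0 by rewrite -cabs_gt0 cr.
  have := loc (fun w => f (r * w + z0)) _ _ ((z - z0) / r).
  rewrite /= mulrCA divff// mulr1 subrK mulr0 add0r; apply.
  - by move=> w w1; apply: cdiff_affine; exact/fd/disc.
  - by move=> w w1; exact/f1/disc.
  rewrite cabsM cabsV cr ler_pdivrMr//.
  have -> : z - z0 = (1 - (1 - q ^+ k) / cabs z)%:C%C * z.
    by rewrite rmorphB rmorph1 mulrBl mul1r.
  rewrite cabsM cabs_real ger0_norm; last first.
    by rewrite subr_ge0 ler_pdivrMr// mul1r ltW.
  rewrite mulrBl divfK ?gt_eqF// mul1r.
  by move: zk; rewrite exprS /q; lra.
have const_open z : cabs z < 1 -> f z = f 0.
  move=> z1; have zp : 0 < 1 - cabs z by rewrite subr_gt0.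
  have : (q ^+ k) @[k --> \oo] --> 0 by apply: cvg_expr; rewrite ger0_norm.
  move=> /cvgrPdist_le/(_ _ zp)[k _ /(_ k (leqnn _))].
  rewrite sub0r normrN ger0_norm ?exprn_ge0// => h.
  by apply: (const_in k); rewrite lerBrDr -lerBrDl.
exists (f 0) => z /[dup] zd /closed_discE z1; rewrite -fgam//.
apply/eqP; rewrite -subr_eq0; apply/eqP/rnorm_eq0/eqP.
rewrite eq_le rnorm_ge0 andbT; apply/ler_addgt0Pr => e e0; rewrite add0r.
have [d d0 H] := cdiff_continuous (fd z z1) e0.
pose t := Num.min (1 / 2) (d / 2).
have t0 : 0 < t by rewrite lt_min !divr_gt0.
have td : t < d.
  apply: (@le_lt_trans _ _ (d / 2)); first by rewrite ge_min lexx orbT.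
  by rewrite ltr_pdivrMr// ltr_pMr// ltr1n.
have t1 : t <= 1 / 2 by rewrite ge_min lexx.
have czt : cabs ((1 - t)%:C%C * z) <= 1 - t.
  rewrite cabsM cabs_real ger0_norm; last by lra.
  by rewrite ler_piMr//; lra.
rewrite rnormC -(const_open ((1 - t)%:C%C * z)); last by apply: le_lt_trans czt _; lra.
apply: H; rewrite (_ : _ - z = - t%:C%C * z); last by rewrite rmorphB rmorph1; ring.
rewrite cabsM cabsN cabs_real gtr0_norm//; apply: le_lt_trans td.
by rewrite ler_piMr// ltW.
Qed.

End local_to_global.

(** * Direct integrals *)

Section Lnorm_extra.
Context (R : realType) d (T : measurableType d) (mu : {measure set T -> \bar R}).
Variable p : R.
Hypothesis p1 : (1 <= p%:E)%E.
Implicit Types u v : T -> R.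

Let p0 : 0 < p. Proof. by rewrite -lte_fin (lt_le_trans _ p1)// lte_fin. Qed.
Let rp1 : 1 <= p. Proof. by rewrite -lee_fin. Qed.

Lemma Lnorm_powR u : (forall x, 0 <= u x) ->
  ('N[mu]_p%:E[EFin \o u] `^ p = \int[mu]_x (u x `^ p)%:E)%E.
Proof.
move=> u0; rewrite poweR_Lnorm ?gt_eqF//; apply: eq_integral => x _ /=.
by rewrite ger0_norm.
Qed.

Lemma measurable_powR_fun u : measurable_fun setT u ->
  measurable_fun setT (EFin \o (fun x => u x `^ p)).
Proof.
move=> mu_; apply/measurable_EFinP.
exact: (@measurableT_comp _ _ _ _ _ _ (@powR R ^~ p)).
Qed.

(** The integral of v ^ p is at most that of u ^ p, which is finite, while u ^ p <= v ^ p almost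
    everywhere; so the difference has integral 0. *)
Lemma Lnorm_le_ae_eq u v : measurable_fun setT u -> measurable_fun setT v ->
  (forall x, 0 <= u x) -> (forall x, 0 <= v x) ->
  {ae mu, forall x, u x <= v x} ->
  ('N[mu]_p%:E[EFin \o v] <= 'N[mu]_p%:E[EFin \o u])%E ->
  ('N[mu]_p%:E[EFin \o u] < +oo)%E ->
  {ae mu, forall x, u x = v x}.
Proof.
move=> mu_ mv u0 v0 uv Nvu Nu.
(* Truncated at 0 because [uv] holds only almost everywhere, whereas [ge0_integralD] wants
   nonnegativity everywhere. *)
pose g x := Num.max (v x `^ p - u x `^ p) 0.
have g0 x : 0 <= g x by rewrite /g le_max lexx orbT.
have mup := measurable_powR_fun mu_; have mvp := measurable_powR_fun mv.
have mg : measurable_fun setT (EFin \o g).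
  apply/measurable_EFinP; apply: measurable_maxr; last exact: measurable_cst.
  by apply: measurable_funB; exact/measurable_EFinP.
have iu : (\int[mu]_x (u x `^ p)%:E < +oo)%E.
  by rewrite -Lnorm_powR//; apply: poweR_lty.
have ig : (\int[mu]_x (g x)%:E = 0)%E.
  apply/eqP; rewrite eq_le integral_ge0 ?andbT; last by move=> x _; rewrite lee_fin.
  have : (\int[mu]_x ((u x `^ p)%:E + (g x)%:E) <= \int[mu]_x (u x `^ p)%:E)%E.
    apply: (@le_trans _ _ (\int[mu]_x (v x `^ p)%:E)%E).
      apply: ae_ge0_le_integral => //.
      - by move=> x _; rewrite adde_ge0 ?lee_fin ?powR_ge0.
      - exact: emeasurable_funD.
      - by move=> x _; rewrite lee_fin powR_ge0.
      apply: filterS uv => x uvx _; rewrite -EFinD lee_fin /g.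
      rewrite max_l ?[u x `^ p + _]addrC ?subrK// subr_ge0.
      by rewrite ge0_ler_powR ?nnegrE// ltW.
    rewrite -!Lnorm_powR//; apply: gt0_ler_poweR; rewrite ?in_itv/= ?leey ?andbT ?Lnorm_ge0//.
    exact: ltW.
  rewrite ge0_integralD//; last 2 first.
  - by move=> x _; rewrite lee_fin powR_ge0.
  - by move=> x _; rewrite lee_fin.
  have iufin : (\int[mu]_x (u x `^ p)%:E)%E \is a fin_num.
    by rewrite ge0_fin_numE// integral_ge0// => x _; rewrite lee_fin powR_ge0.
  by rewrite -[leRHS]adde0 leeD2lE.
have : ae_eq mu setT (EFin \o g) (cst 0%E).
  apply/ae_eq_integral_abs => //; rewrite -[RHS]ig; apply: eq_integral => x _.
  by rewrite gee0_abs// lee_fin.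
apply: filterS2 uv => x uvx /(_ I)[] gx0; apply/eqP; rewrite eq_le uvx /=.
have : v x `^ p - u x `^ p <= 0 by rewrite -gx0 /g le_max lexx.
rewrite subr_le0; apply: contraTT; rewrite -!ltNge => uv'.
by rewrite gt0_ltr_powR ?nnegrE.
Qed.

Lemma Lnorm_sum (I : Type) (r : seq I) (u : I -> T -> R) :
  (forall i, measurable_fun setT (u i)) ->
  ('N[mu]_p%:E[EFin \o (fun x => \sum_(i <- r) u i x)%R] <=
   \sum_(i <- r) 'N[mu]_p%:E[EFin \o u i])%E.
Proof.
move=> mu_; elim: r => [|i r IH].
  rewrite big_nil (@eq_Lnorm _ _ _ _ _ _ (cst 0%E)) ?Lnorm0 ?gt_eqF ?lte_fin//.
  by move=> x /=; rewrite big_nil.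
rewrite big_cons; apply: le_trans (leeD2l _ IH).
rewrite (@eq_Lnorm _ _ _ _ _ _ (EFin \o (u i \+ (fun x => \sum_(i <- r) u i x))%R)).
  apply: eminkowski => //; exact: measurable_sum.
by move=> x /=; rewrite big_cons.
Qed.

(** Since p >= 1, the integral of (2 ^ j * u j) ^ p is at most K ^ p * 2 ^ -j. The sum of these
    functions is integrable, hence finite almost everywhere, and bounds each of them. *)
Lemma Lnorm_geometric_bound (u : nat -> T -> R) (K : R) :
  (forall j, measurable_fun setT (u j)) -> (forall j x, 0 <= u j x) ->
  (forall j, ('N[mu]_p%:E[EFin \o u j] <= (K * 4^-1 ^+ j)%:E)%E) ->
  {ae mu, forall x, exists M, forall j, u j x <= M * 2^-1 ^+ j}.
Proof.
move=> mu_ u0 uK.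
have K0 : 0 <= K.
  by have := uK 0%N; rewrite expr0 mulr1 -lee_fin; apply: le_trans; exact: Lnorm_ge0.
pose F j x := ((2 ^+ j * u j x) `^ p)%:E.
have F0 j x : (0 <= F j x)%E by rewrite lee_fin powR_ge0.
have mF j : measurable_fun setT (F j).
  by apply: (@measurable_powR_fun (fun x => 2 ^+ j * u j x)); exact: measurable_funM.
(* The factor 2 compensates for the exponent j.+1 in [epsilon_trick0]. *)
pose C : R := 2 * K `^ p.
have C0 : 0 <= C by rewrite mulr_ge0 ?powR_ge0.
have intF j : (\int[mu]_x F j x <= (C / (2 ^ j.+1)%:R)%:E)%E.
  rewrite -Lnorm_powR; last by move=> x; rewrite mulr_ge0 ?exprn_ge0.
  rewrite Lnorm_scale//; last first.
    by rewrite /finite_norm; apply: le_lt_trans (uK j) _; rewrite ltry.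
  rewrite ger0_norm ?exprn_ge0//.
  apply: (@le_trans _ _ ((K * 2^-1 ^+ j) `^ p)%:E).
    rewrite -poweR_EFin; apply: gt0_ler_poweR; rewrite ?in_itv/= ?leey ?andbT ?(ltW p0)//.
    - by rewrite mule_ge0// ?lee_fin ?exprn_ge0// Lnorm_ge0.
    - by rewrite lee_fin mulr_ge0// exprn_ge0.
    apply: le_trans (lee_wpmul2l _ (uK j)) _; first by rewrite lee_fin exprn_ge0.
    rewrite -EFinM lee_fin mulrCA ler_wpM2l// -exprMn.
    by rewrite (_ : 2 * 4^-1 = 2^-1)//; field.
  rewrite lee_fin powRM ?exprn_ge0 ?invr_ge0// /C expnS natrM natrX.
  rewrite (_ : 2 * K `^ p / (2 * 2 ^+ j) = K `^ p * 2^-1 ^+ j); last first.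
    by rewrite exprVn; field; rewrite expf_neq0.
  rewrite ler_wpM2l ?powR_ge0//.
  rewrite ge1r_powR// exprn_gt0 ?invr_gt0//= exprn_ile1// ?invr_ge0//.
  by rewrite invf_le1// ler1n.
have : (\int[mu]_x (\sum_(j <oo) F j x) < +oo)%E.
  rewrite integral_nneseries//.
  apply: (@le_lt_trans _ _ (\sum_(j <oo) (C / (2 ^ j.+1)%:R)%:E)%E).
    by apply: lee_nneseries => // j _ _; apply: integral_ge0.
  by apply: le_lt_trans (epsilon_trick0 xpredT C0) _; rewrite ltry.
move=> intS.
have mS : measurable_fun setT (fun x => \sum_(j <oo) F j x)%E.
  by apply: ge0_emeasurable_sum.
have : mu.-integrable setT (fun x => \sum_(j <oo) F j x)%E.
  apply/integrableP; split=> //.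
  rewrite (eq_integral (fun x => \sum_(j <oo) F j x)%E)// => x _.
  by rewrite gee0_abs// nneseries_ge0.
move=> /(integrable_ae measurableT); apply: filterS => x /(_ I) Sfin.
pose B := fine (\sum_(j <oo) F j x)%E.
(* The 1 covers the case 2 ^+ j * u j x <= 1, where the p-th power need not dominate its base. *)
exists (1 + B) => j.
have Fj : (2 ^+ j * u j x) `^ p <= B.
  rewrite -lee_fin /B fineK//.
  have := @nneseries_lim_ge R (fun j => F j x) xpredT 0 j.+1 (fun n _ _ => F0 n x).
  apply: le_trans; rewrite big_nat_recr//= leeDr//.
  by apply: sume_ge0 => i _.
have B0 : 0 <= B by apply: le_trans Fj; exact: powR_ge0.
have y0 : 0 <= 2 ^+ j * u j x by rewrite mulr_ge0 ?exprn_ge0.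
have : 2 ^+ j * u j x <= 1 + B.
  have [y1|y1] := leP (2 ^+ j * u j x) 1; first by rewrite (le_trans y1)// lerDl.
  apply: (@le_trans _ _ B); last by rewrite lerDr.
  apply: le_trans Fj; by rewrite le1r_powR// ltW.
by rewrite exprVn ler_pdivlMr ?exprn_gt0// mulrC.
Qed.

End Lnorm_extra.

Lemma ae_forall_ord (R : realType) d (T : measurableType d) (mu : {measure set T -> \bar R})
    n (P : 'I_n -> T -> Prop) :
  (forall i, {ae mu, forall x, P i x}) -> {ae mu, forall x, forall i, P i x}.
Proof.
move=> H.
have : {ae mu, forall x, forall k, if insub k is Some i then P i x else True}.
  by apply: ae_foralln => k; case: insubP => [i _ _|_]; [exact: H|exact: aeW].
by apply: filterS => x Hx i; have := Hx (val i); rewrite valK.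
Qed.

Section Lp_representatives.
Context (R : realType) d (S : measurableType d) (mu : {measure set S -> \bar R}).
Context (E : S -> completeNormedModType R[i]) (p : R).
Hypotheses (mE : measurable_family E) (p1 : (1 <= p%:E)%E).

Local Notation V := (Lp mu mE p1).
Implicit Types x y : V.

(** A fixed choice of representatives; it respects the operations only off a null set depending on
    the vectors involved. *)
Definition sec x : section E := val (repr x).

Lemma sec_pi (u : Lp_sections mu mE p1) :
  {ae mu, forall s, sec (\pi_V u) s = val u s}.
Proof. by apply/Lp_piP; rewrite reprK. Qed.

Lemma sec_inj x y : {ae mu, forall s, sec x s = sec y s} -> x = y.
Proof. by move=> /Lp_piP/eqP; rewrite !reprK. Qed.

Lemma secD x y : {ae mu, forall s, sec (x + y) s = sec x s + sec y s}.
Proof.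
have := sec_pi (repr x + repr y).
by rewrite pi_LpD !reprK.
Qed.

Lemma secZ (c : R[i]) x : {ae mu, forall s, sec (c *: x) s = c *: sec x s}.
Proof. by have := sec_pi (c *: repr x); rewrite -(pi_Lp_scale c) reprK. Qed.

Lemma sec0 : {ae mu, forall s, sec (0 : V) s = 0}.
Proof. by have := secZ 0 0; apply: filterS => s; rewrite !scale0r. Qed.

Lemma sec_sum (I : Type) (r : seq I) (c : I -> R[i]) (x : I -> V) :
  {ae mu, forall s, sec (\sum_(i <- r) c i *: x i) s = \sum_(i <- r) c i *: sec (x i) s}.
Proof.
elim: r => [|i r IH].
  by apply: filterS sec0 => s; rewrite !big_nil.
rewrite big_cons.
apply: filterS3 (secD (c i *: x i) (\sum_(j <- r) c j *: x j)) (secZ (c i) (x i)) IH => s.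
by rewrite big_cons => -> -> ->.
Qed.

Lemma sec_avg j (g : R[i] -> R[i]) (x : R[i] -> V) :
  {ae mu, forall s, sec (avg j (fun w => g w *: x w)) s = avg j (fun w => g w *: sec (x w) s)}.
Proof.
have H := sec_sum (index_enum 'I_(2 ^ j)) (fun m : 'I_(2 ^ j) => g (root2 R j ^+ m))
  (fun m => x (root2 R j ^+ m)).
have Z := secZ (2 ^ j)%:R^-1 (\sum_(m < 2 ^ j) g (root2 R j ^+ m) *: x (root2 R j ^+ m)).
by apply: filterS2 Z H => s; rewrite /avg => -> ->.
Qed.

Lemma secB x y : {ae mu, forall s, sec (x - y) s = sec x s - sec y s}.
Proof.
rewrite -scaleN1r; apply: filterS2 (secD x (-1 *: y)) (secZ (-1) y) => s -> ->.
by rewrite scaleN1r.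
Qed.

Lemma measurable_sec x : measurable_fun setT (fun s => rnorm (sec x s)).
Proof.
have /asboolP[[/measurable_section_rnorm + _] _] := valP (repr x); exact.
Qed.

Lemma rnorm_sec x : 'N[mu]_p%:E[EFin \o (fun s => rnorm (sec x s))]%E = (rnorm x)%:E.
Proof.
have -> : rnorm x = fine (section_norm mu p%:E (sec x)) by [].
by rewrite fineK// section_norm_fin_num.
Qed.

(** By Minkowski and the hypothesis, the sum of the fibre norms has p-norm at most that of the norm
    of the sum, which it dominates pointwise; [Lnorm_le_ae_eq] makes them equal. *)
Lemma sec_sum_eq n (x : 'I_n -> V) :
  \sum_(i < n) rnorm (x i) <= rnorm (\sum_(i < n) x i) ->
  {ae mu, forall s, \sum_(i < n) rnorm (sec (x i) s) <= rnorm (\sum_(i < n) sec (x i) s)}.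
Proof.
move=> xle; pose y := \sum_(i < n) x i.
have yE : {ae mu, forall s, sec y s = \sum_(i < n) sec (x i) s}.
  have -> : y = \sum_(i < n) 1 *: x i by apply: eq_bigr => i _; rewrite scale1r.
  apply: filterS (sec_sum (index_enum 'I_n) (fun=> 1) x) => s ->.
  by apply: eq_bigr => i _; rewrite scale1r.
have ms i : measurable_fun setT (fun s => rnorm (sec (x i) s)) by exact: measurable_sec.
have : {ae mu, forall s, rnorm (sec y s) = \sum_(i < n) rnorm (sec (x i) s)}.
  apply: (@Lnorm_le_ae_eq _ _ _ mu p p1 (fun s => rnorm (sec y s))
    (fun s => \sum_(i < n) rnorm (sec (x i) s))).
  - exact: measurable_sec.
  - exact: measurable_sum.
  - by move=> s; exact: rnorm_ge0.
  - by move=> s; apply: sumr_ge0 => i _; exact: rnorm_ge0.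
  - by apply: filterS yE => s ->; exact: ler_rnorm_sum.
  - apply: le_trans (Lnorm_sum mu p1 _ ms) _.
    rewrite rnorm_sec (eq_bigr (fun i => (rnorm (x i))%:E)); last first.
      by move=> i _; exact: rnorm_sec.
    by rewrite sumEFin lee_fin.
  - by rewrite rnorm_sec ltry.
by apply: filterS2 yE => s -> ->.
Qed.

Lemma sec_geometric (n : nat -> nat) (x : forall j, 'I_(n j) -> V) (K : R) :
  (forall j, \sum_(i < n j) rnorm (x j i) <= K * 4^-1 ^+ j) ->
  {ae mu, forall s, exists M, forall j, \sum_(i < n j) rnorm (sec (x j i) s) <= M * 2^-1 ^+ j}.
Proof.
move=> xK; apply: (@Lnorm_geometric_bound _ _ _ mu p p1
  (fun j s => \sum_(i < n j) rnorm (sec (x j i) s)) K).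
- by move=> j; apply: measurable_sum => i; exact: measurable_sec.
- by move=> j s; apply: sumr_ge0 => i _; exact: rnorm_ge0.
move=> j; apply: le_trans (Lnorm_sum mu p1 _ _) _; first by move=> i; exact: measurable_sec.
rewrite (eq_bigr (fun i => (rnorm (x j i))%:E)); last by move=> i _; exact: rnorm_sec.
by rewrite sumEFin lee_fin; exact: xK.
Qed.

End Lp_representatives.

(** For [interp_err_geometric]: with n = 2 ^ j and n (n + 1) <= 2 n^2, the constant 24 there is 6
    times the 4 here. The induction starts at 4, from where ((m + 1) / m) ^ 4 <= 625 / 256 < 3. *)
Lemma exp4_le_pow3 n : (n ^ 4 <= 4 * 3 ^ n)%N.
Proof.
have [|n4] := ltnP n 4; first by case: n => [|[|[|[|]]]].
rewrite -(subnK n4); elim: (n - 4)%N => // k IH.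
rewrite addSn (expnS 3); move: IH; set m := (k + 4)%N => IH.
have m4 : (4 <= m)%N by rewrite leq_addl.
suff : (m.+1 ^ 4 <= 3 * m ^ 4)%N by lia.
have : ((4 * m.+1) ^ 4 <= (5 * m) ^ 4)%N by rewrite leq_exp2r//; lia.
rewrite !expnMn; set a := (m.+1 ^ 4)%N; set b := (m ^ 4)%N.
by rewrite (_ : 4 ^ 4 = 256)%N// (_ : 5 ^ 4 = 625)%N//; lia.
Qed.

(** The factor 2 ^ j.+1 counts the nodes of the next level, over which the errors are summed; 4^-1
    ^+ j is the rate that [Lnorm_geometric_bound] expects. *)
Lemma interp_err_geometric (R : realType) j :
  (2 ^ j.+1)%:R * interp_err R j <= 24 * 4^-1 ^+ j.
Proof.
rewrite /interp_err; set N := (2 ^ j)%N.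
have N1 : 1 <= N%:R :> R by rewrite ler1n expn_gt0.
have -> : (2 ^ j.+1)%:R = 2 * N%:R :> R by rewrite expnS natrM.
have -> : 4^-1 ^+ j = (N%:R ^+ 2)^-1 :> R.
  by rewrite exprVn; congr (_^-1); rewrite -!natrX /N -expnM mulnC expnM.
have h : N%:R ^+ 4 <= 4 * 3 ^+ N :> R.
  by have := exp4_le_pow3 N; rewrite -(ler_nat R) natrM !natrX.
have p3 : 0 < 3 ^+ N :> R by rewrite exprn_gt0.
have p2 : 0 < N%:R ^+ 2 :> R by rewrite exprn_gt0// (lt_le_trans _ N1).
rewrite exprVn ler_pdivlMr// mulrC mulrA mulrA mulrA ler_pdivrMr//.
move: h N1; set x := N%:R; set y := _ ^+ N; nra.
Qed.

(** * From the fibres to the direct integral *)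

Section Lp_strictly_psh.
Context (R : realType) d (S : measurableType d) (mu : {measure set S -> \bar R}).
Context (E : S -> completeNormedModType R[i]) (p : R).
Hypotheses (mE : measurable_family E) (p1 : (1 <= p%:E)%E).

Local Notation V := (Lp mu mE p1).


Lemma sec_interp j (x : R[i] -> V) z :
  {ae mu, forall s, sec (interp j x z) s = interp j (fun w => sec (x w) s) z}.
Proof. exact: sec_avg. Qed.

(** One [K] serves all [z] although only countably many null sets are discarded: by [interpS] the
    difference interpolates the residuals at 2 ^ j.+1 nodes, and [rnorm_interp_sum] bounds it by the
    sum of their norms. *)
Lemma interp_Lp_step (f : R[i]^o -> V) :
  (forall w, cabs w <= 1 -> cdiff f w) -> (forall w, cabs w = 1 -> rnorm (f w) <= 1) ->
  {ae mu, forall s, exists K, forall j z, cabs z <= 3^-1 ->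
    rnorm (interp j.+1 (fun w => sec (f (w / 3)) s) z - interp j (fun w => sec (f (w / 3)) s) z)
      <= K * 2^-1 ^+ j}.
Proof.
move=> fd f1; pose q j z : V := interp j (fun w => f (w / 3)) z.
pose x j (m : 'I_(2 ^ j.+1)) : V := f (root2 R j.+1 ^+ m / 3) - q j (root2 R j.+1 ^+ m / 3).
have c3 j m : cabs (root2 R j ^+ m / 3) <= 3^-1.
  by rewrite cabsM cabs_inv3 cabsX cabs_root2 expr1n mul1r.
have xK j : \sum_(i < 2 ^ j.+1) rnorm (x j i) <= 24 * 4^-1 ^+ j.
  apply: le_trans (interp_err_geometric R j).
  apply: (@le_trans _ _ (\sum_(i < 2 ^ j.+1) interp_err R j)).
    by apply: ler_sum => i _; exact: holomorphic_interp.
  by rewrite sumr_const card_ord mulr_natl.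
have xE : {ae mu, forall s, forall j m, sec (x j m) s = sec (f (root2 R j.+1 ^+ m / 3)) s -
    interp j (fun w => sec (f (w / 3)) s) (root2 R j.+1 ^+ m / 3)}.
  apply: ae_foralln => j; apply: ae_forall_ord => m.
  have B := secB (f (root2 R j.+1 ^+ m / 3)) (q j (root2 R j.+1 ^+ m / 3)).
  by apply: filterS2 B (sec_interp j (fun w => f (w / 3)) (root2 R j.+1 ^+ m / 3)) => s -> ->.
apply: filterS2 xE (sec_geometric xK) => s xE [K HK]; exists K => j z z3.
rewrite -[X in _ - X]interpS interpB.
apply: le_trans (rnorm_interp_sum _ _ z3) _; apply: le_trans (HK j).
by apply: ler_sum => m _; rewrite xE.
Qed.

Lemma interp_Lp_cvg (f : R[i]^o -> V) z :
  (forall w, cabs w <= 1 -> cdiff f w) -> (forall w, cabs w = 1 -> rnorm (f w) <= 1) ->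
  cabs z <= 3^-1 ->
  {ae mu, forall s, interp n (fun w => sec (f (w / 3)) s) z @[n --> \oo] --> sec (f z) s}.
Proof.
move=> fd f1 z3.
(* A family with a single index, to fit [sec_geometric]. *)
pose x j (m : 'I_1) : V := interp j (fun w => f (w / 3)) z - f z.
have xK j : \sum_(i < 1) rnorm (x j i) <= 24 * 4^-1 ^+ j.
  rewrite big_ord1; apply: le_trans (interp_err_geometric R j).
  rewrite rnormC; apply: le_trans (holomorphic_interp j fd f1 z3) _.
  rewrite ler_peMl ?ler1n ?expn_gt0//.
  by apply: le_trans (holomorphic_interp j fd f1 z3); exact: rnorm_ge0.
have xE : {ae mu, forall s, forall j, sec (x j ord0) s =
    interp j (fun w => sec (f (w / 3)) s) z - sec (f z) s}.
  apply: ae_foralln => j.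
  have B := secB (interp j (fun w => f (w / 3)) z) (f z).
  by apply: filterS2 B (sec_interp j (fun w => f (w / 3)) z) => s -> ->.
apply: filterS2 xE (sec_geometric xK) => s xE [K HK].
apply/cvg_rnormP => e e0.
have : K * 2^-1 ^+ j @[j --> \oo] --> (0 : R).
  rewrite -[X in _ --> X](mulr0 K); apply: cvgMl_tmp; apply: cvg_expr.
  by rewrite ger0_norm ?invr_ge0// invf_lt1// ltr1n.
move=> /cvgrPdist_le/(_ _ e0); apply: filterS => j; rewrite sub0r normrN => h.
rewrite -xE; apply: le_trans h; apply: le_trans (ler_norm _).
by have := HK j; rewrite big_ord1.
Qed.

Lemma Lp_strictly_psh : {ae mu, forall s, strictly_psh (E s)} -> strictly_psh V.
Proof.
move=> psh; apply: strictly_psh_local => f fd f1 z z18.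
have f1' w : cabs w = 1 -> rnorm (f w) <= 1 by move=> w1; rewrite f1 ?w1.
have c6 j m : cabs (root2 R j ^+ m / 6) <= 3^-1.
  rewrite cabsM cabsX cabs_root2 expr1n mul1r cabsV cabs_natr lef_pV2 ?posrE//.
  by rewrite ler_nat.
have z3 : cabs z <= 3^-1 by apply: le_trans z18 _; rewrite lef_pV2 ?posrE// ler_nat.
(* Adding the bounds of [harnack] at N points gives 2 N - |sum of the values| <= N, so the sum has
   norm at least N, which is the sum of the norms. *)
have add j : \sum_(m < 2 ^ j) rnorm (f (root2 R j ^+ m / 6)) <=
    rnorm (\sum_(m < 2 ^ j) f (root2 R j ^+ m / 6)).
  have c1 w : cabs w <= 3^-1 -> cabs w <= 1 by move=> h; apply: le_trans h (ltW (lt13 _)).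
  have hk (m : 'I_(2 ^ j)) : rnorm (2 *: f 0 - f (root2 R j ^+ m / 6)) <= 1.
    by apply: harnack.
  have : rnorm (\sum_(m < 2 ^ j) (2 *: f 0 - f (root2 R j ^+ m / 6))) <= (2 ^ j)%:R.
    apply: le_trans (ler_rnorm_sum _ _ _) _.
    by rewrite -[X in _ <= X%:R]card_ord -sumr_const; apply: ler_sum.
  rewrite sumrB sumr_const card_ord => h.
  have := le_trans (ler_rnormB _ _) h.
  rewrite -[2 *: f 0 *+ _]scaler_nat !rnormZc !cabs_natr f1 ?cabs0// mulr1.
  rewrite (eq_bigr (fun=> 1)); last by move=> m _; rewrite f1 ?c1.
  by rewrite sumr_const card_ord; lra.
have z0 : cabs 0 <= 3^-1 :> R by rewrite cabs0 invr_ge0.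
have Hu : {ae mu, forall s, forall j m,
    interp n (fun w => sec (f (w / 3)) s) (root2 R j ^+ m / 6) @[n --> \oo] -->
    sec (f (root2 R j ^+ m / 6)) s}.
  by apply: ae_foralln => j; apply: ae_foralln => m; exact: interp_Lp_cvg.
have Ha : {ae mu, forall s, forall j, \sum_(m < 2 ^ j) rnorm (sec (f (root2 R j ^+ m / 6)) s) <=
    rnorm (\sum_(m < 2 ^ j) sec (f (root2 R j ^+ m / 6)) s)}.
  by apply: ae_foralln => j; apply: sec_sum_eq.
(* With [z] fixed, the null sets attached to [z] and 0 join the countably many attached to the nodes
   and to the points of radius 1/6. *)
apply: sec_inj.
apply: filterS3 (filterI (interp_Lp_cvg fd f1' z3) (interp_Lp_cvg fd f1' z0))
  (filterI Hu Ha) (filterI psh (interp_Lp_step fd f1')) => s [Hz H0] [us as_] [pshs [K HK]].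
exact: (@fiber_constant _ _ (fun w => sec (f (w / 3)) s) (fun w => sec (f w) s) K).
Qed.

End Lp_strictly_psh.

(** * From the direct integral to the fibres *)

Lemma strictly_psh_isometry (R : realType) (V W : normedModType R[i]) (iota : V -> W) :
  (forall (c : R[i]) x y, iota (c *: x + y) = c *: iota x + iota y) ->
  (forall x, rnorm (iota x) = rnorm x) ->
  strictly_psh W -> strictly_psh V.
Proof.
move=> lin iso psh gam [U [f [oU dU fU fgam]]] gam1.
have iota0 : iota 0 = 0 by apply: rnorm_eq0; rewrite iso rnorm0.
have iotaZ c x : iota (c *: x) = c *: iota x by rewrite -[c *: x]addr0 lin iota0 addr0.
have iotaB x y : iota (x - y) = iota x - iota y.
  by rewrite addrC -scaleN1r lin scaleN1r addrC.
have [||v Hv] := psh (iota \o gam).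
- exists U, (iota \o f); split=> //; last by move=> z /fgam /= ->.
  move=> z /fU/derivable_cdiffP [D HD]; apply/derivable_cdiffP; exists (iota D).
  move=> e /HD [d' d0 H]; exists d' => // w /H.
  by rewrite -[rnorm (_ - _ - _)]iso !iotaB iotaZ.
- by move=> z /gam1 /=; rewrite !rnormE iso.
exists (gam 0) => z z1; have d0 : closed_disc (0 : R[i]^o) by apply/closed_discE; rewrite cabs0.
apply/eqP; rewrite -subr_eq0; apply/eqP/rnorm_eq0.
by rewrite -iso iotaB; have /= -> := Hv _ z1; have /= -> := Hv _ d0; rewrite subrr rnorm0.
Qed.

Section step_sections.
Context (R : realType) d (S : measurableType d) (mu : {measure set S -> \bar R}).
Context (E : S -> completeNormedModType R[i]) (p : R).
Hypotheses (mE : measurable_family E) (p1 : (1 <= p%:E)%E).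

Lemma pi_spaces_eq s t : E s = E t <-> \pi_(spaces E) s = \pi_(spaces E) t.
Proof.
split=> [est|/eqP].
  by apply/eqP; rewrite piE; apply/asboolP.
by rewrite piE => /asboolP.
Qed.

Lemma measurable_same_space s : measurable (same_space_set E s).
Proof.
have := mE [set \pi_(spaces E) s]; congr measurable.
by apply/seteqP; split=> t /pi_spaces_eq.
Qed.

Lemma transport_trans (V W X : completeNormedModType R[i]) (e : V = W) (e' : W = X) x :
  transport e' (transport e x) = transport (etrans e e') x.
Proof. by case: X / e'; case: W / e. Qed.

(** Once [F] and [G] are identified, [e1] and [e2] prove the same equality of spaces and coincide by
    proof irrelevance. *)
Lemma existT_transport (F G : spaces E) (V : completeNormedModType R[i])
    (e1 : V = space_of F) (e2 : V = space_of G) (x : V) : F = G ->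
  existT _ F (transport e1 x) = existT _ G (transport e2 x) :> space_coprod E.
Proof. by move=> FG; subst G; rewrite (Prop_irrelevance e1 e2). Qed.

Variables (s : S) (A : set S).

(** The inner test produces the equality of spaces along which [x] is transported; it succeeds on
    all of [A] under [AS]. *)
Definition step (x : E s) : section E := fun t =>
  if pselect (A t) is left _ then
    if pselect (E s = E t) is left e then transport e x else 0
  else 0.

Lemma step_lin c (x y : E s) : step (c *: x + y) = c *: step x + step y.
Proof.
apply: sectionP => t; rewrite section_addE section_scaleE /step.
case: pselect => [_|_]; last by rewrite scaler0 addr0.
case: pselect => [e|_]; last by rewrite scaler0 addr0.
by rewrite transportD transportZ.
Qed.

Hypotheses (mA : measurable A) (AS : A `<=` same_space_set E s).

Lemma rnorm_step x t : rnorm (step x t) = rnorm x * \1_A t.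
Proof.
rewrite /step indicE; case: pselect => [At|nAt]; last first.
  by rewrite rnorm0 memNset// mulr0.
rewrite mem_set// mulr1; case: pselect => [e|]; first exact: transport_rnorm.
by have := AS At => /= /esym.
Qed.

Lemma to_coprod_step x t : A t ->
  to_coprod (step x) t = existT _ (\pi_(spaces E) s) (transport (space_ofE E s) x).
Proof.
move=> At; rewrite /to_coprod /step; case: pselect => // _.
case: pselect => [e|]; last by have := AS At => /= /esym.
rewrite transport_trans; apply: existT_transport.
by apply/pi_spaces_eq; rewrite e.
Qed.

(** In the coproduct the section takes a single value on [A] and agrees with the zero section
    elsewhere. So an open set pulls back to all or nothing of [A] plus a measurable part of the
    complement, and there is at most one nonzero value. *)
Lemma strongly_measurable_step x : strongly_measurable (step x).
Proof.
split.
  apply/measurable_sectionP => U oU.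
  have m0 := (measurable_sectionP _).1 (measurable_section0 mE) U oU.
  pose w := existT (fun F => space_of F : Type) (\pi_(spaces E) s) (transport (space_ofE E s) x).
  rewrite (_ : _ @^-1` _ = (A `&` [set _ | U w]) `|` (~` A `&` to_coprod (0 : section E) @^-1` U)).
    apply: measurableU; apply: measurableI => //; last exact: measurableC.
    have [Uw|Uw] := pselect (U w).
      by rewrite (_ : [set _ | _] = setT)//; apply/seteqP; split.
    by rewrite (_ : [set _ | _] = set0)//; apply/seteqP; split.
  have out t : ~ A t -> to_coprod (step x) t = to_coprod (0 : section E) t.
    by move=> nAt; rewrite /to_coprod /step; case: pselect.
  apply/seteqP; split=> t /=.
    have [At|nAt] := pselect (A t); first by rewrite to_coprod_step//; left.
    by rewrite out//; right.
  by move=> [[At]|[nAt]]; [rewrite to_coprod_step|rewrite out].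
exists (nonzero_values (step x)); split=> //; last exact: subset_closure.
apply: (@sub_countable _ _ _
  [set existT _ (\pi_(spaces E) s) (transport (space_ofE E s) x)]); last exact: countable1.
apply: subset_card_le => w [t /= nz <-]; rewrite to_coprod_step//.
by apply: contrapT => nAt; move/eqP: nz; apply; rewrite /step; case: pselect.
Qed.

Hypotheses (A0 : (0 < mu A)%E) (Afin : (mu A < +oo)%E).

Let p0 : 0 < p. Proof. by rewrite -lte_fin (lt_le_trans _ p1)// lte_fin. Qed.

Let indicN : ('N[mu]_p%:E[EFin \o \1_A] `^ p = mu A)%E.
Proof.
rewrite (Lnorm_powR mu p1); last by move=> t; rewrite indicE.
rewrite -[in RHS](setIT A) -integral_indic//; apply: eq_integral => t _.
by rewrite indicE; case: (_ \in _); rewrite ?powR1// powR0// gt_eqF.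
Qed.

(** The number mu(A) ^ (1 / p), by [indicN]; division by it makes [step_embedding] isometric. *)
Let K : R := fine 'N[mu]_p%:E[EFin \o \1_A].

Let indicK : 'N[mu]_p%:E[EFin \o \1_A]%E = K%:E.
Proof.
rewrite /K fineK// ge0_fin_numE ?Lnorm_ge0//.
by apply: (@lty_poweRy _ _ p); rewrite ?gt_eqF// indicN.
Qed.

Let K0 : 0 < K.
Proof.
rewrite lt0r -lee_fin -indicK Lnorm_ge0 andbT; apply/eqP => h.
by move: A0; rewrite -indicN indicK h poweR0r ?gt_eqF// ltxx.
Qed.

Lemma section_norm_step x : section_norm mu p%:E (step x) = (rnorm x * K)%:E.
Proof.
rewrite /section_norm (@eq_Lnorm _ _ _ _ _ _ (EFin \o (fun t => rnorm x * \1_A t))).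
  rewrite Lnorm_scale ?indicK ?ger0_norm ?rnorm_ge0//.
  by rewrite /finite_norm indicK ltry.
by move=> t /=; rewrite rnorm_step.
Qed.

Lemma step_Lp x : step x \in Lp_pred mu mE p1.
Proof.
apply/asboolP; split; first exact: strongly_measurable_step.
by rewrite section_norm_step ltry.
Qed.

Definition step_embedding (x : E s) : Lp mu mE p1 :=
  \pi_(Lp mu mE p1) (Sub (step ((K^-1)%:C%C *: x)) (step_Lp _) : Lp_sections mu mE p1).

Lemma step_embedding_lin c (x y : E s) :
  step_embedding (c *: x + y) = c *: step_embedding x + step_embedding y.
Proof.
have Z (u : Lp_sections mu mE p1) :
    c *: (\pi_(Lp mu mE p1) u : Lp mu mE p1) = \pi_(Lp mu mE p1) (c *: u).
  exact: pi_Lp_scale.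
rewrite /step_embedding Z -pi_LpD; congr (\pi_(Lp mu mE p1) _); apply: val_inj => /=.
by rewrite -step_lin; congr step; rewrite scalerDr !scalerA mulrC.
Qed.

Lemma rnorm_step_embedding x : rnorm (step_embedding x) = rnorm x.
Proof.
rewrite /rnorm Lp_normE /= section_norm_step /= -/(rnorm x).
by rewrite rnormZc cabs_real ger0_norm ?invr_ge0 ?(ltW K0)// mulrAC mulVf ?mul1r// gt_eqF.
Qed.

Lemma strictly_psh_fiber : strictly_psh (Lp mu mE p1) -> strictly_psh (E s).
Proof. exact: strictly_psh_isometry step_embedding_lin rnorm_step_embedding. Qed.

End step_sections.

(** If [B] met every piece of the finite-measure cover in a null set, it would be a countable union
    of null sets. *)
Lemma sigma_finite_subset (R : realType) d (T : measurableType d)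
    (mu : {measure set T -> \bar R}) (B : set T) :
  sigma_finite setT mu -> measurable B -> mu B != 0%E ->
  exists2 A, measurable A & [/\ A `<=` B, (0 < mu A)%E & (mu A < +oo)%E].
Proof.
move=> [F FT Ffin] mB B0; apply: contrapT => H; move/eqP: B0; apply.
have FB0 n : mu (B `&` F n) = 0%E.
  have [mF Fn] := Ffin n; have mBF : measurable (B `&` F n) by exact: measurableI.
  apply: contrapT => /eqP BF; apply: H; exists (B `&` F n) => //; split=> //.
    by rewrite lt_neqAle eq_sym BF measure_ge0.
  by apply: le_lt_trans Fn; apply: le_measure; rewrite ?inE//; exact: subIsetr.
have : mu.-negligible B.
  rewrite -[B]setIT FT setI_bigcupr; apply: negligible_bigcup => n.
  by apply/negligibleP; [apply: measurableI => //; case: (Ffin n)|exact: FB0].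
by move/negligibleP; exact.
Qed.

Theorem theorem2 (R : realType) (d : measure_display) (S : measurableType d)
    (mu : {measure set S -> \bar R})
    (E : S -> completeNormedModType R[i]) (p : R)
    (sfmu : sigma_finite [set: S] mu)
    (mE : measurable_family E) (dE : discrete_family E mu)
    (p1 : (1 <= p%:E)%E) :
  strictly_psh (Lp mu mE p1) <-> {ae mu, forall s, strictly_psh (E s)}.
Proof.
split; last exact: Lp_strictly_psh.
(* The exceptional set is the null set given by [dE]. Membership of [s] depends only on the class of
   [E s], so [mE] makes it measurable. *)
move=> psh; exists [set s | mu (same_space_set E s) = 0%E]; split=> //.
  have := mE [set F | mu [set t | E t = space_of F] = 0%E]; congr measurable.
  by apply/seteqP; split=> s /=; rewrite /same_space_set -space_ofE.
move=> s /= npsh; apply: contrapT => /eqP S0; apply: npsh.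
have [A mA [AS A0 Afin]] := sigma_finite_subset sfmu (measurable_same_space mE s) S0.
exact: strictly_psh_fiber mA AS A0 Afin psh.
Qed.
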